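(* For every bridgeless cubic graph $G$, $\nu_2(G) \geq \frac{44}{45}\cdot \frac{|V(G)| + 2\cdot \nu_3(G)}{4}$.
   Context: Graphs are finite, without loops, possibly with multiple edges; a graph is cubic if every vertex has degree $3$, and bridgeless if it has no edge whose removal increases the number of connected components. For $k\geq 1$, $\nu_k(G)$ is the maximum number of edges of a $k$-edge-colorable subgraph of $G$. *)

(* Defs.v *)
(* A finite loopless multigraph is given by a finite vertex
   type V, a finite edge type E and endpoint maps src tgt : E -> V
   (the orientation is irrelevant; edges are unordered). *)
From mathcomp Require Import all_boot all_order all_algebra.
Set Implicit Arguments. Unset Strict Implicit. Unset Printing Implicit Defensive.

Section Graphs.
Variables (V E : finType) (src tgt : E -> V).

Definition loopless : Prop := forall e, src e != tgt e.

Definition incident (e : E) (v : V) : bool := (src e == v) || (tgt e == v).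

(* degree = number of incident edges (no loops, so each counts once) *)
Definition degree (v : V) : nat := #|[set e | incident e v]|.

Definition cubic : Prop := forall v, degree v = 3.

Definition adjS (S : {set E}) : rel V := fun x y =>
  [exists e in S, ((src e == x) && (tgt e == y)) || ((src e == y) && (tgt e == x))].

Definition ncomp (S : {set E}) : nat := n_comp (adjS S) predT.

Definition bridge (e : E) : bool := ncomp [set: E] < ncomp ([set: E] :\ e).

Definition bridgeless : Prop := forall e, ~~ bridge e.

Definition edges_adj (e f : E) : bool :=
  (e != f) && [exists v, incident e v && incident f v].

Definition colorable (k : nat) (S : {set E}) : bool :=
  [exists c : {ffun E -> 'I_k},
     [forall e in S, forall f in S, edges_adj e f ==> (c e != c f)]].

Definition nu (k : nat) : nat := \max_(S : {set E} | colorable k S) #|S|.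

End Graphs.

(* Main.v *)
(** Let [n] be the number of vertices and let the deficit of a k-edge-colouring be the number of
    pairs of a vertex and a colour missing at it, i.e. [k n] minus twice the number of coloured
    edges. With [d k] the least deficit, the claim reads [45 d 2 <= 2 n + 22 d 3].

    If three vertices are joined by exactly three edges, contracting them does not increase [d 3]
    (Kempe changes) and creates no bridge, while 2-colourings lift without increasing the deficit.
    So the graph may be taken simple and triangle-free.

    In an optimal 3-colouring every uncoloured edge closes a Kempe chain to an odd cycle of length
    at least 5. These cycles are disjoint, and each has as type the colour not used on it. Among
    the optimal colourings take one where a colour [g] is missing at as few vertices as possible,
    [f] in number, and then one where the odd cycles cover as many vertices as possible. Then
    [2 n >= 5 d 3 + 9 f]: besides its own vertices, an odd cycle of type different from [g] accounts
    for the outer ends of the edges leaving it, which lie on no odd cycle and are shared by at most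
    two of them, one of each type. Cycles that are poor (of length 5, or of length 7 with two
    chords) and share much are paid for by their partners; exchanging two colours along a path that
    joins two cycles, and the maximality of the covered set, bound what can be shared. Finally [g]
    and the better of the two other colours form a 2-colouring as required. *)
Require Import Defs.
From mathcomp Require Import all_boot zify boolp.
Set Implicit Arguments. Unset Strict Implicit. Unset Printing Implicit Defensive.

(** The constants come from the last step. With [d] the least deficit and [f] the number of vertices
    missing [g], the better of the two other colours is missing at no more than [(d - f) / 2]
    vertices, so the 2-colouring has deficit at most [(d + f) / 2]. The inequality
    [45 (d + f) / 2 <= 22 d + (5 d + 9 f)] says [3 f <= d], which holds because [g] is the colour
    missing least often; it is an equality when all three colours are missing equally often. The
    tool used throughout is that the uncoloured edge of an odd cycle may be moved around it without
    changing the class sizes, until a given vertex misses a given one of the two colours of the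
    cycle. The obstacle is an outer vertex [z] reached from two cycles, by colour [a] at [x] and by
    colour [b] at [y]. After rotating both cycles, [x], [z], [y] is a whole [a]-[b] chain.
    Exchanging its colours gives two odd cycles in place of the old ones and leaves the others
    alone, so the new ones are together no longer, while each has length at least 5. Short cycles
    leave little room for this. *)

Lemma uniq3 (T : eqType) (a b c : T) :
  uniq [:: a; b; c] = [&& a != b, a != c & b != c].
Proof. by rewrite /= !inE negb_or andbT andbA. Qed.

Lemma uniq3_neq (T : eqType) (a b c : T) :
  uniq [:: a; b; c] -> [/\ a != b, a != c & b != c].
Proof. by rewrite uniq3 => /and3P. Qed.

(** * Alternating chains *)

Section Chain.
Variable T : finType.
Implicit Types (f g : T -> T) (x y z : T) (s t p : seq T).

(** [x :: s] leaves [x] by [f], alternates [f] and [g], and stops where the next involution has a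
    fixed point. With one involution per colour and missed colours as fixed points, this is a Kempe
    chain. *)
Fixpoint alt f g x s : bool :=
  if s is y :: s' then [&& f x == y, y != x & alt g f y s'] else f x == x.

Lemma alt_det f g x s t : alt f g x s -> alt f g x t -> s = t.
Proof.
elim: s f g x t => [|y s IH] f g x [|z t] //=.
- by move=> /eqP-> /and3P[/eqP<-]; rewrite eqxx.
- by move=> /and3P[/eqP->] /negPf->.
by move=> /and3P[/eqP<- _ h1] /and3P[/eqP<- _ h2]; rewrite (IH _ _ _ _ h1 h2).
Qed.

Lemma alt_step f g x s : involutive f -> involutive g -> alt f g x s ->
  forall z, z \in x :: s -> (f z \in x :: s) && ((z != x) ==> (g z \in x :: s)).
Proof.
move=> If Ig; elim: s f g x If Ig => [|y s IH] f g x If Ig /=.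
  by move=> /eqP nfix z; rewrite !inE => /eqP->; rewrite nfix eqxx.
move=> /and3P[/eqP nfix yx h] z; rewrite inE => /orP[/eqP->|zs].
  by rewrite nfix !inE !eqxx orbT.
have /andP[g1 g2] := IH _ _ _ Ig If h z zs.
rewrite [g z \in _]inE g1 orbT implybT andbT.
have [->|zy] := eqVneq z y; first by rewrite -nfix If mem_head.
by rewrite inE (implyP g2 zy) orbT.
Qed.

Lemma alt_closed f g x s : involutive f -> involutive g -> g x = x ->
  alt f g x s -> forall z, z \in x :: s -> f z \in x :: s /\ g z \in x :: s.
Proof.
move=> If Ig gx h z zs; have /andP[h1 /implyP h2] := alt_step If Ig h zs.
split=> //; have [->|] := eqVneq z x; first by rewrite gx mem_head.
exact: h2.
Qed.

(** An inner vertex is moved by both involutions, to its two neighbours on the path. *)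
Lemma alt_ends f g x s z : involutive f -> involutive g ->
  alt f g x s -> z \in x :: s -> f z = z \/ g z = z -> z = x \/ z = last x s.
Proof.
move=> If Ig; elim: s f g x If Ig => [|y s IH] f g x If Ig /=.
  by rewrite inE => _ /eqP->; left.
move=> /and3P[/eqP nfix yx h]; rewrite inE => /orP[/eqP->|zs] hz; first by left.
right; have [zy|//] := IH _ _ _ Ig If h zs ((or_comm _ _).1 hz).
subst z; have fy : f y = x by rewrite -nfix If.
case: hz => hz; first by rewrite -hz fy eqxx in yx.
by case: s h {IH zs} => //= t s; rewrite hz => /andP[/eqP<-]; rewrite eqxx.
Qed.

Lemma alt_last f g x s : alt f g x s ->
  (if odd (size s) then g else f) (last x s) = last x s.
Proof.
elim: s f g x => [|y s IH] f g x /=; first by move/eqP.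
by move=> /and3P[_ _ /IH]; case: odd.
Qed.

Lemma alt_ext f g x : involutive f -> involutive g -> g x = x ->
  exists2 s, alt f g x s & uniq (x :: s).
Proof.
move=> If Ig gx.
(* The vertices [p] left behind are closed under [f], and together with [y] under [g]; hence [f y]
   is either [y] or new. The induction is on the number of vertices outside [p]. *)
suff: forall n f g y p, involutive f -> involutive g -> #|T| - size p = n ->
  (forall z, z \in p -> f z \in p) ->
  (forall z, z \in y :: p -> g z \in y :: p) -> uniq (y :: p) ->
  exists2 s, alt f g y s & uniq (catrev s (y :: p)).
  move=> /(_ _ f g x [::] If Ig erefl) [] //.
    by move=> z; rewrite inE => /eqP->; rewrite gx inE.
  by move=> s' h1 h2; exists s' => //; move: h2; rewrite catrevE uniq_catC /= mem_rev rev_uniq.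
elim=> [|n IH] {f g x If Ig gx} f g y p If Ig Hn Hf Hg Hu.
  have : size (y :: p) <= #|T| by rewrite -(card_uniqP Hu) max_card.
  by rewrite /= -subn_gt0 Hn.
have [fy|fy] := eqVneq (f y) y; first by exists [::] => //=; rewrite fy.
have zp : f y \notin y :: p.
  rewrite inE negb_or fy /=; apply/negP => /Hf; rewrite If.
  by move: Hu => /= /andP[/negPf->].
have [||||s h1 h2] := IH g f (f y) (y :: p) Ig If.
- by rewrite /= subnS Hn.
- exact: Hg.
- move=> z; rewrite in_cons => /orP[/eqP->|]; first by rewrite If !inE eqxx orbT.
  rewrite in_cons => /orP[/eqP->|/Hf h]; first by rewrite mem_head.
  by rewrite !inE h !orbT.
- by rewrite /= in zp Hu *; rewrite zp.
by exists (f y :: s) => //=; rewrite eqxx fy.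
Qed.

Lemma alt_uniq f g x s : involutive f -> involutive g -> g x = x ->
  alt f g x s -> uniq (x :: s).
Proof.
by move=> If Ig gx h; have [t ht] := alt_ext If Ig gx; rewrite (alt_det h ht).
Qed.

Lemma alt_const (A : Type) (P : T -> A) f g x s :
  (forall z, P (f z) = P z) -> (forall z, P (g z) = P z) ->
  alt f g x s -> forall z, z \in x :: s -> P z = P x.
Proof.
move=> Pf Pg; elim: s f g x Pf Pg => [|y s IH] f g x Pf Pg /=.
  by move=> _ z; rewrite inE => /eqP->.
move=> /and3P[/eqP nfix _ h] z; rewrite in_cons => /orP[/eqP->//|zs].
by rewrite (IH _ _ _ Pg Pf h z zs) -nfix Pf.
Qed.

(** With [t] empty this reverses a chain; a general [t] is the accumulator of the induction. The
    parity of the length decides which involution comes first. *)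
Lemma alt_catrev f g x s t : involutive f -> involutive g ->
  alt f g x s -> alt g f x t ->
  if odd (size s) then alt f g (last x s) (catrev (belast x s) t)
  else alt g f (last x s) (catrev (belast x s) t).
Proof.
move=> If Ig; elim: s f g x t If Ig => [|y s IH] f g x t If Ig //=.
move=> /and3P[/eqP nfix yx h] ht; have := IH g f y (x :: t) Ig If h.
rewrite /= -nfix If eqxx nfix eq_sym yx ht => /(_ isT).
by case: odd.
Qed.

Lemma alt_eq f g f' g' x s :
  (forall z, z \in x :: s -> f z = f' z) -> (forall z, z \in x :: s -> g z = g' z) ->
  alt f g x s = alt f' g' x s.
Proof.
elim: s f g f' g' x => [|y s IH] f g f' g' x /= Hf Hg.
  by rewrite Hf ?mem_head.
rewrite Hf ?mem_head // (IH g f g' f') // => z zs; [apply: Hg|apply: Hf];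
by rewrite inE zs orbT.
Qed.
End Chain.

Lemma ord3_case (a b c d : 'I_3) : uniq [:: a; b; c] -> [|| d == a, d == b | d == c].
Proof.
by case: a b c d => [[|[|[|?]]] ?] [[|[|[|?]]] ?] [[|[|[|?]]] ?] [[|[|[|?]]] ?].
Qed.

(** The form needed when an uncoloured edge moves one step: on the path the involutions change only
    at its last vertex, which is now matched to [v], and the chain stops there. *)
Lemma alt_rcons (T : finType) (f g f' g' : T -> T) x s v :
  alt f g x s -> uniq (x :: s) ->
  (forall z, z \in x :: s -> z != last x s -> f' z = f z /\ g' z = g z) ->
  (if odd (size s) then g' else f') (last x s) = v ->
  (if odd (size s) then f' else g') v = v -> v != last x s ->
  alt f' g' x (rcons s v).
Proof.
elim: s f g f' g' x => [|y s IH] f g f' g' x /=.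
  by move=> _ _ _ -> -> ->; rewrite !eqxx.
move=> /and3P[/eqP nfix yx h] /andP[xs us] hh h1 h2 vl.
have [-> _] : f' x = f x /\ g' x = g x.
  by apply: hh; [rewrite mem_head|apply: contraNneq xs => ->; rewrite mem_last].
rewrite nfix eqxx yx /=; apply: (IH g f) => //.
- move=> z zs zl; have [] := hh z _ zl => //.
  by rewrite in_cons zs orbT.
- by move: h1; case: odd.
- by move: h2; case: odd.
Qed.

Lemma rot1_iter (T : Type) k (s : seq T) : k <= size s -> iter k (rot 1) s = rot k s.
Proof.
elim: k => [|k IH] ks; first by rewrite rot0.
by rewrite iterS IH 1?ltnW // -rotS.
Qed.

(** [cl] selects the involution under which [C] is closed. The path can enter [C] only by the other
    one, so it stops at the entry [y] as soon as the selected one is changed to fix [y]. *)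
Lemma alt_cut (T : finType) (cl : bool) (C : pred T) (f g f' g' : T -> T) x s y t :
  involutive f -> involutive g ->
  alt f g x (s ++ y :: t) ->
  (forall z, C z -> C ((if cl then f else g) z)) -> (if cl then f' else g') y = y ->
  C y -> ~~ C x -> ~~ has C s ->
  (forall z, ~~ C z -> f' z = f z /\ g' z = g z) ->
  alt f' g' x (rcons s y).
Proof.
elim: s cl f g f' g' x => [|z s IH] cl f g f' g' x If Ig /=.
  move=> /and3P[/eqP nfix yx _] hC hy Cy nCx _ hh.
  rewrite (hh x nCx).1 nfix eqxx yx /=; case: cl hC hy => hC hy; last by rewrite hy.
  by have := hC y Cy; rewrite -nfix If (negPf nCx).
move=> /and3P[/eqP nfix zx h] hC hy Cy nCx; rewrite negb_or => /andP[nCz nCs] hh.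
rewrite (hh x nCx).1 nfix eqxx zx /=; apply: (IH (~~ cl) g f) => //.
- by move: hC; case: cl {hy}.
- by case: cl hy {hC}.
by move=> w /hh[].
Qed.

Lemma rev_cons_last (T : Type) (x : T) s : last x s :: rev (belast x s) = rev (x :: s).
Proof. by rewrite (lastI x s) rev_rcons. Qed.

(** * Cyclic lists read from any vertex *)

Section Reading.
Variable T : eqType.
Implicit Types (p l s t : seq T) (x y : T).

Definition reads p l := exists k, rot k p = l.

Lemma reads_refl p : reads p p. Proof. by exists 0; rewrite rot0. Qed.

Lemma reads_mem p l : reads p l -> l =i p.
Proof. by move=> [k <-] x; rewrite mem_rot. Qed.

Lemma reads_size p l : reads p l -> size l = size p.
Proof. by move=> [k <-]; rewrite size_rot. Qed.

Lemma reads_uniq p l : reads p l -> uniq l = uniq p.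
Proof. by move=> [k <-]; rewrite rot_uniq. Qed.

Lemma reads_rot1 p x s : reads p (x :: s) -> reads p (rcons s x).
Proof.
move=> [k e]; rewrite -rot1_cons -e; have [kp|kp] := ltnP k (size p).
  by exists k.+1; rewrite rotS.
by rewrite (rot_oversize kp); exists 1.
Qed.

Lemma reads_rev p l : reads p l -> reads (rev p) (rev l).
Proof.
move=> [k <-]; exists (size p - k); rewrite rev_rot /rotr size_rev.
by [].
Qed.

Lemma reads_from p x : x \in p -> exists s, reads p (x :: s).
Proof. by move=> /rot_to[i s e]; exists s, i. Qed.

Lemma reads_index p x s : uniq p -> reads p (x :: s) -> x :: s = rot (index x p) p.
Proof.
move=> up [k e]; have [kp|kp] := ltnP k (size p); last first.
  by rewrite rot_oversize // in e; rewrite e /= eqxx rot0.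
suff -> : index x p = k by [].
have <- : nth x p k = x.
  by have := congr1 (head x) e; rewrite /rot (drop_nth x kp).
by rewrite index_uniq.
Qed.
End Reading.

(** For a 7-cycle whose seventh vertex satisfies [t]: [s] stands for a shared outer end, [t] for one
    shared with a fixed cycle. [t] spreads from the seventh vertex both ways along runs of [s]; at
    most one [s] fails, so every other one is reached. *)
Lemma cyclic_chain (s1 s2 s3 s4 s5 s6 t1 t2 t3 t4 t5 t6 : bool) :
  5 <= s1 + (s2 + (s3 + (s4 + (s5 + s6)))) ->
  [&& s1 ==> t1, t1 && s2 ==> t2, t2 && s3 ==> t3, t3 && s4 ==> t4, t4 && s5 ==> t5,
      s6 ==> t6, t6 && s5 ==> t5, t5 && s4 ==> t4, t4 && s3 ==> t3, t3 && s2 ==> t2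
    & t2 && s1 ==> t1] ->
  5 <= t1 + (t2 + (t3 + (t4 + (t5 + t6)))).
Proof.
by case: s1; case: s2; case: s3; case: s4; case: s5; case: s6 => //= _;
  case: t1; case: t2; case: t3; case: t4; case: t5; case: t6.
Qed.
(** For a 7-cycle with one chord, between vertices 0 and 3. The six links make the five other
    vertices a 2-connected graph, so [t] stays constant on the [s] when one of these fails. *)
Lemma chord_chain (s1 s2 s4 s5 s6 t1 t2 t4 t5 t6 : bool) :
  4 <= s1 + (s2 + (s4 + (s5 + s6))) -> t1 || t2 || t4 || t5 || t6 ->
  [&& s1 && s2 ==> (t1 == t2), s4 && s5 ==> (t4 == t5), s5 && s6 ==> (t5 == t6),
     s4 && s6 ==> (t4 == t6), s1 && s4 ==> (t1 == t4) & s2 && s6 ==> (t2 == t6)] ->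
  [&& t1 ==> s1, t2 ==> s2, t4 ==> s4, t5 ==> s5 & t6 ==> s6] ->
  3 <= t1 + (t2 + (t4 + t6)).
Proof.
by case: s1; case: s2; case: s4; case: s5; case: s6 => //=;
  case: t1; case: t2; case: t4; case: t5; case: t6.
Qed.

Lemma odd_invol (T : finType) (f : T -> T) (A : {set T}) : involutive f ->
  (forall x, x \in A -> f x \in A) -> (forall x, x \in A -> f x != x) -> ~~ odd #|A|.
Proof.
move=> fi; move: {2}#|A| (leqnn #|A|) => n; elim: n A => [|n IH] A h fA nfix.
  by move: h; rewrite leqn0 => /eqP ->.
have [->|[x xA]] := set_0Vmem A; first by rewrite cards0.
have d1 := cardsD1 x A; have d2 := cardsD1 (f x) (A :\ x).
rewrite xA in d1; rewrite !inE nfix // fA //= in d2.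
have := IH (A :\ x :\ f x).
rewrite d1 d2 /= negbK; apply; first by move: h; rewrite d1 d2; lia.
  move=> y; rewrite !inE => /and3P[h1 h2 yA]; rewrite fA // andbT.
  by rewrite (inj_eq (can_inj fi)) h2 /=; apply: contra h1 => /eqP <-; rewrite fi.
by move=> y; rewrite !inE => /and3P[_ _]; apply: nfix.
Qed.

(** * Optimal 3-edge-colourings of a simple cubic graph *)

Section Coloring.
Variables (V : finType) (adj : rel V).
Hypothesis adjC : symmetric adj.
Hypothesis adj_irr : irreflexive adj.
Hypothesis adj3 : forall x, #|[set y | adj x y]| = 3.
Implicit Types (m : 'I_3 -> V -> V) (a b c d g : 'I_3) (x y z u v w q : V) (s t p : seq V).

(* The class of colour [c] is the involution [m c]; its fixed points are the vertices that miss [c] *)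
Definition coloring m : Prop :=
  [/\ forall c, involutive (m c),
      forall c x, m c x != x -> adj x (m c x)
    & forall c d x, c != d -> m c x != x -> m c x != m d x].

Definition nfix m c := #|[set x | m c x == x]|.
Definition deficit m := \sum_c nfix m c.
Definition optimal m := coloring m /\ forall m', coloring m' -> deficit m <= deficit m'.
Definition unc m u v := adj u v && [forall c, m c u != v].
Definition recolor m c (h : V -> V) : 'I_3 -> V -> V := fun d => if d == c then h else m d.
Definition flip u v (h : V -> V) x := if x == u then v else if x == v then u else h x.
Definition kempe m a b (K : {set V}) : 'I_3 -> V -> V := fun c x =>
  if x \in K then (if c == a then m b x else if c == b then m a x else m c x)
  else m c x.

Lemma col_inv m c : coloring m -> involutive (m c). Proof. by case. Qed.

Lemma upd_coloring m c h : coloring m -> involutive h ->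
  (forall x, h x != x -> adj x (h x)) ->
  (forall x d, d != c -> h x != x -> h x != m d x) -> coloring (recolor m c h).
Proof.
move=> [m1 m2 m3] h1 h2 h3; split; rewrite /recolor.
- by move=> d; case: eqP => _.
- by move=> d x; case: (d =P c) => _ /=; [apply: h2|apply: m2].
move=> d e x; case: (d =P c) => [->|/eqP dc]; case: (e =P c) => [->|/eqP ec] de /= hx.
- by rewrite eqxx in de.
- exact: h3.
- have [->//|hh] := eqVneq (h x) x; by rewrite eq_sym h3.
- exact: m3.
Qed.

Lemma def_upd m c h : deficit (recolor m c h) + nfix m c = deficit m + #|[set x | h x == x]|.
Proof.
rewrite /deficit (bigD1 c) //= [in RHS](bigD1 c) //= {1}/nfix /recolor eqxx.
rewrite (eq_bigr (fun d => nfix m d)) => [|d /negPf dc]; first by lia.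
by rewrite /nfix dc.
Qed.

Lemma flip_inv u v h : involutive h -> h u = u -> h v = v -> involutive (flip u v h).
Proof.
move=> hi hu hv x; rewrite /flip.
have [->|xu] := eqVneq x u; first by rewrite eqxx; case: eqP.
have [->|xv] := eqVneq x v; first by rewrite eqxx.
have -> : (h x == u) = false by apply: contraNF xu => /eqP h1; rewrite -(hi x) h1 hu.
have -> : (h x == v) = false by apply: contraNF xv => /eqP h1; rewrite -(hi x) h1 hv.
exact: hi.
Qed.

(** Giving such an edge the colour [c] would lower the deficit by 2. *)
Lemma noadd m c u v : optimal m -> m c u = u -> m c v = v -> ~~ unc m u v.
Proof.
move=> [cm om] cu cv; apply/negP => /andP[uv /forallP un].
have uv' : u != v by apply: contraTneq uv => ->; rewrite adj_irr.
have [m1 m2 m3] := cm.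
have un' d : m d v != u by apply: contra (un d) => /eqP h; rewrite -h m1.
have hc : coloring (recolor m c (flip u v (m c))).
  apply: upd_coloring => //; first exact: flip_inv.
    move=> x; rewrite /flip; case: (x =P u) => [->//|_].
    by case: (x =P v) => [->|_]; [rewrite adjC | apply: m2].
  move=> x d dc; rewrite /flip; case: (x =P u) => [->|_]; first by move=> _; rewrite eq_sym.
  by case: (x =P v) => [->|_]; [move=> _; rewrite eq_sym | move=> h; apply: m3; rewrite // eq_sym].
have := om _ hc; have := def_upd m c (flip u v (m c)).
have -> : [set x | flip u v (m c) x == x] = [set x | m c x == x] :\ u :\ v.
  apply/setP => x; rewrite !inE /flip; have [->|xu] := eqVneq x u.
    by rewrite eq_sym (negPf uv') andbF.
  by have [->|xv] := eqVneq x v; rewrite ?(negPf uv') ?andbF.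
have := cardsD1 v ([set x | m c x == x] :\ u); have := cardsD1 u [set x | m c x == x].
by rewrite -/(nfix m c) !inE cu cv !eqxx eq_sym uv' /=; lia.
Qed.

(** * Kempe changes *)

Section Kempe.
Variables (m : 'I_3 -> V -> V) (a b : 'I_3) (K : {set V}).
Hypothesis cm : coloring m.
Hypothesis ab : a != b.
Hypothesis Ka : forall x, x \in K -> m a x \in K.
Hypothesis Kb : forall x, x \in K -> m b x \in K.

Lemma kmp_coloring : coloring (kempe m a b K).
Proof.
have [m1 m2 m3] := cm.
have Ka' x : (m a x \in K) = (x \in K).
  by apply/idP/idP => [/Ka|/Ka//]; rewrite m1.
have Kb' x : (m b x \in K) = (x \in K).
  by apply/idP/idP => [/Kb|/Kb//]; rewrite m1.
split; rewrite /kempe.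
- move=> c x; case xK: (x \in K); case: (c =P a) => [->|/eqP ca].
  + by rewrite Kb' xK m1.
  + case: (c =P b) => [->|_]; first by rewrite Ka' xK m1.
    by rewrite m1; case: ifP.
  + by rewrite Ka' xK m1.
  case: (c =P b) => [->|_]; first by rewrite Kb' xK m1.
  by rewrite m1; case: ifP.
- by move=> c x; case: (x \in K); [case: (c =P a) => _; [|case: (c =P b) => _]|]; apply: m2.
move=> c d x cd; case xK: (x \in K); last exact: m3.
case: (c =P a) => [ca|/eqP ca]; case: (d =P a) => [da|/eqP da].
- by rewrite ca da eqxx in cd.
- by case: (d =P b) => [_|/eqP db]; apply: m3; rewrite // eq_sym.
- by case: (c =P b) => [_|/eqP cb]; apply: m3.
case: (c =P b) => [cb|/eqP cb]; case: (d =P b) => [db|/eqP db].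
- by rewrite cb db eqxx in cd.
- by apply: m3; rewrite eq_sym.
- exact: m3.
- exact: m3.
Qed.

Lemma fx_kmp c : c != a -> c != b -> nfix (kempe m a b K) c = nfix m c.
Proof.
move=> /negPf ca /negPf cb; apply: eq_card => x; rewrite !inE /kempe ca cb.
by case: ifP.
Qed.

Lemma fx_kmp2 : nfix (kempe m a b K) a + nfix (kempe m a b K) b = nfix m a + nfix m b.
Proof.
rewrite /nfix -(cardsID K) -(cardsID K [set x | kempe _ _ _ _ b _ == _]).
rewrite -(cardsID K [set x | m a x == x]) -(cardsID K [set x | m b x == x]).
have e c d : (forall x, x \in K -> kempe m a b K c x = m d x) ->
   #|[set x | kempe m a b K c x == x] :&: K| = #|[set x | m d x == x] :&: K|.
  move=> h; apply: eq_card => x; rewrite !inE.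
  by case xK: (x \in K); rewrite ?andbF ?andbT ?h.
have e' c : #|[set x | kempe m a b K c x == x] :\: K| = #|[set x | m c x == x] :\: K|.
  apply: eq_card => x; rewrite !inE /kempe.
  by case: (x \in K).
rewrite (e a b) ?(e b a) ?e' ?(e' b) /kempe; first by lia.
- by move=> x ->; rewrite eqxx eq_sym (negPf ab).
- by move=> x ->; rewrite eqxx.
Qed.

Lemma def_kmp : deficit (kempe m a b K) = deficit m.
Proof.
rewrite /deficit (bigD1 a) //= (bigD1 b) 1?eq_sym //=.
rewrite [in RHS](bigD1 a) //= [in RHS](bigD1 b) 1?eq_sym //=.
rewrite !addnA fx_kmp2; congr addn; apply: eq_bigr => c /andP[ca cb].
exact: fx_kmp.
Qed.

Lemma opt_kmp : optimal m -> optimal (kempe m a b K).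
Proof.
by move=> [_ om]; split; [exact: kmp_coloring|move=> m' hm'; rewrite def_kmp om].
Qed.
End Kempe.

(** * Missed colours and uncoloured edges *)

Lemma nb_inj m x : coloring m ->
  {in [pred c | m c x != x] &, injective (m^~ x)}.
Proof.
move=> [_ _ m3] c d; rewrite !inE => hc _ /eqP e; apply/eqP; apply: contraTT e.
by move=> cd; apply: m3.
Qed.

Definition unc_nbrs m x := [set y | unc m x y].

(** Both numbers are 3 minus the number of colours present at [x]. *)
Lemma card_unb m x : coloring m -> #|unc_nbrs m x| = #|[set c | m c x == x]|.
Proof.
move=> cm; have [m1 m2 m3] := cm.
set I := [set m c x | c in [pred c | m c x != x]].
have -> : unc_nbrs m x = [set y | adj x y] :\: I.
  apply/setP => y; rewrite !inE andbC /unc; have [xy|] := boolP (adj x y); rewrite ?andbF ?andbT //=.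
  apply/forallP/idP => [h|h c]; first by apply/imsetP => -[c _ e]; have := h c; rewrite e eqxx.
  apply: contra h => /eqP e; apply/imsetP; exists c; rewrite ?inE e //.
  by apply: contraTneq xy => ->; rewrite adj_irr.
rewrite cardsD (setIidPr _) ?adj3; last first.
  by apply/subsetP => y /imsetP[c]; rewrite !inE => /m2 h ->.
rewrite card_in_imset; last exact: nb_inj.
have := cardC [pred c | m c x != x]; rewrite card_ord.
have -> : #|[predC [pred c | m c x != x]]| = #|[set c | m c x == x]|.
  by apply: eq_card => c; rewrite !inE negbK.
by lia.
Qed.

Lemma unc_sym m u v : coloring m -> unc m u v = unc m v u.
Proof.
move=> cm; rewrite /unc adjC; congr andb; apply: eq_forallb => c.
by congr negb; apply/eqP/eqP => <-; rewrite col_inv.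
Qed.

Lemma unc_neq m u v : unc m u v -> u != v.
Proof. by move=> /andP[uv _]; apply: contraTneq uv => ->; rewrite adj_irr. Qed.

Lemma unc_miss m u v : coloring m -> unc m u v -> exists c, m c u == u.
Proof.
move=> cm uv; have : 0 < #|unc_nbrs m u| by apply/card_gt0P; exists v; rewrite inE.
by rewrite card_unb // => /card_gt0P[c]; rewrite inE; exists c.
Qed.

Lemma miss_unc m u c : coloring m -> m c u = u -> exists v, unc m u v.
Proof.
move=> cm cu; have : 0 < #|unc_nbrs m u|.
  by rewrite card_unb //; apply/card_gt0P; exists c; rewrite inE cu.
by move=> /card_gt0P[v]; rewrite inE; exists v.
Qed.

Lemma unc_kmp m a b (K : {set V}) u v : coloring m -> a != b ->
  (forall x, x \in K -> m a x \in K) -> (forall x, x \in K -> m b x \in K) ->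
  unc (kempe m a b K) u v = unc m u v.
Proof.
move=> cm ab Ka Kb; rewrite /unc; congr andb; apply/forallP/forallP => h c.
  case uK: (u \in K); last by have := h c; rewrite /kempe uK.
  have [->|ca] := eqVneq c a.
    by have := h b; rewrite /kempe uK [b == a]eq_sym (negPf ab) !eqxx.
  have [->|cb] := eqVneq c b; first by have := h a; rewrite /kempe uK !eqxx.
  by have := h c; rewrite /kempe uK (negPf ca) (negPf cb).
rewrite /kempe; case: (u \in K) => //; case: (c =P a) => // _; case: (c =P b) => //.
Qed.

Lemma chain_set m a b v : coloring m -> a != b -> m b v = v ->
  exists s, [/\ alt (m a) (m b) v s, uniq (v :: s),
    forall x, x \in [set y in v :: s] -> m a x \in [set y in v :: s]
  & forall x, x \in [set y in v :: s] -> m b x \in [set y in v :: s]].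
Proof.
move=> cm ab bv; have [m1 _ _] := cm; have [s h1 h2] := alt_ext (m1 a) (m1 b) bv.
by exists s; split=> // x; rewrite !inE -!in_cons => /(alt_closed (m1 a) (m1 b) bv h1)[].
Qed.

(* If [v] misses [b] and its uncoloured neighbour [u] misses [c], the [b]-[c] chain
   starting at [v] must end at [u]: otherwise a Kempe change frees a common colour. *)
Lemma chain_end m b c v u s : optimal m -> c != b -> m b v = v -> m c u = u -> unc m v u ->
  alt (m c) (m b) v s -> last v s = u.
Proof.
move=> om cb bv cu vu h; have cm := om.1; have [m1 _ _] := cm.
have [t [ht _ kc kb]] := chain_set cm cb bv.
rewrite -(alt_det h ht) in kc kb.
have us : u \in v :: s.
  apply: contraT => us; have ou := opt_kmp cm cb kc kb om.
  have /negP[] : ~~ unc (kempe m c b [set y in v :: s]) v u.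
    apply: (noadd (c := c) ou); first by rewrite /kempe inE mem_head eqxx bv.
    by rewrite /kempe inE (negPf us) cu.
  by rewrite unc_kmp.
have [uv|//] := alt_ends (m1 c) (m1 b) h us (or_introl cu).
by have := unc_neq vu; rewrite uv eqxx.
Qed.

Lemma miss_two m a b c v u : optimal m -> uniq [:: a; b; c] -> m a v = v -> m b v = v ->
  unc m v u -> m c u = u /\ (forall s, alt (m a) (m c) u s -> last u s = v).
Proof.
move=> om abc av bv vu; have cm := om.1; have uv : unc m u v by rewrite unc_sym.
have [d /eqP du] := unc_miss cm uv.
  case/or3P: (ord3_case d abc) => /eqP e; move: du; rewrite e // => du.
    by case/negP: (noadd om av du).
  by case/negP: (noadd om bv du).
move: abc; rewrite uniq3 => /and3P[_ ac _].
by split=> // s; apply: chain_end.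
Qed.

Lemma third a b : a != b -> exists c, uniq [:: a; b; c].
Proof.
move=> ab; have : 0 < #|~: [set a; b]|.
  by have := cardsC [set a; b]; rewrite cards2 ab card_ord; lia.
by move=> /card_gt0P[c]; rewrite !inE negb_or => /andP[ca cb]; exists c;
  rewrite uniq3 ab eq_sym ca eq_sym.
Qed.

(** Otherwise [v] has two uncoloured neighbours [u] and [u'], both missing the third colour [c]. The
    [a]-[c] chains from both end at [v], so they are one chain, which cannot have three ends. *)
Lemma miss_one m a b v : optimal m -> m a v = v -> m b v = v -> a = b.
Proof.
move=> om av bv; apply/eqP; apply: contraT => ab; have [c abc] := third ab.
have cm := om.1; have [m1 _ _] := cm.
have : 1 < #|unc_nbrs m v|.
  rewrite card_unb //; apply: leq_trans (_ : #|[set a; b]| <= _); first by rewrite cards2 ab.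
  by apply/subset_leq_card/subsetP => d; rewrite !inE => /orP[]/eqP->; apply/eqP.
move=> /card_gt1P[u [u' []]]; rewrite !inE => vu vu' uu'.
have [cu hu] := miss_two om abc av bv vu; have [cu' hu'] := miss_two om abc av bv vu'.
move: (abc); rewrite uniq3 => /and3P[_ ac _].
have [s [hs us ka kc]] := chain_set cm ac cu.
have [s' [hs' us' _ _]] := chain_set cm ac cu'.
have vs : v \in u :: s by rewrite -{1}(hu _ hs) mem_last.
have vs' : v \in u' :: s' by rewrite -{1}(hu' _ hs') mem_last.
pose P x := x \in u :: s.
have Pa x : P (m a x) = P x.
  by apply/idP/idP => h; have := ka; [move=> /(_ (m a x))|move=> /(_ x)]; rewrite !inE -!in_cons => /(_ h); rewrite ?m1.
have Pc x : P (m c x) = P x.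
  by apply/idP/idP => h; have := kc; [move=> /(_ (m c x))|move=> /(_ x)]; rewrite !inE -!in_cons => /(_ h); rewrite ?m1.
have u's : u' \in u :: s.
  by have := alt_const Pa Pc hs' vs'; rewrite /P vs.
have [e|e] := alt_ends (m1 a) (m1 c) hs u's (or_intror cu').
  by rewrite e eqxx in uu'.
by have := unc_neq vu'; rewrite e (hu _ hs) eqxx.
Qed.

Lemma unc_uniq m x u v : optimal m -> unc m x u -> unc m x v -> u = v.
Proof.
move=> om xu xv; have cm := om.1; have [c /eqP cx] := unc_miss cm xu.
have : #|unc_nbrs m x| <= 1.
  rewrite card_unb //; apply/card_le1_eqP => d e; rewrite !inE => /eqP h /eqP h'.
  exact: miss_one om h' h.
by move=> /card_le1_eqP; apply; rewrite inE.
Qed.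

(** * Odd cycles *)

(* [v :: s] is the odd cycle formed by the uncoloured edge between [v] and [last v s]
   and the chain of colours [b] (missed by [v]) and [c] (missed by [last v s]) *)
Definition ocyc m a b c v s :=
  [/\ uniq [:: a; b; c], m b v = v, alt (m c) (m b) v s, unc m v (last v s) & ~~ odd (size s)].

Lemma ocyc_ex m b v : optimal m -> m b v = v -> exists a c s, ocyc m a b c v s.
Proof.
move=> om bv; have cm := om.1; have [u vu] := miss_unc cm bv.
have [c /eqP cu] : exists c, m c u == u by apply: (@unc_miss _ u v); rewrite // unc_sym.
have cb : c != b by apply: contraTneq vu => cb; apply: noadd om bv _; rewrite -cb.
have [a abc] : exists a, uniq [:: a; b; c].
  have [a h] := third cb; exists a; move: h; rewrite !uniq3 => /and3P[h1 h2 h3].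
  by rewrite (eq_sym a b) h3 (eq_sym a c) h2 (eq_sym b c) h1.
have [s [hs _ _ _]] := chain_set cm cb bv.
have e := chain_end om cb bv cu vu hs.
exists a, c, s; split=> //; first by rewrite e.
(* An odd number of steps would make the far end miss both [b] and [c]. *)
apply/negP => os; have := alt_last hs; rewrite os e => bu.
by rewrite (miss_one om bu cu) eqxx in cb.
Qed.

Lemma ocyc_uniq m a b c v s : optimal m -> ocyc m a b c v s -> uniq (v :: s).
Proof.
by move=> [[m1 _ _] _] [_ bv h _ _]; apply: alt_uniq h.
Qed.

Lemma ocyc_neq m a b c v s : ocyc m a b c v s -> [/\ a != b, a != c & b != c].
Proof. by case; rewrite uniq3 => /and3P. Qed.

Lemma ocyc_last m a b c v s : ocyc m a b c v s -> m c (last v s) = last v s.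
Proof. by case=> _ _ h _ /negPf os; have := alt_last h; rewrite os. Qed.

Lemma ocyc_closed m a b c v s : optimal m -> ocyc m a b c v s ->
  forall z, z \in v :: s -> m c z \in v :: s /\ m b z \in v :: s.
Proof. by move=> [[m1 _ _] _] [_ bv h _ _]; apply: alt_closed. Qed.

Lemma ocyc_rev m a b c v s : optimal m -> ocyc m a b c v s ->
  ocyc m a c b (last v s) (rev (belast v s)).
Proof.
move=> om C; have cl := ocyc_last C; case: C => abc bv h vu os; have [m1 _ _] := om.1.
split=> //.
- by move: abc; rewrite !uniq3 (eq_sym c b) => /and3P[-> -> ->].
- have /= := alt_catrev (m1 c) (m1 b) h (t := [::]).
  by rewrite (negPf os) /= bv eqxx => /(_ isT); rewrite catrevE cats0.
- case: s {h os cl} vu => [|y s] /=; first by move/(unc_neq); rewrite eqxx.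
  by rewrite rev_cons last_rcons (unc_sym _ _ om.1).
by rewrite size_rev size_belast.
Qed.

(** Uncolour the edge [v w] and give its colour [c] to the uncoloured edge at [v]. Then [c] is
    missed at [w] instead of the old far end and [b] still at [v]: class sizes are kept, and [b] and
    [c] change roles. *)
Lemma rot_step m a b c v w s : optimal m -> ocyc m a b c v (w :: s) ->
  exists m', [/\ optimal m', forall d, nfix m' d = nfix m d,
    forall d x, x \notin v :: w :: s -> m' d x = m d x,
    m' a =1 m a & ocyc m' a c b w (rcons s v)].
Proof.
move=> om C; have us := ocyc_uniq om C; have cl := ocyc_last C.
have [ab ac bc] := ocyc_neq C.
case: C => abc bv h vu os; have cm := om.1; have [m1 m2 m3] := cm.
case: s us cl h vu os => [//|y s] us cl h vu os.
set u := last v _ in cl vu.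
move: h => /= /and3P[/eqP cv wv] /and3P[/eqP bw yw h].
have cw : m c w = v by rewrite -cv m1.
have uys : u \in y :: s by rewrite /u /= mem_last.
case/andP: us => vws /andP[wys us].
move: vws; rewrite !inE !negb_or => /and3P[vw vy vs].
have uv : u != v by rewrite eq_sym; apply: unc_neq vu.
have uw : u != w by apply: contraNneq wys => <-.
pose g x := if x == w then w else flip v u (m c) x.
have gi : involutive g.
  move=> x; rewrite /g /flip; have [->|xw] := eqVneq x w; first by rewrite eqxx.
  have [->|xv] := eqVneq x v; first by rewrite (negPf uw) (negPf uv) eqxx.
  have [->|xu] := eqVneq x u; first by rewrite (negPf vw) eqxx.
  have -> : (m c x == w) = false by apply: contraNF xv => /eqP e; rewrite -(m1 c x) e cw.
  have -> : (m c x == v) = false by apply: contraNF xw => /eqP e; rewrite -(m1 c x) e cv.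
  have -> : (m c x == u) = false by apply: contraNF xu => /eqP e; rewrite -(m1 c x) e cl.
  exact: m1.
have cm' : coloring (recolor m c g).
  have /andP[avu /forallP nvu] := vu.
  apply: upd_coloring => //.
    move=> x; rewrite /g /flip; have [->|xw] := eqVneq x w; first by rewrite eqxx.
    have [->|xv] := eqVneq x v; first by [].
    have [->|xu] := eqVneq x u; first by rewrite adjC.
    exact: m2.
  move=> x d dc; rewrite /g /flip; have [->|xw] := eqVneq x w; first by rewrite eqxx.
  have [->|xv] := eqVneq x v; first by move=> _; rewrite eq_sym nvu.
  have [->|xu] := eqVneq x u.
    move=> _; apply: contraTneq (nvu d) => e; rewrite negbK; apply/eqP.
    by rewrite e m1.
  by move=> mx; apply: m3; rewrite // eq_sym.
have fg : #|[set x | g x == x]| = nfix m c.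
  have -> : [set x | g x == x] = w |: ([set x | m c x == x] :\ u).
    apply/setP => x; rewrite !inE /g /flip.
    have [->|xw] := eqVneq x w; first by rewrite eqxx.
    have [->|xv] := eqVneq x v; first by rewrite cv (eq_sym w) (negPf vw) andbF (negPf uv).
    by have [->|xu] := eqVneq x u; rewrite //= eq_sym (negPf uv).
  rewrite cardsU1 !inE cw (eq_sym w) (negPf uw) (negPf vw) /=.
  by rewrite /nfix (cardsD1 u [set x | m c x == x]) inE cl eqxx.
have fe d : nfix (recolor m c g) d = nfix m d.
  by rewrite /nfix /recolor; have [->|//] := eqVneq d c.
exists (recolor m c g); split=> //.
- split=> // m' hm'; apply: leq_trans (om.2 _ hm'); rewrite /deficit.
  by apply/eq_leq/eq_bigr => d _; rewrite fe.
- move=> d x; rewrite !inE !negb_or => /and4P[/negPf xv /negPf xw xy xs].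
  rewrite /recolor; case: (d =P c) => // ->; rewrite /g /flip xw xv.
  by case: (x =P u) => // xu; move: uys; rewrite -xu !inE (negPf xy) (negPf xs).
- by move=> x; rewrite /recolor (negPf ac).
split.
- by move: abc; rewrite !uniq3 (eq_sym c b) => /and3P[-> -> ->].
- by rewrite /recolor /g !eqxx.
- rewrite /= /recolor (negPf bc) bw eqxx yw /= eqxx; apply: (alt_rcons h) => //.
  + move=> z zs zl; split=> //; rewrite /g /flip.
    have [e|_] := eqVneq z w; first by rewrite -e zs in wys.
    have [e|_] := eqVneq z v; first by move: zs; rewrite e inE (negPf vy) (negPf vs).
    by rewrite -[u]/(last y s) (negPf zl).
  + move: os => /= /negPn/negPf ->.
    by rewrite /g /flip -[last y s]/u (negPf uw) (negPf uv) eqxx.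
  + by move: os => /= /negPn/negPf ->.
  by rewrite eq_sym.
- have -> : last w (rcons (y :: s) v) = v by exact: last_rcons.
  rewrite /unc -{1}cw m2 ?cw //=; apply/forallP => d; rewrite /recolor.
  have [_|dc] := eqVneq d c; first by rewrite /g eqxx eq_sym.
  by rewrite -cw eq_sym; apply: m3; rewrite ?cw // eq_sym.
by rewrite /= size_rcons.
Qed.

Lemma rot_iter m a b c v s k : optimal m -> ocyc m a b c v s ->
  exists m' v' s', [/\ optimal m', forall d, nfix m' d = nfix m d,
    forall d x, x \notin v :: s -> m' d x = m d x,
    m' a =1 m a & ocyc m' a (if odd k then c else b) (if odd k then b else c) v' s' /\
    v' :: s' = iter k (rot 1) (v :: s)].
Proof.
move=> om C; elim: k => [|k [m' [v' [s' [om' h1 h2 h3 [C' e]]]]]]; first by exists m, v, s.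
have sz : size (v' :: s') = size (v :: s).
  by rewrite e; elim: (k) => //= n <-; rewrite size_rot.
have me : v' :: s' =i v :: s.
  by rewrite e; elim: (k) => //= n IH x; rewrite mem_rot IH.
case: s' C' e sz me => [|w s'] C' e sz me.
  by case: C' => _ _ _ /(unc_neq); rewrite eqxx.
have [m2 [om2 g1 g2 g3 C2]] := rot_step om' C'.
exists m2, w, (rcons s' v'); split=> //.
- by move=> d; rewrite g1.
- by move=> d x xs; rewrite g2 ?h2 // me.
- by move=> x; rewrite g3.
split; last by rewrite iterS -e rot1_cons.
by move: C2; rewrite /=; case: odd.
Qed.

(** [dd] chooses which of the two colours [x] misses. Every step exchanges them and the cycle is
    odd, so one more full turn reverses the choice. *)
Lemma ocyc_rot m a b c v s x (dd : bool) : optimal m -> ocyc m a b c v s -> x \in v :: s ->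
  exists m' s', [/\ optimal m', forall d, nfix m' d = nfix m d,
    forall d y, y \notin v :: s -> m' d y = m d y,
    m' a =1 m a & ocyc m' a (if dd then c else b) (if dd then b else c) x s' /\
    x :: s' = rot (index x (v :: s)) (v :: s)].
Proof.
move=> om C xs; set i := index _ _.
have os : odd (size (v :: s)) by case: C.
have isz : i <= size (v :: s) by rewrite ltnW // index_mem.
have fin k : odd k = dd -> iter k (rot 1) (v :: s) = rot i (v :: s) ->
  exists m' s', [/\ optimal m', forall d, nfix m' d = nfix m d,
    forall d y, y \notin v :: s -> m' d y = m d y,
    m' a =1 m a & ocyc m' a (if dd then c else b) (if dd then b else c) x s' /\
    x :: s' = rot i (v :: s)].
  move=> ok e; have [m' [v' [s' [om' h1 h2 h3 [C' e']]]]] := rot_iter k om C.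
  have vx : v' = x.
    have := e'; rewrite e => /(congr1 (head x)) /= ->.
    have := index_mem x (v :: s); rewrite xs => /idP il.
    by rewrite /rot (drop_nth x) ?nth_index.
  by exists m', s'; rewrite -vx -ok -e; split.
have [oi|oi] := eqVneq (odd i) dd; first by apply: (fin i) => //; rewrite rot1_iter.
apply: (fin (i + size (v :: s))); first by rewrite oddD os addbT; case: (odd i) (dd) oi => [] [].
by rewrite iterD (rot1_iter (leqnn _)) rot_size rot1_iter.
Qed.

(** Rotation leaves the class of [a] alone and can make [x] miss [b]; by [miss_one] it does not miss
    [a] as well. *)
Lemma ocyc_sees m a b c v s x : optimal m -> ocyc m a b c v s -> x \in v :: s -> m a x != x.
Proof.
move=> om C xs; apply/eqP => ax; have [ab _ _] := ocyc_neq C.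
have [m' [s' [om' _ _ ea [[_ bx _ _ _] _]]]] := ocyc_rot false om C xs.
have ax' : m' a x = x by rewrite ea.
by rewrite (miss_one om' ax' bx) eqxx in ab.
Qed.

Lemma ocyc_miss m a b c v s x d : optimal m -> ocyc m a b c v s -> x \in v :: s ->
  m d x = x -> x = v /\ d = b \/ x = last v s /\ d = c.
Proof.
move=> om C xs dx; have := ocyc_sees om C xs; have cl := ocyc_last C.
have [ab ac bc] := ocyc_neq C.
have [m1 _ _] := om.1.
case: C => abc bv h vu os.
case/or3P: (ord3_case d abc) => /eqP e; first by rewrite -e dx eqxx.
  move=> _; have [xv|xl] := alt_ends (m1 c) (m1 b) h xs (or_intror (eq_ind _ (fun i => m i x = x) dx _ e)).
    by left.
  rewrite xl in dx; rewrite e in dx.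
  by rewrite (miss_one om dx cl) eqxx in bc.
move=> _; have [xv|xl] := alt_ends (m1 c) (m1 b) h xs (or_introl (eq_ind _ (fun i => m i x = x) dx _ e)).
  rewrite xv in dx; rewrite e in dx.
  by rewrite (miss_one om bv dx) eqxx in bc.
by right.
Qed.

Lemma uniq3_third a b c a' : uniq [:: a; b; c] -> uniq [:: a'; b; c] -> a' = a.
Proof.
rewrite !uniq3 => /and3P[h1 h2 h3] /and3P[h4 h5 _].
have := @ord3_case a b c a'; rewrite uniq3 h1 h2 h3 => /(_ isT).
by rewrite (negPf h4) (negPf h5) /= orbF => /eqP.
Qed.

Lemma ocyc_closed_ne m a b c v s z d : optimal m -> ocyc m a b c v s -> z \in v :: s ->
  d != a -> m d z \in v :: s.
Proof.
move=> om C zs da; have [h1 h2] := ocyc_closed om C zs; have [abc _ _ _ _] := C.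
by case/or3P: (ord3_case d abc) da => /eqP->; rewrite ?eqxx.
Qed.

(** By [ocyc_miss], [v'] is an end of the first cycle. The uncoloured edge at [v'] then fixes the
    other end, hence the second colour, and a chain is determined by its start and its colours. *)
Lemma ocyc_same m a b c v s a' b' c' v' s' : optimal m -> ocyc m a b c v s ->
  ocyc m a' b' c' v' s' -> v' \in v :: s ->
  a' = a /\ (v' :: s' = v :: s \/ v' :: s' = rev (v :: s)).
Proof.
move=> om C C' vs.
have base b0 c0 v0 s0 : ocyc m a b0 c0 v0 s0 -> v' = v0 -> b' = b0 ->
    a' = a /\ v' :: s' = v0 :: s0.
  move=> C0 e1 e2; rewrite e1 e2 in C' *; have l0 := ocyc_last C0; have l' := ocyc_last C'.
  case: C0 C' => abc bv h vu _ [abc' _ h' vu' _].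
  have e : last v0 s' = last v0 s0 := unc_uniq om vu' vu.
  have ec : c' = c0 by apply: (miss_one om l'); rewrite e.
  rewrite ec in abc' h'; split; first exact: uniq3_third abc abc'.
  by rewrite (alt_det h' h).
have bv' : m b' v' = v' by case: C'.
have [[e1 e2]|[e1 e2]] := ocyc_miss om C vs bv'.
  by have [-> ->] := base _ _ _ _ C e1 e2; split=> //; left.
have [-> ->] := base _ _ _ _ (ocyc_rev om C) e1 e2.
by split=> //; right; rewrite rev_cons_last.
Qed.

Lemma ocyc_eqi m a b c v s a' b' c' v' s' : optimal m -> ocyc m a b c v s ->
  ocyc m a' b' c' v' s' -> v' \in v :: s -> v' :: s' =i v :: s.
Proof.
move=> om C C' vs x; have [_ [->//|->]] := ocyc_same om C C' vs.
by rewrite mem_rev.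
Qed.

Lemma ocyc_ext m m' a b c v s : ocyc m a b c v s ->
  (forall d x, x \in v :: s -> m' d x = m d x) -> ocyc m' a b c v s.
Proof.
move=> [abc bv h vu os] e; split=> //; first by rewrite e ?mem_head.
  by rewrite (@alt_eq _ _ _ (m c) (m b)) // => z zs; rewrite e.
move: vu; rewrite /unc => /andP[-> /forallP h1]; apply/forallP => d.
by rewrite e ?mem_head.
Qed.

Lemma ocyc_last_out m a b c v s a' b' c' v' s' : optimal m -> ocyc m a b c v s ->
  ocyc m a' b' c' v' s' -> v' \notin v :: s -> last v' s' \notin v :: s.
Proof.
move=> om C C' vs; apply: contra vs => vs.
rewrite -(ocyc_eqi om C (ocyc_rev om C') vs) rev_cons_last.
by rewrite mem_rev mem_head.
Qed.

(** Let [y] be the first vertex of [v :: s] on the chain from [v'], and rotate [v :: s] so that [y]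
    misses [b]. The chain enters [y] by colour [a] and now stops there, whereas by [chain_end] it
    must stop at the other end of the uncoloured edge. *)
Let disj1 m a b c v s v' s' : optimal m -> ocyc m a b c v s ->
  ocyc m c a b v' s' -> v' \notin v :: s -> forall x, x \in v' :: s' -> x \notin v :: s.
Proof.
move=> om C C' v's; have us := ocyc_last_out om C C' v's.
suff h : ~~ has (mem (v :: s)) s'.
  by move=> x; rewrite in_cons => /orP[/eqP->//|xs]; apply: contra h => xs'; apply/hasP; exists x.
apply/negP => hs; set P := mem (v :: s) in hs; pose i := find P s'.
have isz : i < size s' by rewrite -has_find.
pose y := nth v' s' i; have Py : y \in v :: s := nth_find v' hs.
have e : s' = take i s' ++ y :: drop i.+1 s' by rewrite -drop_nth ?cat_take_drop.
have nP : ~~ has P (take i s').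
  apply/hasP => -[z /(nthP v')[j]]; rewrite (size_takel (ltnW isz)) => ji.
  by rewrite nth_take // => <- h; have := before_find v' ji; rewrite h.
have [m' [s2 [om' h1 h2 h3 [C2 e2]]]] := ocyc_rot false om C Py.
have [ab ac bc] := ocyc_neq C.
have cl := ocyc_closed om C; have l' := ocyc_last C'; have [m1 _ _] := om.1.
case: C' => abc' av' h' vu' _; rewrite e in h'.
have hc := @alt_cut _ true P (m b) (m a) (m' b) (m' a) v' _ _ _ (m1 b) (m1 a) h'.
have h4 : alt (m' b) (m' a) v' (rcons (take i s') y).
  apply: hc => //.
  - by move=> z /cl[].
  - by case: C2.
  - by move=> z nz; rewrite !h2.
have ba : b != a by rewrite eq_sym.
have vu2 : unc m' v' (last v' s').
  by move: vu' => /andP[avu /forallP q]; rewrite /unc avu; apply/forallP => d; rewrite h2.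
have av2 : m' a v' = v' by rewrite h2.
have l2 : m' b (last v' s') = last v' s' by rewrite h2.
have := chain_end om' ba av2 l2 vu2 h4; rewrite last_rcons => ee.
by rewrite -ee Py in us.
Qed.

(** For equal types, [v :: s] is closed under both colours of the other chain. For different types,
    reversing the cycles as needed leads to [disj1]. *)
Lemma ocyc_disj m a b c v s a' b' c' v' s' : optimal m -> ocyc m a b c v s ->
  ocyc m a' b' c' v' s' -> v' \notin v :: s -> forall x, x \in v' :: s' -> x \notin v :: s.
Proof.
move=> om C C' v's; have [m1 _ _] := om.1.
have [ea|ne] := eqVneq a' a.
  move=> x; case: (C') => abc' _ h _ _.
  have nb : b' != a /\ c' != a.
    by move: abc'; rewrite uniq3 ea (eq_sym a b') (eq_sym a c') => /and3P[-> -> _].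
  have cl d : d != a -> forall z, (m d z \in v :: s) = (z \in v :: s).
    move=> da z; apply/idP/idP => zs; last exact: (ocyc_closed_ne om C zs da).
    by rewrite -(m1 d z); apply: (ocyc_closed_ne om C zs da).
  by move=> /(alt_const (P := fun z => z \in v :: s) (cl _ nb.2) (cl _ nb.1) h) ->.
have wl b0 c0 v0 s0 : ocyc m a b0 c0 v0 s0 -> a' = c0 -> v0 :: s0 =i v :: s ->
    forall x, x \in v' :: s' -> x \notin v :: s.
  move=> C0 e e0; rewrite e in C'; move: (C') (C0) => [abc' _ _ _ _] [abc0 _ _ _ _].
  have [b'a|b'a] := eqVneq b' a.
    have c'b : c' = b0.
      move: abc' abc0; rewrite b'a => h1 h2; apply: (@uniq3_third b0 a c0).
        by move: h2; rewrite !uniq3 (eq_sym b0 a) => /and3P[-> -> ->].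
      by move: h1; rewrite !uniq3 (eq_sym c' c0) (eq_sym c' a) (eq_sym c0) => /and3P[-> -> ->].
    rewrite b'a c'b in C' => x xs; rewrite -e0.
    by apply: (disj1 om C0 C') => //; rewrite e0.
  have c'a : c' = a.
    have := ord3_case a abc'; rewrite (eq_sym a b') (negPf b'a) -e eq_sym (negPf ne) /=.
    by move/eqP.
  have b'b : b' = b0.
    move: abc' abc0; rewrite c'a => h1 h2; apply: (@uniq3_third b0 a c0).
      by move: h2; rewrite !uniq3 (eq_sym b0 a) => /and3P[-> -> ->].
    by move: h1; rewrite !uniq3 (eq_sym b' c0) (eq_sym c0 a) => /and3P[-> -> ->].
  rewrite c'a b'b in C' => x xs; rewrite -e0.
  apply: (disj1 om C0 (ocyc_rev om C')).
    by rewrite e0; apply: ocyc_last_out C C' v's; rewrite ?e.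
  by rewrite rev_cons_last mem_rev.
case: (C) => abc _ _ _ _.
case/or3P: (ord3_case a' abc) => /eqP e; first by rewrite e eqxx in ne.
  apply: (wl _ _ _ _ (ocyc_rev om C) e) => x.
  by rewrite rev_cons_last mem_rev.
exact: wl _ _ _ _ C e (fun _ => erefl).
Qed.

Definition extremal m g := optimal m /\ forall m', optimal m' -> nfix m g <= nfix m' g.

Lemma ext_fx m m' g : extremal m g -> optimal m' -> nfix m' g = nfix m g -> extremal m' g.
Proof. by move=> [_ e] om' h; split=> // m2 /e; rewrite h. Qed.

Lemma ocyc_rot_miss m a b c v s x d : optimal m -> ocyc m a b c v s -> x \in v :: s -> d != a ->
  exists m', [/\ optimal m', forall d, nfix m' d = nfix m d,
    forall d y, y \notin v :: s -> m' d y = m d y, m' a =1 m a & m' d x = x].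
Proof.
move=> om C xs da; have abc : uniq [:: a; b; c] by case: C.
have [m' [s' [om' h1 h2 h3 [C' e]]]] := ocyc_rot (d == c) om C xs.
exists m'; split=> //.
have dE : d = if d == c then c else b.
  by case: eqP => // dc; case/or3P: (ord3_case d abc) da => /eqP e'; rewrite ?e' ?eqxx.
by rewrite dE; case: C'.
Qed.

(* Otherwise recolouring the joining edge from [a] to [g] would enlarge the class of [g] *)
Lemma ocyc_nonadj m g a b c v s b' c' v' s' x x' : extremal m g -> a != g ->
  ocyc m a b c v s -> ocyc m a b' c' v' s' -> v' \notin v :: s ->
  x \in v :: s -> x' \in v' :: s' -> m a x != x'.
Proof.
move=> [om em] ag C C' v's xs xs'; apply/eqP => e.
have ga : g != a by rewrite eq_sym.
have dj := ocyc_disj om C C' v's.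
have dj' y : y \in v :: s -> y \notin v' :: s' by move=> ys; apply: contraL ys; apply: dj.
have [m2 [om2 f2 o2 a2 gx]] := ocyc_rot_miss om C xs ga.
have C2 : ocyc m2 a b' c' v' s' by apply: (ocyc_ext C') => d y ys; rewrite o2 ?dj.
have [m3 [om3 f3 o3 a3 gx']] := ocyc_rot_miss om2 C2 xs' ga.
have gx3 : m3 g x = x by rewrite o3 ?gx ?dj'.
have [m1 _ _] := om3.1.
have e3 : m3 a x = x' by rewrite a3 a2.
have e3' : m3 a x' = x by rewrite -e3 m1.
pose K := [set x; x'].
have Ka y : y \in K -> m3 a y \in K.
  by rewrite !inE => /orP[]/eqP->; rewrite ?e3 ?e3' eqxx ?orbT.
have Kg y : y \in K -> m3 g y \in K.
  by rewrite !inE => /orP[]/eqP->; rewrite ?gx3 ?gx' eqxx ?orbT.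
have := em _ (opt_kmp om3.1 ag Ka Kg om3); rewrite -f2 -f3 leqNgt => /negP[].
have xx' : x != x' by apply: contraTneq xs => ->; apply: dj.
apply/proper_card/properP; split.
  apply/subsetP => y; rewrite !inE /kempe; case yK: (y \in K) => //.
  by move: yK; rewrite !inE => /orP[]/eqP->; rewrite ?gx3 ?gx'.
exists x; rewrite !inE ?gx3 // /kempe !inE !eqxx /= (negPf ga) e3 eq_sym //.
Qed.

(** * Exchange along a path between two odd cycles *)

Section SwapShare.
Variables (m : 'I_3 -> V -> V) (a b g : 'I_3) (x y : V) (s t : seq V).
Hypothesis em : extremal m g.
Hypothesis Cx : ocyc m a b g x s.
Hypothesis Cy : ocyc m b a g y t.
Hypothesis sh : m b (m a x) = y.
Let z := m a x.
Let K := [set x; z; y].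
Let m' := kempe m a b K.
Let om := em.1.

Let nes : [/\ a != b, a != g & b != g]. Proof. exact: ocyc_neq Cx. Qed.
Let mi c : involutive (m c). Proof. by apply: col_inv om.1. Qed.
Let ax : m a x != x.
Proof. by have := ocyc_sees om Cx (mem_head x s). Qed.
Let bx : m b x = x. Proof. by case: Cx. Qed.
Let ay : m a y = y. Proof. by case: Cy. Qed.
Let az : m a z = x. Proof. by rewrite /z mi. Qed.
Let bz : m b z = y. Proof. exact: sh. Qed.
Let by' : m b y = z. Proof. by rewrite -sh mi. Qed.

Lemma share_out : y \notin x :: s.
Proof.
apply/negP => ys; have [e _] := ocyc_same om Cx Cy ys.
by have [/negP[]] := nes; rewrite e.
Qed.

Let xy : x != y. Proof. by have := share_out; rewrite in_cons negb_or eq_sym => /andP[]. Qed.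
Let zx : z != x. Proof. exact: ax. Qed.
Let zy : z != y.
Proof. by apply/eqP => e; move: az xy; rewrite e ay => ->; rewrite eqxx. Qed.

Let Ka q : q \in K -> m a q \in K.
Proof. by rewrite !inE -orbA => /or3P[]/eqP->; rewrite -/z ?az ?ay eqxx ?orbT. Qed.
Let Kb q : q \in K -> m b q \in K.
Proof. by rewrite !inE -orbA => /or3P[]/eqP->; rewrite -/z ?bz ?bx ?by' eqxx ?orbT. Qed.

Lemma swap_out c q : q \notin K -> m' c q = m c q.
Proof. by rewrite /m' /kempe => /negPf->. Qed.

Lemma swap_g : m' g =1 m g.
Proof.
have [_ ag bg] := nes.
by move=> q; rewrite /m' /kempe (eq_sym g a) (negPf ag) (eq_sym g b) (negPf bg); case: ifP.
Qed.

Lemma swap_a q : q \in K -> m' a q = m b q.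
Proof. by rewrite /m' /kempe => ->; rewrite eqxx. Qed.

Lemma swap_b q : q \in K -> m' b q = m a q.
Proof. by have [ab _ _] := nes; rewrite /m' /kempe => ->; rewrite (eq_sym b a) (negPf ab) eqxx. Qed.

(** [x] misses [b] and [y] misses [a], so [x], [z], [y] is a whole [a]-[b] chain; the class of [g]
    is untouched. *)
Lemma swap_ext : extremal m' g.
Proof.
have [ab ag bg] := nes; apply: (ext_fx em); first exact: (opt_kmp om.1 ab Ka Kb om).
by apply: fx_kmp; rewrite eq_sym.
Qed.

(** Each cycle keeps its uncoloured edge and the colour [g] missed at the far end, while its start
    now misses the other one of [a] and [b]; so the two types change places. *)
Lemma swap_cyc : (exists2 s', ocyc m' b a g x s' & last x s' = last x s) /\
  (exists2 t', ocyc m' a b g y t' & last y t' = last y t).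
Proof.
have [ab ag bg] := nes; have om' := swap_ext.1.
have fin d e w p : ocyc m d e g w p -> uniq [:: e; d; g] -> m' d w = w ->
    exists2 p', ocyc m' e d g w p' & last w p' = last w p.
  move=> C edg dw; have [e' [c [p' C']]] := ocyc_ex om' dw.
  have vu : unc m' w (last w p) by rewrite (unc_kmp _ _ om.1 ab Ka Kb); case: C.
  have vu' : unc m' w (last w p') by case: C'.
  have el := unc_uniq om' vu' vu.
  have cl : m' g (last w p) = last w p by rewrite swap_g (ocyc_last C).
  have cg : c = g.
    by apply: (miss_one om' _ cl); rewrite -el (ocyc_last C').
  have ee : e' = e by apply: (uniq3_third edg); rewrite -cg; case: C'.
  by exists p' => //; rewrite -ee -cg.
split.
- apply: (fin a b x s Cx); last by rewrite swap_a ?bx // !inE eqxx.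
  by rewrite uniq3 eq_sym ab bg ag.
- apply: (fin b a y t Cy); last by rewrite swap_b ?ay // !inE eqxx orbT.
  by rewrite uniq3 ab bg ag.
Qed.

(** A cycle of type [a] through [z] would follow [b] to [y], one of another type would follow [a] to
    [x]; but [y] lies on a cycle of type [b] and [x] on one of type [a]. *)
Lemma share_mid a0 b0 c0 v0 s0 : ocyc m a0 b0 c0 v0 s0 -> z \notin v0 :: s0.
Proof.
move=> C0; apply/negP => z0; have [ab _ _] := nes.
have ty a1 b1 c1 v1 s1 q : ocyc m a1 b1 c1 v1 s1 -> q \in v0 :: s0 -> q \in v1 :: s1 -> a1 = a0.
  move=> C1 q0 q1; have [v10|v10] := boolP (v1 \in v0 :: s0).
    by have [] := ocyc_same om C0 C1 v10.
  by have := ocyc_disj om C0 C1 v10 q1; rewrite q0.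
have [e|ne] := eqVneq a a0.
  have y0 : y \in v0 :: s0 by rewrite -bz; apply: (ocyc_closed_ne om C0 z0); rewrite -e eq_sym.
  by have := ty _ _ _ _ _ _ Cy y0 (mem_head _ _); rewrite -e => /eqP; rewrite eq_sym (negPf ab).
have x0 : x \in v0 :: s0 by rewrite -az; apply: (ocyc_closed_ne om C0 z0).
by have := ty _ _ _ _ _ _ Cx x0 (mem_head _ _) => /eqP; rewrite (negPf ne).
Qed.

Lemma swap_keep a0 b0 c0 v0 s0 : ocyc m a0 b0 c0 v0 s0 -> v0 \notin x :: s ->
  v0 \notin y :: t -> ocyc m' a0 b0 c0 v0 s0.
Proof.
move=> C0 vx vy; apply: (ocyc_ext C0) => d q q0; apply: swap_out.
rewrite !inE -orbA; apply/or3P => -[]/eqP e; rewrite e in q0.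
- by have := ocyc_disj om Cx C0 vx q0; rewrite mem_head.
- by have := share_mid C0; rewrite q0.
- by have := ocyc_disj om Cy C0 vy q0; rewrite mem_head.
Qed.
End SwapShare.

(** * Extremal colourings *)

Hypothesis tri : forall x y z, adj x y -> adj y z -> ~~ adj x z.

Lemma ocyc_type m a b c v s a' b' c' v' s' x : optimal m -> ocyc m a b c v s ->
  ocyc m a' b' c' v' s' -> x \in v :: s -> x \in v' :: s' -> a' = a /\ v' \in v :: s.
Proof.
move=> om C C' xs xs'; have [v's|v's] := boolP (v' \in v :: s).
  by have [] := ocyc_same om C C' v's.
by have := ocyc_disj om C C' v's xs'; rewrite xs.
Qed.

Lemma ocyc_size m a b c v s : optimal m -> ocyc m a b c v s -> 4 <= size s.
Proof.
move=> om [_ bv h vu os]; have [_ m2 _] := om.1.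
case: s h vu os => [|p [|q [|r [|r' s]]]] //=.
  by move=> _ /(unc_neq); rewrite eqxx.
move=> /and5P[/eqP e1 n1 /eqP e2 n2 _] /andP[vq _] _.
have vp : adj v p by rewrite -e1 m2 // e1.
have pq : adj p q by rewrite -e2 m2 // e2.
by have := tri vp pq; rewrite vq.
Qed.

(** Arriving on a cycle of the same type contradicts [ocyc_nonadj]; a cycle of another type is
    closed under [a] and would contain [x]. *)
Lemma ocyc_out m g a b c v s x a' b' c' v' s' : extremal m g -> a != g -> ocyc m a b c v s ->
  x \in v :: s -> m a x \notin v :: s -> ocyc m a' b' c' v' s' -> m a x \notin v' :: s'.
Proof.
move=> em ag C xs ax C'; have om := em.1; apply/negP => ax'.
have v's : v' \notin v :: s.
  by apply: contra ax => v's; rewrite -(ocyc_eqi om C C' v's).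
have [e|ne] := eqVneq a a'.
  by have := ocyc_nonadj em ag C (eq_ind_r (fun i => ocyc m i _ _ _ _) C' e)
       v's xs ax'; rewrite eqxx.
have := ocyc_closed_ne om C' ax' ne; rewrite (col_inv _ om.1) => xs'.
by have := ocyc_disj om C C' v's xs'; rewrite xs.
Qed.

Definition cover m : {set V} :=
  [set x | `[< exists a b c v s, ocyc m a b c v s /\ x \in v :: s >]].

Lemma coverP m x : reflect (exists a b c v s, ocyc m a b c v s /\ x \in v :: s) (x \in cover m).
Proof. by rewrite inE; apply: asboolP. Qed.

Lemma ocyc_cover m a b c v s x : ocyc m a b c v s -> x \in v :: s -> x \in cover m.
Proof. by move=> C xs; apply/coverP; exists a, b, c, v, s. Qed.

Definition extremal2 m g := extremal m g /\ forall m', extremal m' g -> #|cover m'| <= #|cover m|.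

(** Rotating one odd cycle keeps the vertex sets of all of them, so the cover stays maximal. *)
Lemma ext3_rot m g a b c v s m' b' c' x s' : extremal2 m g -> ocyc m a b c v s ->
  optimal m' -> (forall d, nfix m' d = nfix m d) ->
  (forall d y, y \notin v :: s -> m' d y = m d y) ->
  ocyc m' a b' c' x s' -> x :: s' =i v :: s -> extremal2 m' g.
Proof.
move=> [em mx] C om' h1 h2 C' e; split; first exact: ext_fx em om' (h1 g).
move=> m2 /mx/leq_trans; apply; apply/subset_leq_card/subsetP => q /coverP.
move=> [a0 [b0 [c0 [v0 [s0 [C0 q0]]]]]].
have [v0s|v0s] := boolP (v0 \in v :: s).
  by apply: (ocyc_cover C'); rewrite e -(ocyc_eqi em.1 C C0 v0s).
apply: (ocyc_cover _ q0); apply: (ocyc_ext C0) => d y ys.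
by rewrite h2 // (ocyc_disj em.1 C C0 v0s).
Qed.

Section SwapBound.
Variables (m : 'I_3 -> V -> V) (a b g : 'I_3) (x y : V) (s t : seq V).
Hypothesis em3 : extremal2 m g.
Hypothesis Cx : ocyc m a b g x s.
Hypothesis Cy : ocyc m b a g y t.
Hypothesis sh : m b (m a x) = y.

Let em := em3.1.
Let om := em.1.
Let K := [set x; m a x; y].
Let m' := kempe m a b K.
Let em' : extremal m' g. Proof. exact: (swap_ext em Cx Cy sh). Qed.
Let om' := em'.1.

(* After exchanging [a] and [b] along the path [x], [m a x], [y], the two cycles are replaced
   by two other ones, [P] and [Q], of swapped types *)
Lemma swap_bound : exists s' t', let P := x :: s' in let Q := y :: t' in
  [/\ last x s' = last x s /\ last y t' = last y t,
    [/\ 4 <= size s', 4 <= size t', ~~ odd (size s'), ~~ odd (size t')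
      & size s' + size t' <= size s + size t],
    [/\ forall q, q \in P -> m g q \in P, forall q, q \in P -> q != x -> m a q \in P,
        forall q, q \in Q -> m g q \in Q & forall q, q \in Q -> q != y -> m b q \in Q],
    [/\ size s' = 4 -> m g (m a (m g x)) = m a (last x s)
      & size t' = 4 -> m g (m b (m g y)) = m b (last y t)]
  & [/\ uniq P, uniq Q,
      (forall b2 c2 v2 s2 w, ocyc m b b2 c2 v2 s2 -> v2 \notin y :: t ->
        w \in P -> m b w \notin v2 :: s2)
    & (forall b2 c2 v2 s2 w, ocyc m a b2 c2 v2 s2 -> v2 \notin x :: s ->
        w \in Q -> m a w \notin v2 :: s2)]].
Proof.
have [[s' C1 l1] [t' C2 l2]] := swap_cyc em Cx Cy sh.
rewrite -/K -/m' in C1 C2.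
have [ab ag bg] := ocyc_neq Cx.
have mid := share_mid em Cx Cy sh.
have keep := swap_keep em Cx Cy sh; rewrite -/K -/m' in keep.
have [m1 _ _] := om.1.
have Kb q : q \in K -> m b q \in K.
  have bx : m b x = x by case: Cx.
  rewrite !inE -orbA => /or3P[]/eqP->; rewrite ?bx ?sh ?eqxx ?orbT //.
  by rewrite -sh m1 eqxx orbT.
have Ka q : q \in K -> m a q \in K.
  have ay : m a y = y by case: Cy.
  by rewrite !inE -orbA => /or3P[]/eqP->; rewrite ?ay ?m1 ?eqxx ?orbT.
have yP : y \notin x :: s'.
  by apply/negP => h; have [e _] := ocyc_same om' C1 C2 h; rewrite e eqxx in ab.
have PQ := ocyc_disj om' C1 C2 yP.
(* The start of an odd cycle of [m] that lies on a new cycle is one of the two ends of the latter,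
   and these ends lie on the corresponding old cycle. *)
have outW a1 b1 w s1 s0 : ocyc m' a1 b1 g w s1 -> last w s1 = last w s0 ->
    (forall v, v \in w :: s1 -> v != m a x -> v \in K -> v = w) ->
    forall a2 b2 c2 v2 s2, ocyc m a2 b2 c2 v2 s2 -> v2 \notin w :: s0 -> v2 \notin w :: s1.
  move=> C0 l0 Kw a2 b2 c2 v2 s2 C h; apply: contra h => h.
  have b2v : m b2 v2 = v2 by case: C.
  have zv : v2 != m a x by apply: contraTneq (mid _ _ _ _ _ C) => ->; rewrite mem_head.
  have [vK|vK] := boolP (v2 \in K); first by rewrite (Kw _ h zv vK) mem_head.
  have b2v' : m' b2 v2 = v2 by rewrite /m' swap_out.
  by have [[e _]|[e _]] := ocyc_miss om' C0 h b2v'; rewrite e ?l0 ?mem_head ?mem_last.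
have outP : forall a2 b2 c2 v2 s2, ocyc m a2 b2 c2 v2 s2 -> v2 \notin x :: s -> v2 \notin x :: s'.
  apply: (outW _ _ _ _ _ C1 l1) => v h /negPf zv; rewrite !inE zv orbF => /orP[/eqP //|/eqP e].
  by rewrite -e h in yP.
have outQ : forall a2 b2 c2 v2 s2, ocyc m a2 b2 c2 v2 s2 -> v2 \notin y :: t -> v2 \notin y :: t'.
  apply: (outW _ _ _ _ _ C2 l2) => v h /negPf zv; rewrite !inE zv orbF => /orP[/eqP e|/eqP //].
  by have := PQ v h; rewrite e mem_head.
have zE : m' a (m a x) = y by rewrite /m' swap_a // !inE eqxx orbT.
have zE' : m' b (m a x) = x.
  by rewrite /m' (swap_b Cx) ?m1 // !inE eqxx orbT.
have zP : m a x \notin x :: s'.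
  by apply: contra yP => h; rewrite -zE; apply: (ocyc_closed_ne om' C1 h).
have zQ : m a x \notin y :: t'.
  apply/negP => h; have := ocyc_closed_ne om' C2 h (d := b); rewrite zE' eq_sym => /(_ ab) h'.
  by have := PQ _ h'; rewrite mem_head.
have xQ : x \notin y :: t' by apply/negP => /PQ; rewrite mem_head.
have sameP q : q \in x :: s' -> q != x -> m' a q = m a q.
  move=> h qx; rewrite /m' swap_out // !inE negb_or negb_or qx /=.
  by apply/andP; split; [apply: contraNneq zP | apply: contraNneq yP] => <-.
have sameQ q : q \in y :: t' -> q != y -> m' b q = m b q.
  move=> h qy; rewrite /m' swap_out // !inE negb_or negb_or qy andbT.
  by apply/andP; split; [apply: contraNneq xQ | apply: contraNneq zQ] => <-.
have nshare q : m' g q = m g q by rewrite /m' (swap_g _ Cx).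
have KN a2 b2 c2 v2 s2 w : ocyc m a2 b2 c2 v2 s2 -> v2 \notin x :: s -> v2 \notin y :: t ->
    w \in K -> w \notin v2 :: s2.
  move=> C vx vy; rewrite !inE -orbA => /or3P[]/eqP->.
  - by apply/negP => h; have := ocyc_disj om Cx C vx h; rewrite mem_head.
  - exact: mid C.
  - by apply/negP => h; have := ocyc_disj om Cy C vy h; rewrite mem_head.
have ninP a2 b2 c2 v2 s2 w : ocyc m a2 b2 c2 v2 s2 -> v2 \notin x :: s -> v2 \notin y :: t ->
    w \in v2 :: s2 -> w \notin x :: s'.
  by move=> C vx vy; apply: (ocyc_disj om' C1 (keep _ _ _ _ _ C vx vy)); apply: outP C vx.
have ninQ a2 b2 c2 v2 s2 w : ocyc m a2 b2 c2 v2 s2 -> v2 \notin x :: s -> v2 \notin y :: t ->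
    w \in v2 :: s2 -> w \notin y :: t'.
  by move=> C vx vy; apply: (ocyc_disj om' C2 (keep _ _ _ _ _ C vx vy)); apply: outQ C vy.
(* All other odd cycles survive, disjoint from the new ones, so a larger total would contradict the
   maximality of the cover. *)
have bound : size s' + size t' <= size s + size t.
  pose S (p : seq V) := [set q in p].
  have cS p : uniq p -> #|S p| = size p by move=> up; rewrite cardsE (card_uniqP up).
  have u1 := ocyc_uniq om Cx; have u2 := ocyc_uniq om Cy.
  have u3 := ocyc_uniq om' C1; have u4 := ocyc_uniq om' C2.
  pose R := cover m :\: (S (x :: s) :|: S (y :: t)).
  have Rc q : q \in R -> exists a2 b2 c2 v2 s2,
      [/\ ocyc m a2 b2 c2 v2 s2, q \in v2 :: s2, v2 \notin x :: s & v2 \notin y :: t].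
    rewrite inE => /andP[]; rewrite !inE -!in_cons negb_or => /andP[qx qy].
    move=> /asboolP [a2 [b2 [c2 [v2 [s2 [C q2]]]]]]; exists a2, b2, c2, v2, s2; split=> //.
      by apply: contra qx => h; rewrite -(ocyc_eqi om Cx C h).
    by apply: contra qy => h; rewrite -(ocyc_eqi om Cy C h).
  have Rq q : q \in R -> q \notin x :: s' /\ q \notin y :: t'.
    move=> /Rc[a2 [b2 [c2 [v2 [s2 [C q2 vx vy]]]]]].
    by split; [apply: ninP C vx vy q2 | apply: ninQ C vx vy q2].
  have sub : S (x :: s') :|: S (y :: t') :|: R \subset cover m'.
    rewrite !subUset -andbA; apply/and3P; split; apply/subsetP => q.
    - by rewrite inE; apply: ocyc_cover C1.
    - by rewrite inE; apply: ocyc_cover C2.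
    move=> /Rc[a2 [b2 [c2 [v2 [s2 [C q2 vx vy]]]]]].
    exact: ocyc_cover (keep _ _ _ _ _ C vx vy) q2.
  have := leq_trans (subset_leq_card sub) (em3.2 _ em').
  have d1 : [disjoint S (x :: s') :|: S (y :: t') & R].
    apply/pred0P => q /=; apply/negbTE; rewrite negb_and; have [qR|] := boolP (q \in R); last by rewrite orbT.
    by have [h1 h2] := Rq q qR; rewrite orbF !inE -!in_cons negb_or h1 h2.
  have d2 : [disjoint S (x :: s') & S (y :: t')].
    apply/pred0P => q /=; apply/negbTE; rewrite negb_and.
    have [h|] := boolP (q \in S (y :: t')); last by rewrite orbT.
    by rewrite orbF !inE -!in_cons; apply: PQ; move: h; rewrite inE.
  have e1 := leq_card_setU (S (x :: s') :|: S (y :: t')) R.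
  have e2 := leq_card_setU (S (x :: s')) (S (y :: t')).
  rewrite d1 in e1; rewrite d2 in e2; rewrite (eqP (e1.2 : _ == _)) (eqP (e2.2 : _ == _)).
  rewrite !cS // => h.
  have : #|cover m| <= #|R| + (size (x :: s) + size (y :: t)).
    rewrite -!cS // -(cardsID (S (x :: s) :|: S (y :: t)) (cover m)) addnC leq_add2l.
    apply: leq_trans (subset_leq_card (subsetIr _ _)) _.
    exact: (leq_card_setU _ _).1.
  move: h => /=; move: (size s) (size s') (size t) (size t') #|R| #|cover m|.
  by clear=> *; lia.
have s4 := ocyc_size om' C1; have t4 := ocyc_size om' C2.
exists s', t'; split=> //.
- by split=> //; [case: C1 | case: C2].
- split=> q.
  + by move=> h; rewrite -nshare; apply: (ocyc_closed_ne om' C1 h); rewrite eq_sym.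
  + by move=> h qx; rewrite -sameP //; apply: (ocyc_closed_ne om' C1 h).
  + by move=> h; rewrite -nshare; apply: (ocyc_closed_ne om' C2 h); rewrite eq_sym.
  + by move=> h qy; rewrite -sameQ //; apply: (ocyc_closed_ne om' C2 h); rewrite eq_sym.
(* On a 5-cycle the vertex before the last is reached from the start by three steps and from the
   last vertex by one. *)
- split=> sz.
  + have u := ocyc_uniq om' C1; case: C1 => _ _ h _ _; rewrite -l1.
    case: s' sz h u sameP {l1 outP PQ yP zP ninP bound s4} => [|q1 [|q2 [|q3 [|q4 [|]]]]] //= _.
    move=> /and5P[/eqP e1 n1 /eqP e2 n2 /and5P[/eqP e3 n3 /eqP e4 n4 _]] u same.
    have n3x : q3 != x by apply: contraTneq u => ->; rewrite !inE eqxx !orbT.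
    rewrite -!nshare e1 -same ?inE ?eqxx ?orbT // e2 e3 -[q3 in LHS](m1 a) -[m a q3]same ?inE ?eqxx ?orbT //.
    by rewrite e4.
  + have u := ocyc_uniq om' C2; case: C2 => _ _ h _ _; rewrite -l2.
    case: t' sz h u sameQ {l2 outQ PQ zQ xQ ninQ bound t4} => [|q1 [|q2 [|q3 [|q4 [|]]]]] //= _.
    move=> /and5P[/eqP e1 n1 /eqP e2 n2 /and5P[/eqP e3 n3 /eqP e4 n4 _]] u same.
    have n3y : q3 != y by apply: contraTneq u => ->; rewrite !inE eqxx !orbT.
    rewrite -!nshare e1 -same ?inE ?eqxx ?orbT // e2 e3 -[q3 in LHS](m1 b) -[m b q3]same ?inE ?eqxx ?orbT //.
    by rewrite e4.
(* The exchanged colouring is extremal too, so [ocyc_nonadj] separates each new cycle from the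
   surviving cycles of its new type. *)
- split=> //; [exact: ocyc_uniq om' C1 | exact: ocyc_uniq om' C2 | |].
  + move=> b2 c2 v2 s2 w C vy wP; apply/negP => h.
    have vx : v2 \notin x :: s.
      by apply/negP => vx; have [e _] := ocyc_same om Cx C vx; rewrite e eqxx in ab.
    have [wK|wK] := boolP (w \in K).
      by have := KN _ _ _ _ _ _ C vx vy (Kb _ wK); rewrite h.
    have := ocyc_nonadj em' bg C1 (keep _ _ _ _ _ C vx vy) (outP _ _ _ _ _ C vx) wP h.
    by rewrite /m' swap_out // eqxx.
  + move=> b2 c2 v2 s2 w C vx wQ; apply/negP => h.
    have vy : v2 \notin y :: t.
      by apply/negP => vy; have [e _] := ocyc_same om Cy C vy; rewrite e eqxx in ab.
    have [wK|wK] := boolP (w \in K).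
      by have := KN _ _ _ _ _ _ C vx vy (Ka _ wK); rewrite h.
    have := ocyc_nonadj em' ag C2 (keep _ _ _ _ _ C vx vy) (outQ _ _ _ _ _ C vy) wQ h.
    by rewrite /m' swap_out // eqxx.
Qed.
End SwapBound.

(** Both cycles are first rotated to start at [x] and [y] with [g] missed at the far ends. [m'] is
    this rotated colouring; the exchanged one appears only through the vertex lists [P] and [Q] of
    its two cycles and their closure properties. *)
Lemma share_swap m g a b b1 c1 v1 s1 b2 c2 v2 s2 x : extremal2 m g -> uniq [:: a; b; g] ->
  ocyc m a b1 c1 v1 s1 -> ocyc m b b2 c2 v2 s2 ->
  x \in v1 :: s1 -> m b (m a x) \in v2 :: s2 ->
  let y := m b (m a x) in let p1 := v1 :: s1 in let p2 := v2 :: s2 in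
  exists m' s t (P Q : seq V),
  [/\ [/\ x :: s = rot (index x p1) p1, y :: t = rot (index y p2) p2,
        alt (m' g) (m' b) x s, alt (m' g) (m' a) y t & forall c, involutive (m' c)],
      [/\ forall q, q \in p1 -> m' a q = m a q, forall q, q \in p2 -> m' b q = m b q
        & forall c q, q \notin cover m -> m' c q = m c q],
      [/\ [/\ x \in P, last x s \in P, uniq P, forall q, q \in P -> m' g q \in P
           & forall q, q \in P -> q != x -> m' a q \in P],
          [/\ y \in Q, last y t \in Q, uniq Q, forall q, q \in Q -> m' g q \in Q
           & forall q, q \in Q -> q != y -> m' b q \in Q],
          5 <= size P, 5 <= size Q & size P + size Q <= size p1 + size p2],
      [/\ size P = 5 -> m' g (m' a (m' g x)) = m' a (last x s)
        & size Q = 5 -> m' g (m' b (m' g y)) = m' b (last y t)]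
    & [/\ forall b3 c3 v3 s3 w, ocyc m b b3 c3 v3 s3 -> v3 \notin p2 ->
          w \in P -> m' b w \notin v3 :: s3
        & forall b3 c3 v3 s3 w, ocyc m a b3 c3 v3 s3 -> v3 \notin p1 ->
          w \in Q -> m' a w \notin v3 :: s3]].
Proof.
move=> em abg C1 C2 xs ys y p1 p2; have om := em.1.1.
have [ab ag bg] := uniq3_neq abg.
have rots a0 b0 b1' c1' v s z (m0 := m) : uniq [:: a0; b0; g] -> forall m0, extremal2 m0 g ->
    ocyc m0 a0 b1' c1' v s -> z \in v :: s -> exists m' s',
    [/\ extremal2 m' g, ocyc m' a0 b0 g z s', z :: s' = rot (index z (v :: s)) (v :: s),
      forall d q, q \notin v :: s -> m' d q = m0 d q & m' a0 =1 m0 a0].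
  move=> abc m2 em2 C zs; have om2 := em2.1.1; have abc' : uniq [:: a0; b1'; c1'] by case: C.
  have [m' [s' [om' h1 h2 h3 [C' e]]]] := ocyc_rot (b0 != b1') om2 C zs.
  have bb : (if b0 != b1' then c1' else b1') = b0.
    case: eqP => [-> //|/eqP nb] /=; have := ord3_case b0 abc'; rewrite (negPf nb) /=.
    by move: abc; rewrite uniq3 eq_sym => /and3P[/negPf-> _ _] /= /eqP.
  have gg : (if b0 != b1' then b1' else c1') = g.
    have := ord3_case g abc'; move: abc bb; rewrite uniq3 => /and3P[_ /negPf ag0 bg0].
    rewrite [g == a0]eq_sym ag0 /= => bb.
    by move: bb bg0; case: eqP => [->|_] /= e0; rewrite -?e0 ![_ == g]eq_sym => /negPf->; rewrite ?orbF /= => /eqP.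
  rewrite bb gg in C'; exists m', s'; split=> //.
  by apply: (ext3_rot em2 C om' h1 h2 C') => q; rewrite e mem_rot.
have v21 : v2 \notin p1.
  by apply/negP => h; have [e _] := ocyc_same om C1 C2 h; rewrite e eqxx in ab.
have dj := ocyc_disj om C1 C2 v21.
have [m1 [s [em1 C1' e1 o1 a1]]] := rots a b _ _ _ _ _ abg m em C1 xs.
have C2' : ocyc m1 b b2 c2 v2 s2 by apply: (ocyc_ext C2) => d q q2; rewrite o1 ?dj.
have bag : uniq [:: b; a; g] by rewrite uniq3 eq_sym ab bg ag.
have [m' [t [em' C2'' e2 o2 b2']]] := rots b a _ _ _ _ _ bag m1 em1 C2' ys.
have C1'' : ocyc m' a b g x s.
  apply: (ocyc_ext C1') => d q; rewrite -/p1 => q1; apply: o2; apply/negP => /dj.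
  by rewrite -[_ \in v1 :: s1](mem_rot (index x p1)) -e1 q1.
have dj' q : q \in p1 -> q \notin p2 by move=> q1; apply/negP => /dj; rewrite q1.
have ma q : q \in p1 -> m' a q = m a q by move=> q1; rewrite o2 ?a1 ?dj'.
have mb q : q \in p2 -> m' b q = m b q by move=> q2; rewrite b2' o1 ?dj.
have sh : m' b (m' a x) = y.
  have e : m b y = m a x by rewrite /y (col_inv _ om.1).
  by rewrite ma // -e -(mb y ys) (col_inv _ em'.1.1.1).
have [s' [t' [[l1 l2] [z1 z2 z3 z4 z5] [h1 h2 h3 h4] [h5 h6] [u1 u2 h7 h8]]]] :=
  swap_bound em' C1'' C2'' sh.
have tr C3a b3 c3 v3 s3 : ocyc m C3a b3 c3 v3 s3 -> v3 \notin p1 -> v3 \notin p2 ->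
    ocyc m' C3a b3 c3 v3 s3.
  move=> C3 n1 n2; apply: (ocyc_ext C3) => d q q3.
  by rewrite o2 ?o1 //; [apply: ocyc_disj om C1 C3 n1 _ q3 | apply: ocyc_disj om C2 C3 n2 _ q3].
have sz1 : size (x :: s) = size p1 by rewrite e1 size_rot.
have sz2 : size (y :: t) = size p2 by rewrite e2 size_rot.
exists m', s, t, (x :: s'), (y :: t'); split.
- by split=> //; [case: C1'' | case: C2'' | case: em'.1.1.1].
- split=> // c q qc; rewrite o2 ?o1 //; apply: contra qc => h.
    exact: ocyc_cover C1 h.
  exact: ocyc_cover C2 h.
- split=> //; first by split=> //; [exact: mem_head | rewrite -l1 mem_last].
    by split=> //; [exact: mem_head | rewrite -l2 mem_last].
  by rewrite -sz1 -sz2 /= !addSn !addnS !ltnS.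
- by split=> [[]|[]]; [exact: h5 | exact: h6].
split=> b3 c3 v3 s3 w C3 n3 wP.
  have n1 : v3 \notin p1.
    by apply/negP => h; have [e _] := ocyc_same om C1 C3 h; rewrite e eqxx in ab.
  apply: (h7 _ _ _ _ _ (tr _ _ _ _ _ C3 n1 n3)) => //.
  by rewrite e2 mem_rot.
have n1 : v3 \notin p2.
  by apply/negP => h; have [e _] := ocyc_same om C2 C3 h; rewrite e eqxx in ab.
apply: (h8 _ _ _ _ _ (tr _ _ _ _ _ C3 n3 n1)) => //.
by rewrite e1 mem_rot.
Qed.

(** * Short odd cycles *)

Section Cases.
Variables (m : 'I_3 -> V -> V) (g : 'I_3).
Hypothesis em3 : extremal2 m g.
Let em := em3.1.
Let om := em.1.

(** An odd cycle read from any vertex: where the uncoloured edge lies is forgotten, since rotation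
    can move it anywhere. *)
Definition ocy a p := exists b c v s, ocyc m a b c v s /\ reads (v :: s) p.

Lemma ocy_uniq a p : ocy a p -> uniq p.
Proof.
by move=> [b [c [v [s [C r]]]]]; rewrite (reads_uniq r); exact: ocyc_uniq om C.
Qed.

Lemma ocy_rot1 a x s : ocy a (x :: s) -> ocy a (rcons s x).
Proof.
by move=> [b [c [v [t [C r]]]]]; exists b, c, v, t; split; [|exact: reads_rot1].
Qed.

Lemma ocy_rev a p : ocy a p -> ocy a (rev p).
Proof.
move=> [b [c [v [t [C r]]]]].
exists c, b, (last v t), (rev (belast v t)); split; first exact: ocyc_rev.
by rewrite rev_cons_last; apply: reads_rev.
Qed.

Lemma ocy_from a p x : ocy a p -> x \in p -> exists2 s, ocy a (x :: s) & x :: s =i p.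
Proof.
move=> [b [c [v [t [C r]]]]] xp.
have [s rs] : exists s, reads (v :: t) (x :: s) by apply: reads_from; rewrite -(reads_mem r).
exists s; first by exists b, c, v, t.
by move=> q; rewrite (reads_mem rs) (reads_mem r).
Qed.

Lemma ocy_odd a p : ocy a p -> odd (size p).
Proof. by move=> [b [c [v [t [[_ _ _ _ /= h] r]]]]]; rewrite (reads_size r) /=. Qed.

Lemma ocy_size a p : ocy a p -> 5 <= size p.
Proof.
move=> [b [c [v [t [C r]]]]]; rewrite (reads_size r) /= ltnS.
exact: (ocyc_size om C).
Qed.

Lemma ocy_cover a p x : ocy a p -> x \in p -> x \in cover m.
Proof. by move=> [b [c [v [t [C r]]]]]; rewrite (reads_mem r) => /(ocyc_cover C). Qed.

Lemma ocy_type a p a' p' x : ocy a p -> ocy a' p' -> x \in p -> x \in p' ->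
  a' = a /\ p' =i p.
Proof.
move=> [b [c [v [t [C r]]]]] [b' [c' [v' [t' [C' r']]]]].
rewrite (reads_mem r) (reads_mem r') => xt xt'.
have [e h] := ocyc_type om C C' xt xt'; split=> // q.
by rewrite (reads_mem r) (reads_mem r') (ocyc_eqi om C C' h).
Qed.

Lemma ocy_out a p x : ocy a p -> a != g -> x \in p -> m a x \notin p -> m a x \notin cover m.
Proof.
move=> [b [c [v [t [C r]]]]] ag; rewrite !(reads_mem r) => xt ax.
apply/negP => /coverP[a0 [b0 [c0 [v0 [s0 [C0 h]]]]]].
by have := ocyc_out em ag C xt ax C0; rewrite h.
Qed.

Lemma ocy_closed a p x d : ocy a p -> x \in p -> d != a -> m d x \in p.
Proof.
move=> [b [c [v [t [C r]]]]]; rewrite !(reads_mem r) => xt da.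
exact: ocyc_closed_ne om C xt da.
Qed.

Lemma share_nocover a b p p' x : ocy a p -> ocy b p' -> a != b -> x \in p ->
  m b (m a x) \in p' -> m a x \notin cover m.
Proof.
move=> O O' ab xp yp; apply/negP => /coverP[a0 [b0 [c0 [v0 [s0 [C0 h]]]]]].
have O0 : ocy a0 (v0 :: s0) by exists b0, c0, v0, s0; split=> //; apply: reads_refl.
have [e|ne] := eqVneq a a0.
  have ba : b != a0 by rewrite -e eq_sym.
  by have [e2 _] := ocy_type O0 O' (ocy_closed O0 h ba) yp; rewrite e2 e eqxx in ab.
have := ocy_closed O0 h ne; rewrite (col_inv _ om.1) => x0.
by have [e2 _] := ocy_type O0 O x0 xp; rewrite e2 eqxx in ne.
Qed.

Lemma ocy_reading a p x k : ocy a p -> size p = k.+1 -> x \in p ->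
  exists s, [/\ ocy a (x :: s), x :: s =i p & size s = k].
Proof.
move=> O sz xp; have [s O1 e] := ocy_from O xp; exists s; split=> //.
apply/eqP; rewrite -eqSS -/(size (x :: s)) -(card_uniqP (ocy_uniq O1)) (eq_card e).
by rewrite (card_uniqP (ocy_uniq O)) sz.
Qed.

Lemma ocy_head a x s : ocy a (x :: s) -> exists m1 b c,
  [/\ optimal m1, m1 a =1 m a & ocyc m1 a b c x s].
Proof.
move=> O; have uO := ocy_uniq O; case: O => [b [c [v [t [C r]]]]].
have xt : x \in v :: t by rewrite -(reads_mem r) mem_head.
have [m1 [s' [om1 _ _ h [C1 e]]]] := ocyc_rot false om C xt.
exists m1, b, c; split=> //.
by have := reads_index (etrans (esym (reads_uniq r)) uO) r; rewrite -e => -[->].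
Qed.

(** With the cycle rotated to start at [x0], the edge to [x1] has another colour; an edge to [x2]
    would close a triangle. *)
Lemma ocy_near a x0 x1 x2 s : ocy a [:: x0, x1, x2 & s] -> (m a x0 != x1) && (m a x0 != x2).
Proof.
move=> /ocy_head[m1 [b [c [om1 e C1]]]]; have [ab ac bc] := ocyc_neq C1.
have [_ m2 m3] := om1.1; rewrite -!e.
have a0 := ocyc_sees om1 C1 (mem_head _ _).
case: C1 => _ _ /= /and4P[/eqP e1 n1 /eqP e2 /andP[n2 _]] _ _; apply/andP; split.
  by rewrite -e1; apply: m3.
apply/eqP => h; have a01 : adj x0 x1 by rewrite -e1 m2 // e1.
have a12 : adj x1 x2 by rewrite -e2 m2 // e2.
by have := tri a01 a12; rewrite -h m2.
Qed.

Lemma ocy_sees a p x : ocy a p -> x \in p -> m a x != x.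
Proof.
move=> O /(ocy_from O)[s O1 _]; have [m1 [b [c [om1 e C1]]]] := ocy_head O1.
by rewrite -e; apply: (ocyc_sees om1 C1); rewrite mem_head.
Qed.

Lemma ocy_swap a b x s y t : uniq [:: a; b; g] -> ocy a (x :: s) -> ocy b (y :: t) ->
  m b (m a x) = y ->
  exists m' (P Q : seq V),
  [/\ [/\ alt (m' g) (m' b) x s, alt (m' g) (m' a) y t & forall c, involutive (m' c)],
      [/\ forall q, q \in x :: s -> m' a q = m a q, forall q, q \in y :: t -> m' b q = m b q
        & forall c q, q \notin cover m -> m' c q = m c q],
      [/\ [/\ x \in P, last x s \in P, uniq P, forall q, q \in P -> m' g q \in P
           & forall q, q \in P -> q != x -> m' a q \in P],
          [/\ y \in Q, last y t \in Q, uniq Q, forall q, q \in Q -> m' g q \in Q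
           & forall q, q \in Q -> q != y -> m' b q \in Q],
          5 <= size P, 5 <= size Q & size P + size Q <= size (x :: s) + size (y :: t)],
      [/\ size P = 5 -> m' g (m' a (m' g x)) = m' a (last x s)
        & size Q = 5 -> m' g (m' b (m' g y)) = m' b (last y t)]
    & [/\ forall p3 w, ocy b p3 -> w \in P -> m' b w \in p3 -> p3 =i y :: t
        & forall p3 w, ocy a p3 -> w \in Q -> m' a w \in p3 -> p3 =i x :: s]].
Proof.
move=> abg O1 O2 sh; have u1 := ocy_uniq O1; have u2 := ocy_uniq O2.
move: (O1) (O2) => [b1 [c1 [v1 [s1 [C1 r1]]]]] [b2 [c2 [v2 [s2 [C2 r2]]]]].
have x1 : x \in v1 :: s1 by rewrite -(reads_mem r1) mem_head.
have y2 : m b (m a x) \in v2 :: s2 by rewrite sh -(reads_mem r2) mem_head.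
have := share_swap em3 abg C1 C2 x1 y2; rewrite /= sh.
move=> [m' [s' [t' [P [Q [[e1 e2 h1 h2 inv] h3 h4 h5 [h6 h7]]]]]]].
have es : s' = s.
  by have := reads_index (etrans (esym (reads_uniq r1)) u1) r1; rewrite -e1 => -[->].
have et : t' = t.
  by have := reads_index (etrans (esym (reads_uniq r2)) u2) r2; rewrite -e2 => -[->].
rewrite {}es {}et in e1 e2 h1 h2 h4 h5; exists m', P, Q.
have sz1 : (size s1).+1 = size (x :: s) by rewrite (reads_size r1).
have sz2 : (size s2).+1 = size (y :: t) by rewrite (reads_size r2).
rewrite sz1 sz2 in h4.
have [h3a h3b h3c] := h3; split=> //.
- by split=> // q; rewrite ?(reads_mem r1) ?(reads_mem r2) => qq; [apply: h3a | apply: h3b].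
split=> p3 w [b3 [c3 [v3 [s3 [C3 r3]]]]] wP; rewrite (reads_mem r3) => wp.
  have [v32|v32] := boolP (v3 \in v2 :: s2); last by have := h6 _ _ _ _ _ C3 v32 wP; rewrite wp.
  by move=> q; rewrite (reads_mem r3) (reads_mem r2) (ocyc_eqi om C2 C3 v32).
have [v32|v32] := boolP (v3 \in v1 :: s1); last by have := h7 _ _ _ _ _ C3 v32 wP; rewrite wp.
by move=> q; rewrite (reads_mem r3) (reads_mem r1) (ocyc_eqi om C1 C3 v32).
Qed.

Lemma ocy_mirror a x s : ocy a (x :: s) -> ocy a (x :: rev s).
Proof. by move=> /ocy_rot1/ocy_rev; rewrite rev_rcons. Qed.

(** * Cycles of length 5 *)

Section TwoColours.
Variables (a b : 'I_3).
Hypothesis abg : uniq [:: a; b; g].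

Let neqs : [/\ a != b, a != g & b != g].
Proof. exact: uniq3_neq. Qed.

Lemma share_next x0 x1 s p2 p3 : ocy a [:: x0, x1 & s] -> ocy b p2 -> ocy b p3 ->
  m b (m a x0) \in p2 -> m b (m a x1) \in p3 -> p3 =i p2.
Proof.
have [ab ag bg] := neqs.
move=> O1 O2 O3 sh2 sh3; have [t O2' e2] := ocy_from O2 sh2.
have [m' [P [Q [[h1 _ _] [e1 _ ec] [[xP _ _ gP aP] _ _ _ _] _ [cr _]]]]] := ocy_swap abg O1 O2' erefl.
case/and3P: h1 => /eqP g0 n1 _.
have x1P : x1 \in P by rewrite -g0 gP.
have x1s : x1 \in [:: x0, x1 & s] by rewrite !inE eqxx orbT.
have wP : m a x1 \in P by rewrite -e1 // aP.
have nc := share_nocover O1 O3 ab x1s sh3.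
by move=> q; rewrite -e2 (cr _ _ O3 wP) // ec.
Qed.

(** On a 5-cycle every other vertex is within distance 2, so [ocy_near] in both directions
    applies. *)
Lemma chord5 x p : ocy a p -> size p = 5 -> x \in p -> m a x \notin p.
Proof.
move=> O /(ocy_reading O) sz /sz[s [O1 e]].
rewrite -e; case: s O1 {e} => [|x1 [|x2 [|x3 [|x4 [|]]]]] // O1 _.
have /andP[n1 n2] := ocy_near O1; have /andP[n3 n4] := ocy_near (ocy_mirror O1).
by rewrite !inE !negb_or n1 n2 n3 n4 (ocy_sees O1 (mem_head _ _)).
Qed.

Lemma size5_from p x : ocy a p -> size p = 5 -> x \in p -> exists x1 x2 x3 x4,
  ocy a [:: x; x1; x2; x3; x4] /\ [:: x; x1; x2; x3; x4] =i p.
Proof.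
move=> O /(ocy_reading O) sz /sz[s [O1 e]].
case: s O1 e => [|x1 [|x2 [|x3 [|x4 [|]]]]] // O1 e _.
by exists x1, x2, x3, x4.
Qed.

(** The new cycles have length at least 5 each and at most 10 together, so [P] is the 5-cycle [x0],
    [x1], [m a x1], [m a x4], [x4]. *)
Lemma tight5 x0 x1 x2 x3 x4 p2 : ocy a [:: x0; x1; x2; x3; x4] -> ocy b p2 ->
  m b (m a x0) \in p2 -> size p2 = 5 -> m g (m a x1) = m a x4.
Proof.
have [ab ag bg] := neqs; move=> O1 O2 sh sz; have [t O2' e2] := ocy_from O2 sh.
have u2 := ocy_uniq O2'; have sz2 : size (m b (m a x0) :: t) = 5.
  by rewrite -(card_uniqP u2) (eq_card e2) (card_uniqP (ocy_uniq O2)) sz.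
have [m' [P [Q [[h1 _ _] [e1 _ ec] [_ _ P5 Q5 PQ] [tt _] _]]]] := ocy_swap abg O1 O2' erefl.
have /tt : size P = 5.
  by move: PQ P5 Q5; rewrite sz2 /=; move: (size P) (size Q); clear=> *; lia.
case/and3P: h1 => /eqP -> _ _.
have x1p : x1 \in [:: x0; x1; x2; x3; x4] by rewrite !inE eqxx orbT.
rewrite /= !e1 ?inE ?eqxx ?orbT // ec //.
exact: (ocy_out O1 ag x1p (chord5 O1 erefl x1p)).
Qed.

(** Exchange at [x2]. By the tightness at [x0], the new cycle collects [x1], [m a x1], [m a x4],
    [x4], [x0] and [m a x0], so [p3] is the 5-cycle [p2]. Hence this exchange is tight as well, and
    the two equations give [x3 = x4]. *)
Lemma far5 x0 x1 x2 x3 x4 p2 p3 : ocy a [:: x0; x1; x2; x3; x4] -> ocy b p2 ->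
  size p2 = 5 -> m b (m a x0) \in p2 -> ocy b p3 -> m b (m a x2) \in p3 -> False.
Proof.
have [ab ag bg] := neqs; move=> O1 O2 sz sh O3 sh3.
have t0 := tight5 O1 O2 sh sz; have [m1 _ _] := om.1.
have O1' := ocy_rot1 (ocy_rot1 O1); rewrite /= in O1'.
have [t O3' e3] := ocy_from O3 sh3.
have [m' [P [Q [[h1 _ _] [e1 _ ec] [[x2P x1P _ gP aP] _ P5 Q5 PQ] [tt _] [cr _]]]]] :=
  ocy_swap abg O1' O3' erefl.
have nc q : q \in [:: x0; x1; x2; x3; x4] -> m a q \notin cover m.
  by move=> qp; apply: (ocy_out O1 ag qp); apply: chord5 O1 _ qp.
have u := ocy_uniq O1'; have [n12 n02] : x1 != x2 /\ x0 != x2.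
  by move: u; rewrite /= !inE !negb_or !(eq_sym x2) => /andP[/and4P[_ _ -> ->]].
have cv q : q \in [:: x0; x1; x2; x3; x4] -> q \in cover m by apply: ocy_cover O1.
have nx2 q : q \in [:: x0; x1; x2; x3; x4] -> m a q != x2.
  by move=> /nc; apply: contraNneq => ->; apply: cv; rewrite !inE eqxx ?orbT.
have w1P : m a x1 \in P.
  by rewrite -e1 ?inE ?eqxx ?orbT // aP.
have w4P : m a x4 \in P.
  by rewrite -t0 -ec ?gP //; apply: nc; rewrite !inE eqxx ?orbT.
have x4P : x4 \in P.
  rewrite -[x4](m1 a) -ec; last by apply: nc; rewrite !inE eqxx ?orbT.
  by apply: aP => //; apply: nx2; rewrite !inE eqxx ?orbT.
have [g4 n3] : m' g x4 = x0 /\ x3 != x2.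
  by case/and5P: h1 => _ n3 _ _ /and3P[/eqP-> _ _].
have x0P : x0 \in P by rewrite -g4 gP.
have w0P : m a x0 \in P by rewrite -e1 ?inE ?eqxx ?orbT // aP.
have e32 : p2 =i m b (m a x2) :: t.
  by apply: cr O2 w0P _; rewrite ec //; apply: nc; rewrite !inE eqxx ?orbT.
have sz3 : size (m b (m a x2) :: t) = 5.
  by rewrite -(card_uniqP (ocy_uniq O3')) -(eq_card e32) (card_uniqP (ocy_uniq O2)) sz.
have /tt : size P = 5.
  by move: PQ P5 Q5; rewrite sz3 /=; move: (size P) (size Q); clear=> *; lia.
case/and3P: h1 => /eqP -> _ _ /=.
rewrite !e1 ?inE ?eqxx ?orbT // ec; last by apply: nc; rewrite !inE eqxx ?orbT.
move=> e; have := congr1 (m g) e; rewrite m1 t0 => /(can_inj (m1 a)) e34.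
by move: u; rewrite e34 /= !inE eqxx ?orbT /= ?andbF.
Qed.
End TwoColours.

Lemma uniq3_swap a b c : uniq [:: a; b; c] -> uniq [:: b; a; c].
Proof. by rewrite !uniq3 (eq_sym b a) => /and3P[-> -> ->]. Qed.

(** By [share_next] both partners lie on [p2]. At distance 2 there, [far5] applies with the cycles
    interchanged. If they are adjacent, tightness on both sides makes [x4] share with [p2] too, and
    [x4] and [x1] are at distance 2. *)
Lemma near5 a b x0 x1 x2 x3 x4 p2 p3 : uniq [:: a; b; g] ->
  ocy a [:: x0; x1; x2; x3; x4] -> ocy b p2 -> size p2 = 5 -> m b (m a x0) \in p2 ->
  ocy b p3 -> m b (m a x1) \in p3 -> False.
Proof.
move=> abg O1 O2 sz sh O3 sh3; have bag := uniq3_swap abg; have [m1 _ _] := om.1.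
have sh1 : m b (m a x1) \in p2 by rewrite -(share_next abg O1 O2 O3 sh sh3).
have x0p : x0 \in [:: x0; x1; x2; x3; x4] by rewrite mem_head.
have x1p : x1 \in [:: x0; x1; x2; x3; x4] by rewrite !inE eqxx orbT.
have far y1 y2 y3 y4 : ocy b [:: m b (m a x0); y1; y2; y3; y4] -> m b (m a x1) = y2 -> False.
  move=> Oy e; apply: (far5 bag Oy O1 erefl _ O1); first by rewrite !m1.
  by rewrite -e !m1.
have near y1 y2 y3 y4 : ocy b [:: m b (m a x0); y1; y2; y3; y4] ->
    [:: m b (m a x0); y1; y2; y3; y4] =i p2 -> m b (m a x1) = y1 -> False.
  move=> Oy e ey; have tx := tight5 abg O1 O2 sh sz.
  have ty : m g (m b y1) = m b y4 by apply: (tight5 bag Oy O1); rewrite ?m1.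
  rewrite -ey m1 tx in ty.
  have s4 : m b (m a x4) \in p2 by rewrite ty m1 -e !inE eqxx !orbT.
  have O4 := ocy_rot1 (ocy_rot1 (ocy_rot1 (ocy_rot1 O1))); rewrite /= in O4.
  exact: (far5 abg O4 O2 sz s4 O2 sh1).
have [y1 [y2 [y3 [y4 [Oy e]]]]] := size5_from O2 sz sh.
have Oy' := ocy_mirror Oy; rewrite /rev /= in Oy'.
have e' : [:: m b (m a x0); y4; y3; y2; y1] =i p2.
  move=> q; rewrite -e !inE.
  by case: (q == y1); case: (q == y2); case: (q == y3); case: (q == y4); rewrite ?orbT ?orbF.
have ux := ocy_uniq O1; have n10 : m b (m a x1) != m b (m a x0).
  rewrite (inj_eq (can_inj (m1 b))) (inj_eq (can_inj (m1 a))) eq_sym.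
  by move: ux; rewrite /= inE negb_or => /andP[/andP[]].
move: sh1; rewrite -e !inE (negPf n10) /= => /or4P[]/eqP h.
- exact: near Oy e h.
- exact: far Oy h.
- exact: far Oy' h.
- exact: near Oy' e' h.
Qed.

Lemma five_unique a b p1 p2 p3 x x' : uniq [:: a; b; g] -> ocy a p1 -> ocy b p2 -> ocy b p3 ->
  size p1 = 5 -> size p2 = 5 -> x \in p1 -> m b (m a x) \in p2 ->
  x' \in p1 -> m b (m a x') \in p3 -> x' = x.
Proof.
move=> abg O1 O2 O3 z1 z2 xp sh x'p sh'; apply/eqP; apply: contraT => xx'.
have [x1 [x2 [x3 [x4 [Ox e]]]]] := size5_from O1 z1 xp.
have Ox' := ocy_mirror Ox; rewrite /rev /= in Ox'.
move: x'p sh'; rewrite -e !inE (negPf xx') /= => /or4P[]/eqP-> sh'.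
- by case: (near5 abg Ox O2 z2 sh O3 sh').
- by case: (far5 abg Ox O2 z2 sh O3 sh').
- by case: (far5 abg Ox' O2 z2 sh O3 sh').
- by case: (near5 abg Ox' O2 z2 sh O3 sh').
Qed.

(** What is known of one of the two new cycles after an exchange, in a form that serves both by
    symmetry. *)
Definition outcome a b (m' : 'I_3 -> V -> V) x s (P : seq V) : Prop :=
  [/\ (forall c, involutive (m' c)) /\ alt (m' g) (m' b) x s,
    (forall q, q \in x :: s -> m' a q = m a q) /\
    (forall c q, q \notin cover m -> m' c q = m c q),
    [/\ x \in P, last x s \in P, uniq P & 5 <= size P],
    forall q, q \in P -> m' g q \in P
  & forall q, q \in P -> q != x -> m' a q \in P].

Lemma ocy_swap2 a b x s y t : uniq [:: a; b; g] -> ocy a (x :: s) -> ocy b (y :: t) ->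
  m b (m a x) = y ->
  exists m' P Q,
  [/\ outcome a b m' x s P, outcome b a m' y t Q, size P + size Q <= size (x :: s) + size (y :: t),
    size Q = 5 -> m' g (m' b (m' g y)) = m' b (last y t)
  & forall p3 w, ocy b p3 -> w \in P -> m' b w \in p3 -> p3 =i y :: t].
Proof.
move=> abg O1 O2 sh.
have [m' [P [Q [[h1 h2 inv] [e1 e2 ec] [[a1 a2 a3 a4 a5] [b1 b2 b3 b4 b5] p5 q5 pq] [_ tt] [cr _]]]]] :=
  ocy_swap abg O1 O2 sh.
by exists m', P, Q; split.
Qed.

(** * Cycles of length 7 and poor cycles *)

Definition outs a p := count (fun x => m a x \notin p) p.

Lemma chord7 a x0 x1 x2 x3 x4 x5 x6 p : ocy a [:: x0; x1; x2; x3; x4; x5; x6] ->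
  [:: x0; x1; x2; x3; x4; x5; x6] =i p ->
  (m a x0 \in p) = (m a x0 == x3) || (m a x0 == x4).
Proof.
move=> O e; have /andP[/negPf n1 /negPf n2] := ocy_near O.
have := ocy_mirror O; rewrite /rev /= => O'; have /andP[/negPf n3 /negPf n4] := ocy_near O'.
have /negPf n0 := ocy_sees O (mem_head _ _).
by rewrite -e !inE n0 n1 n2 n3 n4 /= orbF.
Qed.

(** However the two chords lie, closure under [g] and [a] brings all seven vertices into [P]; the
    outer ends at the two leaving vertices other than [x0] make it 9. *)
Lemma seven_three a b m' x0 x1 x2 x3 x4 x5 x6 P (p := [:: x0; x1; x2; x3; x4; x5; x6]) :
  ocy a p -> outs a p = 3 -> m a x0 \notin p ->
  outcome a b m' x0 [:: x1; x2; x3; x4; x5; x6] P -> 9 <= size P.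
Proof.
move=> O o3 n0 [[inv h] [e1 ec] [x0P x6P uP _] gP aP].
have u := ocy_uniq O; have [m1 _ _] := om.1.
have g01 : m' g x0 = x1 by case/and3P: h => /eqP.
have g23 : m' g x2 = x3 by case/and5P: h => _ _ _ _ /and3P[/eqP].
have g45 : m' g x4 = x5 by case/and5P: h => _ _ _ _ /and5P[_ _ _ _ /and3P[/eqP]].
have g32 : m' g x3 = x2 by rewrite -g23 inv.
have g54 : m' g x5 = x4 by rewrite -g45 inv.
(* Chords join vertices at distance 3 and avoid [x0], so these five are the only candidates. *)
pose c14 := m a x1 == x4; pose c15 := m a x1 == x5; pose c25 := m a x2 == x5.
pose c26 := m a x2 == x6; pose c36 := m a x3 == x6.
have sw x y : (m a x == y) = (m a y == x) by apply/eqP/eqP => <-; rewrite m1.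
have O1 := ocy_rot1 O; have O2 := ocy_rot1 O1; have O3 := ocy_rot1 O2.
have O4 := ocy_rot1 O3; have O5 := ocy_rot1 O4; have O6 := ocy_rot1 O5.
rewrite /= in O1 O2 O3 O4 O5 O6.
have f0 x : x \in p -> (m a x == x0) = false.
  by move=> xp; apply/eqP => h1; rewrite -h1 m1 xp in n0.
have k1 : (m a x1 \in p) = c14 || c15 by rewrite (chord7 O1 (mem_rot 1 p)).
have k2 : (m a x2 \in p) = c25 || c26 by rewrite (chord7 O2 (mem_rot 2 p)).
have k3 : (m a x3 \in p) = c36.
  by rewrite (chord7 O3 (mem_rot 3 p)) (f0 x3) ?orbF // !inE eqxx ?orbT.
have k4 : (m a x4 \in p) = c14.
  by rewrite (chord7 O4 (mem_rot 4 p)) (f0 x4) /= 1?sw // !inE eqxx ?orbT.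
have k5 : (m a x5 \in p) = c15 || c25.
  by rewrite (chord7 O5 (mem_rot 5 p)) (sw x5) (sw x5 x2).
have k6 : (m a x6 \in p) = c26 || c36.
  by rewrite (chord7 O6 (mem_rot 6 p)) (sw x6) (sw x6 x3).
move: o3; rewrite /outs /= -/p n0 k1 k2 k3 k4 k5 k6 => o3.
have A q : q \in P -> q \in p -> q != x0 -> m a q \in P.
  by move=> qP qp q0; rewrite -e1 // aP.
have x1P : x1 \in P by rewrite -g01 gP.
have nx q : q \in [:: x1; x2; x3; x4; x5; x6] -> q != x0.
  by move=> qq; case/andP: u => u0 _; apply: contraNneq u0 => <-.
have nij i j : i < 7 -> j < 7 -> i != j -> nth x0 p i != nth x0 p j.
  by move=> hi hj ij; rewrite nth_uniq.
(* Four of the ten pairs of candidates have a common end. *)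
have key : [|| [&& c14, ~~ c15, c25, ~~ c26 & ~~ c36], [&& c14, ~~ c15, c36, ~~ c26 & ~~ c25],
  [&& c14, ~~ c15, c26, ~~ c25 & ~~ c36], [&& c25, ~~ c14, c36, ~~ c26 & ~~ c15],
  [&& c15, ~~ c14, c36, ~~ c26 & ~~ c25] | [&& c15, ~~ c14, c26, ~~ c25 & ~~ c36]].
  have n45 : x4 != x5 := nij 4 5 isT isT isT.
  have n56 : x5 != x6 := nij 5 6 isT isT isT.
  have n12 : x1 != x2 := nij 1 2 isT isT isT.
  have n23 : x2 != x3 := nij 2 3 isT isT isT.
  have i1 : ~~ (c14 && c15) by apply: contra n45 => /andP[/eqP<- /eqP<-].
  have i2 : ~~ (c25 && c26) by apply: contra n56 => /andP[/eqP<- /eqP<-].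
  have i3 : ~~ (c15 && c25).
    by apply: contra n12; rewrite /c15 /c25 sw (sw x2) => /andP[/eqP<- /eqP<-].
  have i4 : ~~ (c26 && c36).
    by apply: contra n23; rewrite /c26 /c36 sw (sw x3) => /andP[/eqP<- /eqP<-].
  clear k1 k2 k3 k4 k5 k6; move: o3 i1 i2 i3 i4.
  by case: c14; case: c15; case: c25; case: c26; case: c36.
have fin i j : 0 < i < 7 -> 0 < j < 7 -> i != j -> m a (nth x0 p i) \notin p ->
    m a (nth x0 p j) \notin p -> x2 \in P -> x3 \in P -> x4 \in P -> x5 \in P -> 9 <= size P.
  move=> hi hj ij ni nj h2 h3 h4 h5; have pP : {subset p <= P}.
    by apply/allP; rewrite /= x0P x1P h2 h3 h4 h5 x6P.
  have out k : 0 < k < 7 -> m a (nth x0 p k) \in P.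
    by move=> /andP[k0 k7]; apply: A; rewrite ?pP ?mem_nth // (nij k 0) // -lt0n.
  have [[_ i7] [_ j7]] := (andP hi, andP hj).
  rewrite -[9]/(size [:: m a (nth x0 p i), m a (nth x0 p j) & p]); apply: uniq_leq_size.
    by rewrite /= in_cons negb_or (inj_eq (can_inj (m1 a))) nij // ni nj.
  by move=> q; rewrite !in_cons => /or3P[/eqP->|/eqP->|/pP //]; apply: out.
have px : [/\ x1 \in p, x2 \in p, x3 \in p, x4 \in p & x5 \in p] /\ x6 \in p.
  by split; rewrite ?inE ?eqxx ?orbT //; split; rewrite !inE eqxx ?orbT.
have [[p1 p2 p3 p4 p5] p6] := px.
have [q1 q2 q3 q4 q5] : [/\ x1 != x0, x2 != x0, x3 != x0, x4 != x0 & x5 != x0].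
  by split; rewrite nx // !inE eqxx ?orbT.
have q6 : x6 != x0 by rewrite nx // !inE eqxx ?orbT.
have A1 := A _ x1P p1 q1.
case/or4P: key => [||| /or3P[]] /and5P[/eqP ea /negPf na /eqP eb /negPf nb /negPf nc];
  rewrite ?na ?nb ?nc /= in k1 k2 k3 k4 k5 k6.
- have x4P : x4 \in P by rewrite -ea.
  have x5P : x5 \in P by rewrite -g45 gP.
  have x2P : x2 \in P by rewrite -(m1 a x2) eb A.
  have x3P : x3 \in P by rewrite -g23 gP.
  exact: (fin 3 6 isT isT isT (negbT k3) (negbT k6)).
- have x4P : x4 \in P by rewrite -ea.
  have x5P : x5 \in P by rewrite -g45 gP.
  have x3P : x3 \in P by rewrite -(m1 a x3) eb A.
  have x2P : x2 \in P by rewrite -g32 gP.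
  exact: (fin 2 5 isT isT isT (negbT k2) (negbT k5)).
- have x4P : x4 \in P by rewrite -ea.
  have x5P : x5 \in P by rewrite -g45 gP.
  have x2P : x2 \in P by rewrite -(m1 a x2) eb A.
  have x3P : x3 \in P by rewrite -g23 gP.
  exact: (fin 3 5 isT isT isT (negbT k3) (negbT k5)).
- have x3P : x3 \in P by rewrite -(m1 a x3) eb A.
  have x2P : x2 \in P by rewrite -g32 gP.
  have x5P : x5 \in P by rewrite -ea A.
  have x4P : x4 \in P by rewrite -g54 gP.
  exact: (fin 1 4 isT isT isT (negbT k1) (negbT k4)).
- have x5P : x5 \in P by rewrite -ea.
  have x4P : x4 \in P by rewrite -g54 gP.
  have x3P : x3 \in P by rewrite -(m1 a x3) eb A.
  have x2P : x2 \in P by rewrite -g32 gP.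
  exact: (fin 2 4 isT isT isT (negbT k2) (negbT k4)).
have x5P : x5 \in P by rewrite -ea.
have x4P : x4 \in P by rewrite -g54 gP.
have x2P : x2 \in P by rewrite -(m1 a x2) eb A.
have x3P : x3 \in P by rewrite -g23 gP.
exact: (fin 3 4 isT isT isT (negbT k3) (negbT k4)).
Qed.

Lemma size7_from a p x : ocy a p -> size p = 7 -> x \in p -> exists x1 x2 x3 x4 x5 x6,
  ocy a [:: x; x1; x2; x3; x4; x5; x6] /\ [:: x; x1; x2; x3; x4; x5; x6] =i p.
Proof.
move=> O /(ocy_reading O) sz /sz[s [O1 e]].
case: s O1 e => [|x1 [|x2 [|x3 [|x4 [|x5 [|x6 [|]]]]]]] // O1 e _.
by exists x1, x2, x3, x4, x5, x6.
Qed.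

Lemma outs_eqi a p p' : uniq p -> uniq p' -> p =i p' -> outs a p = outs a p'.
Proof.
move=> u u' e; rewrite /outs -!size_filter.
apply: perm_size; apply: uniq_perm; rewrite ?filter_uniq // => x.
by rewrite !mem_filter !e.
Qed.

Lemma shared_out a b p p' x : ocy a p -> ocy b p' -> a != b -> x \in p ->
  m b (m a x) \in p' -> m a x \notin p.
Proof.
move=> O O' ab xp yp; apply: contra (share_nocover O O' ab xp yp); exact: ocy_cover O.
Qed.

Lemma seven_three_swap a b p x m' s P : ocy a (x :: s) -> x :: s =i p -> size p = 7 -> uniq p ->
  outs a p = 3 -> m a x \notin p -> outcome a b m' x s P -> 9 <= size P.
Proof.
move=> O e sz u o3 n0 h; have u' := ocy_uniq O.
have sz1 : size s = 6.
  by apply/eqP; rewrite -eqSS -/(size (x :: s)) -(card_uniqP u') (eq_card e) (card_uniqP u) sz.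
rewrite -(outs_eqi a u' u e) in o3; rewrite -e in n0.
case: s O {e u'} o3 n0 h sz1 => [|x1 [|x2 [|x3 [|x4 [|x5 [|x6 [|]]]]]]] // O o3 n0 h _.
exact: seven_three O o3 n0 h.
Qed.

(** The number of leaving edges is odd and at least 3, so these are the cycles for which
    [2 * (size p - 5) + 2 * outs a p] is 10, one more than the 9 asked of each cycle in the count;
    for all others it is at least 14. *)
Definition poor a p := (size p == 5) || (size p == 7) && (outs a p == 3).

(** A poor 7-cycle would grow to at least 9 in the exchange, against at least 5 for the other cycle,
    or 9 if that is a poor 7-cycle too; the old total 12 or 14 is exceeded. *)
Lemma poor_share a b p p' x : uniq [:: a; b; g] -> ocy a p -> ocy b p' -> poor a p -> poor b p' ->
  x \in p -> m b (m a x) \in p' -> size p = 5 /\ size p' = 5.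
Proof.
move=> abg O O' pr pr' xp yp; have [ab ag bg] : [/\ a != b, a != g & b != g].
  by move: abg; rewrite uniq3 => /and3P.
have [m1 _ _] := om.1.
have [s Os es] := ocy_from O xp; have [t Ot et] := ocy_from O' yp.
have [m' [P [Q [h1 h2 sz _ _]]]] := ocy_swap2 abg Os Ot erefl.
have u := ocy_uniq O; have u' := ocy_uniq O'.
have zs : size (x :: s) = size p by rewrite -(card_uniqP u) -(eq_card es) (card_uniqP (ocy_uniq Os)).
have zt : size (m b (m a x) :: t) = size p'.
  by rewrite -(card_uniqP u') -(eq_card et) (card_uniqP (ocy_uniq Ot)).
have n0 := shared_out O O' ab xp yp.
have n0' : m a (m b (m b (m a x))) \in p by rewrite !m1.
have ba : b != a by rewrite eq_sym.
have n1 := shared_out O' O ba yp n0'.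
have P5 : 5 <= size P by case: h1 => _ _ [].
have Q5 : 5 <= size Q by case: h2 => _ _ [].
have hP : size p = 7 -> outs a p = 3 -> 9 <= size P.
  by move=> z o; apply: seven_three_swap Os es z u o n0 h1.
have hQ : size p' = 7 -> outs b p' = 3 -> 9 <= size Q.
  by move=> z o; apply: seven_three_swap Ot et z u' o n1 h2.
rewrite zs zt in sz.
case/orP: pr => [/eqP z|/andP[/eqP z /eqP o]]; case/orP: pr' => [/eqP z'|/andP[/eqP z' /eqP o']].
- by [].
- by have := hQ z' o'; move: sz P5; rewrite z z'; move: (size P) (size Q); clear=> *; lia.
- by have := hP z o; move: sz Q5; rewrite z z'; move: (size P) (size Q); clear=> *; lia.
- by have := hQ z' o'; have := hP z o; move: sz; rewrite z z'; move: (size P) (size Q); clear=> *; lia.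
Qed.

Definition shared a b x : bool := `[< exists2 p, ocy b p & m b (m a x) \in p >].

Lemma sharedI a b x p : ocy b p -> m b (m a x) \in p -> shared a b x.
Proof. by move=> O h; apply/asboolP; exists p. Qed.

Lemma tight_far b z0 z1 z2 z3 z4 : ocy b [:: z0; z1; z2; z3; z4] ->
  m g (m b z1) = m b z4 -> m g (m b z3) = m b z1 -> False.
Proof.
move=> O h1 h2; have [m1 _ _] := om.1.
have := congr1 (m g) h2; rewrite m1 h1 => /(can_inj (m1 b)) e.
by have := ocy_uniq O; rewrite e /= !inE eqxx ?orbT ?andbF.
Qed.

(** Among three vertices of a 5-cycle two are at distance 2, and [tight_far] forbids tightness at
    both. *)
Lemma tight_three b p (S : seq V) : ocy b p -> size p = 5 -> uniq S -> 3 <= size S ->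
  {subset S <= p} ->
  (forall z0 z1 z2 z3 z4, z0 \in S -> ocy b [:: z0; z1; z2; z3; z4] ->
     m g (m b z1) = m b z4) -> False.
Proof.
move=> O sz; case: S => [|z0 [|u [|v S]]] //= /and3P[]; rewrite !inE !negb_or.
move=> /and3P[uz vz _] /andP[uv _] _ _ sub tt.
have in0 : z0 \in [:: z0, u, v & S] by rewrite inE eqxx.
have inu : u \in [:: z0, u, v & S] by rewrite !inE eqxx orbT.
have inv : v \in [:: z0, u, v & S] by rewrite !inE eqxx !orbT.
have [z1 [z2 [z3 [z4 [O1 e]]]]] := size5_from O sz (sub _ in0).
have far z0' z1' z2' z3' z4' : ocy b [:: z0'; z1'; z2'; z3'; z4'] ->
    z0' \in [:: z0, u, v & S] -> z2' \in [:: z0, u, v & S] -> False.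
  move=> O' h0 h2; apply: (tight_far O' (tt _ _ _ _ _ h0 O')).
  by have O2 := ocy_rot1 (ocy_rot1 O'); rewrite /= in O2; apply: (tt _ _ _ _ _ h2 O2).
have O1' := ocy_mirror O1; rewrite /rev /= in O1'.
have O4 := ocy_rot1 (ocy_rot1 (ocy_rot1 (ocy_rot1 O1))); rewrite /= in O4.
have n14 w : w \in [:: z0, u, v & S] -> z0 != w -> w = z1 \/ w = z4.
  move=> ws zw; have := sub _ ws; rewrite -e !inE eq_sym (negPf zw) /=.
  case/or4P=> /eqP ew; [by left | | | by right].
    by case: (far _ _ _ _ _ O1 in0); rewrite -ew.
  by case: (far _ _ _ _ _ O1' in0); rewrite -ew.
have [eu|eu] := n14 _ inu uz; have [ev|ev] := n14 _ inv vz.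
- by rewrite eu ev eqxx in uv.
- by apply: (far _ _ _ _ _ O4); [rewrite -ev | rewrite -eu].
- by apply: (far _ _ _ _ _ O4); [rewrite -eu | rewrite -ev].
- by rewrite eu ev eqxx in uv.
Qed.

Section Seven.
Variables (a b : 'I_3).
Hypothesis abg : uniq [:: a; b; g].
Let neqs : [/\ a != b, a != g & b != g].
Proof. exact: uniq3_neq. Qed.

(** As the 7-cycle does not shrink, neither can its partner grow. A partner of length 5 is therefore
    tight, and a poor 7-cycle, which would grow to 9, is no partner. *)
Lemma seven_grow x s u v p2 : ocy a (x :: s) -> size (x :: s) = 7 -> ocy b p2 ->
  m b (m a x) \in p2 -> m a u \notin cover m -> m a v \notin cover m ->
  (forall m' P, outcome a b m' x s P -> [/\ 7 <= size P, m a u \in P & m a v \in P]) ->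
  [/\ forall p3, ocy b p3 -> m b (m a u) \in p3 -> p3 =i p2,
      forall p3, ocy b p3 -> m b (m a v) \in p3 -> p3 =i p2,
      forall z1 z2 z3 z4, ocy b [:: m b (m a x); z1; z2; z3; z4] -> m g (m b z1) = m b z4
    & poor b p2 -> size p2 = 5].
Proof.
have [ab ag bg] := neqs; have [m1 _ _] := om.1.
move=> O sz O2 sh uc vc hP; have [t Ot et] := ocy_from O2 sh.
have xp : x \in x :: s by rewrite mem_head.
split.
- move=> p3 O3 h3; have [m' [P [Q [h1 h2 _ _ cr]]]] := ocy_swap2 abg O Ot erefl.
  have [_ uP _] := hP _ _ h1; move=> q; rewrite -et; apply: cr O3 uP _ q.
  by case: h1 => _ [_ ec] _ _ _; rewrite ec.
- move=> p3 O3 h3; have [m' [P [Q [h1 h2 _ _ cr]]]] := ocy_swap2 abg O Ot erefl.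
  have [_ _ vP] := hP _ _ h1; move=> q; rewrite -et; apply: cr O3 vP _ q.
  by case: h1 => _ [_ ec] _ _ _; rewrite ec.
- move=> z1 z2 z3 z4 Oz; have [m' [P [Q [h1 h2 PQ tt cr]]]] := ocy_swap2 abg O Oz erefl.
  have [P7 _ _] := hP _ _ h1.
  case: h2 => [[_ hz] [eb ec] [_ _ _ Q5] _ _].
  have /tt : size Q = 5.
    by move: PQ P7 Q5; rewrite sz /=; move: (size P) (size Q); clear=> *; lia.
  case/and3P: hz => /eqP -> _ _ /=.
  have z1p : z1 \in [:: m b (m a x); z1; z2; z3; z4] by rewrite !inE eqxx orbT.
  rewrite !eb ?inE ?eqxx ?orbT // ec //.
  exact: (ocy_out Oz bg z1p (chord5 Oz erefl z1p)).
case/orP => [/eqP //|/andP[/eqP z7 /eqP o3]].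
have [m' [P [Q [h1 h2 PQ _ _]]]] := ocy_swap2 abg O Ot erefl.
have [P7 _ _] := hP _ _ h1.
have ba : b != a by rewrite eq_sym.
have n1 : m b (m b (m a x)) \notin p2.
  by apply: (shared_out O2 O ba sh); rewrite !m1.
have := seven_three_swap Ot et z7 (ocy_uniq O2) o3 n1 h2.
have zt : size (m b (m a x) :: t) = 7.
  by rewrite -(card_uniqP (ocy_uniq Ot)) (eq_card et) (card_uniqP (ocy_uniq O2)).
by move: PQ P7; rewrite sz zt; move: (size P) (size Q); clear=> *; lia.
Qed.

(** The far end [y6] is in [P], its chord leads to [w] and colour [g] to [v]. With [y0], [y1] and
    the outer ends at [y1] and [v] these are seven vertices. *)
Lemma seven_in m' y0 y1 y2 y3 y4 y5 y6 w v P (p := [:: y0; y1; y2; y3; y4; y5; y6]) : ocy a p ->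
  [:: w; v] = [:: y3; y2] \/ [:: w; v] = [:: y2; y3] -> m a w = y6 ->
  m a y1 \notin p -> m a v \notin p -> outcome a b m' y0 [:: y1; y2; y3; y4; y5; y6] P ->
  [/\ 7 <= size P, m a y1 \in P & m a v \in P].
Proof.
move=> O cv c6 n1 nv [[inv h] [e1 ec] [x0P x6P uP _] gP aP].
have u := ocy_uniq O; have [m1 _ _] := om.1.
have g01 : m' g y0 = y1 by case/and3P: h => /eqP.
have gcv : m' g w = v.
  by case/and5P: h => _ _ _ _ /and3P[/eqP e _ _]; case: cv => -[-> ->]; rewrite -e ?inv.
have A q : q \in p -> q \in P -> q != y0 -> m a q \in P.
  by move=> qp qP q0; rewrite -e1 // aP.
have nij i j : i < 7 -> j < 7 -> i != j -> nth y0 p i != nth y0 p j.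
  by move=> hi hj ij; rewrite nth_uniq.
have s6 : {subset [:: y0; y1; w; v; y6] <= p} /\ uniq [:: y0; y1; w; v; y6].
  have u5 : uniq [:: y0; y1; y2; y3; y6].
    exact: (mask_uniq u [:: true; true; true; true; false; false; true]).
  have e : perm_eq [:: y0; y1; w; v; y6] [:: y0; y1; y2; y3; y6].
    case: cv => -[-> ->]; last exact: perm_refl.
    by rewrite !perm_cons; apply/permPl/(perm_catCA [:: y3] [:: y2] [:: y6]).
  rewrite (perm_uniq e); split=> // q; rewrite (perm_mem e).
  exact: (@mem_mask _ q [:: true; true; true; true; false; false; true] p).
have [sub u5] := s6; move: (u5); rewrite /= !inE !negb_or => /and5P[/and4P[n01 n0c n0v n06] /and3P[n1c n1v n16] _ _ _].
have y1P : y1 \in P by rewrite -g01 gP.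
have w1P : m a y1 \in P by apply: A; rewrite 1?eq_sym // sub // !inE eqxx ?orbT.
have wP : w \in P.
  by rewrite -[w](m1 a) c6; apply: A; rewrite 1?eq_sym // sub // !inE eqxx ?orbT.
have vP : v \in P by rewrite -gcv gP.
have wvP : m a v \in P by apply: A; rewrite 1?eq_sym // sub // !inE eqxx ?orbT.
split=> //; rewrite -[7]/(size [:: m a y1, m a v & [:: y0; y1; w; v; y6]]); apply: uniq_leq_size.
  rewrite 2!cons_uniq in_cons negb_or (inj_eq (can_inj (m1 a))) n1v u5 andbT.
  by apply/andP; split; [apply: contra n1|apply: contra nv]; apply: sub.
by apply/allP; rewrite /= w1P wvP x0P y1P wP vP x6P.
Qed.

Lemma shared_subout x p : ocy a p -> x \in p -> shared a b x -> m a x \notin p.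
Proof.
have [ab _ _] := neqs.
by move=> O xp /asboolP[p' O' h]; apply: (shared_out O O' ab xp h).
Qed.

Lemma count_partner p p2 : ocy a p -> ocy b p2 ->
  count (fun x => m b (m a x) \in p2) p <= outs b p2.
Proof.
have [ab _ _] := neqs; move=> O O2; have [m1 _ _] := om.1; have ba : b != a by rewrite eq_sym.
pose f x := m b (m a x); have fi : injective f.
  by move=> x y; rewrite /f => /(can_inj (m1 b))/(can_inj (m1 a)).
rewrite /outs -!size_filter -(size_map f); apply: uniq_leq_size.
  by rewrite (map_inj_uniq fi) filter_uniq // (ocy_uniq O).
move=> y /mapP[x]; rewrite mem_filter => /andP[h xp] ->; rewrite mem_filter h andbT.
by apply: (shared_out O2 O ba h); rewrite !m1.
Qed.

Lemma poor_outs p : poor b p -> outs b p <= 5.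
Proof.
case/orP => [/eqP z|/andP[_ /eqP ->//]]; rewrite -[5]z.
exact: count_size.
Qed.

(** Suppose at most one leaving edge is unshared. Without a chord, [share_next] spreads sharing with
    [p2] to six vertices, but [p2] has at most five leaving edges. With one chord, exchanges next to
    its ends produce three tight vertices on a 5-cycle. *)
Lemma seven_slack p p2 x : ocy a p -> size p = 7 -> 5 <= outs a p -> x \in p ->
  ocy b p2 -> m b (m a x) \in p2 -> poor b p2 -> (count (shared a b) p).+2 <= outs a p.
Proof.
have [ab ag bg] := neqs; move=> O sz o5 xp O2 sh pr; rewrite leqNgt; apply/negP => few.
have [m1 _ _] := om.1; pose t q := m b (m a q) \in p2.
have ts q : t q -> shared a b q by move=> h; apply: sharedI O2 h.
have partner q p3 : ocy b p3 -> m b (m a q) \in p3 -> p3 =i p2 -> t q.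
  by move=> _ h e; rewrite /t -e.
pose link q q' := forall p3 p4, ocy b p3 -> ocy b p4 -> m b (m a q) \in p3 ->
  m b (m a q') \in p4 -> p4 =i p3.
have link_next q q' s : ocy a [:: q, q' & s] -> link q q'.
  by move=> Oq p3 p4 O3 O4 h3 h4; apply: (share_next abg Oq O3 O4 h3 h4).
have link_eq q q' : link q q' -> shared a b q && shared a b q' ==> (t q == t q').
  move=> lk; apply/implyP => /andP[/asboolP[p3 O3 h3] /asboolP[p4 O4 h4]].
  apply/eqP; apply/idP/idP => h.
    by apply: (partner _ _ O4 h4); apply: lk O2 O4 h h4.
  by apply: (partner _ _ O3 h3) => w; rewrite (lk _ _ O3 O2 h3 h).
have nx q q' s : ocy a [:: q, q' & s] -> t q && shared a b q' ==> t q'.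
  move=> Oq; apply/implyP => /andP[tq sq]; have := link_eq _ _ (link_next _ _ _ Oq).
  by rewrite (ts _ tq) sq tq /= => /eqP<-.
have u := ocy_uniq O.
have cc P p' : ocy a p' -> p' =i p -> count P p' = count P p.
  move=> O' e; rewrite -!size_filter; apply/perm_size/uniq_perm; rewrite ?filter_uniq //.
    exact: ocy_uniq O'.
  by move=> q; rewrite !mem_filter e.
have [oe|on] := eqVneq (outs a p) 7.
  have [x1 [x2 [x3 [x4 [x5 [x6 [Ox ex]]]]]]] := size7_from O sz xp.
  have tx : t x by [].
  have O1 := ocy_rot1 Ox; have Oa := ocy_rot1 O1; have Ob := ocy_rot1 Oa.
  have Oc := ocy_rot1 Ob; have Od := ocy_rot1 Oc; have Oe := ocy_rot1 Od.
  rewrite /= in O1 Oa Ob Oc Od Oe.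
  have M := ocy_mirror Ox; have M2 := ocy_mirror Oa.
  have M3 := ocy_mirror Ob; have M4 := ocy_mirror Oc; have M5 := ocy_mirror Od.
  have M6 := ocy_mirror Oe; rewrite /rev /= in M M2 M3 M4 M5 M6.
  have h1 : 5 <= shared a b x1 + (shared a b x2 + (shared a b x3 + (shared a b x4 +
     (shared a b x5 + shared a b x6)))).
    by move: few; rewrite oe -(cc _ _ Ox ex) /= (ts _ tx) addn0 !ltnS.
  have := cyclic_chain h1 (t1 := t x1) (t2 := t x2) (t3 := t x3) (t4 := t x4) (t5 := t x5) (t6 := t x6).
  have n1 := nx _ _ _ Ox; have n6 := nx _ _ _ M; rewrite tx /= in n1 n6.
  rewrite n1 n6 (nx _ _ _ O1) (nx _ _ _ Oa) (nx _ _ _ Ob) (nx _ _ _ Oc).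
  rewrite (nx _ _ _ M2) (nx _ _ _ M3) (nx _ _ _ M4) (nx _ _ _ M5) (nx _ _ _ M6) => /(_ isT) h2.
  have := leq_trans (count_partner O O2) (poor_outs pr).
  rewrite -(cc _ _ Ox ex) /= -/(t x) tx /= -/(t x1) -/(t x2) -/(t x3) -/(t x4) -/(t x5) -/(t x6).
  by rewrite addn0 ltnNge h2.
have [c cp cc'] : exists2 c, c \in p & m a c \in p.
  have : has (fun q => m a q \in p) p.
    rewrite -[has _ _]negbK -all_predC; apply: contra on; rewrite all_count => h.
    by rewrite /outs -[count _ p]/(count (predC (fun q => m a q \in p)) p) (eqP h) sz.
  by move=> /hasP[c cp h]; exists c.
have [x0 [x1 [x2 [x3 [x4 [x5 [x6 [Ox ex c03]]]]]]]] : exists x0 x1 x2 x3 x4 x5 x6,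
    [/\ ocy a [:: x0; x1; x2; x3; x4; x5; x6], [:: x0; x1; x2; x3; x4; x5; x6] =i p
      & m a x0 = x3].
  have [x1 [x2 [x3 [x4 [x5 [x6 [Ox ex]]]]]]] := size7_from O sz cp.
  move: cc'; rewrite (chord7 Ox ex) => /orP[]/eqP e.
    by exists c, x1, x2, x3, x4, x5, x6.
  exists c, x6, x5, x4, x3, x2, x1; split=> //; first exact: ocy_mirror Ox.
  move=> q; rewrite -ex -[RHS]mem_rev (_ : rev _ = [:: x6; x5; x4; x3; x2; x1; c]) //.
  by rewrite -(mem_rot 1 [:: c; _; _; _; _; _; _]).
have in_p q : q \in [:: x0; x1; x2; x3; x4; x5; x6] -> q \in p by rewrite ex.
have c30 : m a x3 = x0 by rewrite -c03 m1.
have no0 : (m a x0 \notin p) = false by rewrite c03 in_p ?inE ?eqxx ?orbT.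
have no3 : (m a x3 \notin p) = false by rewrite c30 in_p ?inE ?eqxx ?orbT.
have oE : outs a p = outs a [:: x0; x1; x2; x3; x4; x5; x6].
  by apply: outs_eqi; rewrite ?(ocy_uniq Ox) // => q; rewrite ex.
have cE : outs a [:: x0; x1; x2; x3; x4; x5; x6] =
   count (fun q => m a q \notin p) [:: x0; x1; x2; x3; x4; x5; x6].
  by apply: eq_count => q; rewrite /= ex.
have [[n1 n2 n4] [n5 n6] o5'] : [/\ [/\ m a x1 \notin p, m a x2 \notin p & m a x4 \notin p],
    m a x5 \notin p /\ m a x6 \notin p & outs a p = 5].
  move: o5; rewrite oE cE /= no0 no3.
  by case: (m a x1 \in p); case: (m a x2 \in p); case: (m a x4 \in p);
    case: (m a x5 \in p); case: (m a x6 \in p).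
have s0 : shared a b x0 = false.
  by apply: contraFF no0 => h; apply: (shared_subout O _ h); apply: in_p; rewrite !inE eqxx.
have s3 : shared a b x3 = false.
  by apply: contraFF no3 => h; apply: (shared_subout O _ h); apply: in_p; rewrite !inE eqxx ?orbT.
have few' : 4 <= shared a b x1 + (shared a b x2 + (shared a b x4 + (shared a b x5 + shared a b x6))).
  by move: few; rewrite o5' -(cc _ _ Ox ex) /= s0 s3 !ltnS addn0 add0n.
have O1 := ocy_rot1 Ox; have O2' := ocy_rot1 O1; have O3' := ocy_rot1 O2'.
have O4 := ocy_rot1 O3'; have O5 := ocy_rot1 O4; have O6 := ocy_rot1 O5.
rewrite /= in O1 O2' O3' O4 O5 O6.
have M6 := ocy_mirror O6; have M2 := ocy_mirror O2'; rewrite /rev /= in M6 M2.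
have oc q : q \in p -> m a q \notin p -> m a q \notin cover m by move=> *; apply: ocy_out O _ _ _.
have [k1 k2 k4 k5 k6] : [/\ m a x1 \notin cover m, m a x2 \notin cover m, m a x4 \notin cover m,
    m a x5 \notin cover m & m a x6 \notin cover m].
  by split; apply: oc => //; apply: in_p; rewrite !inE eqxx ?orbT.
have nin y0 y1 y2 y3 y4 y5 y6 q : ocy a [:: y0; y1; y2; y3; y4; y5; y6] ->
    m a q \notin cover m -> m a q \notin [:: y0; y1; y2; y3; y4; y5; y6].
  by move=> Oy; apply: contra; apply: ocy_cover Oy.
pose grow q u v := forall p3, ocy b p3 -> m b (m a q) \in p3 ->
  [/\ forall p4, ocy b p4 -> m b (m a u) \in p4 -> p4 =i p3,
      forall p4, ocy b p4 -> m b (m a v) \in p4 -> p4 =i p3,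
      forall z1 z2 z3 z4, ocy b [:: m b (m a q); z1; z2; z3; z4] -> m g (m b z1) = m b z4
    & poor b p3 -> size p3 = 5].
have growth y0 y1 y2 y3 y4 y5 y6 w v : ocy a [:: y0; y1; y2; y3; y4; y5; y6] ->
    [:: w; v] = [:: y3; y2] \/ [:: w; v] = [:: y2; y3] -> m a w = y6 ->
    m a y1 \notin cover m -> m a v \notin cover m -> grow y0 y1 v.
  move=> Oy cv c6 h1 h2 p3 Op3 h; apply: (seven_grow Oy erefl Op3 h h1 h2) => m' P.
  by apply: (seven_in Oy cv c6); apply: (nin _ _ _ _ _ _ _ _ Oy).
(* The symmetries of the cycle with chord [x0 x3] give an exchange of size at least 7 at each of the
   four neighbours of its ends. *)
have G4 := growth _ _ _ _ _ _ _ _ _ O4 (or_introl erefl) c03 k5 k6.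
have G6 := growth _ _ _ _ _ _ _ _ _ M6 (or_introl erefl) c30 k5 k4.
have G1 := growth _ _ _ _ _ _ _ _ _ O1 (or_intror erefl) c30 k2 k4.
have G2 := growth _ _ _ _ _ _ _ _ _ M2 (or_intror erefl) c03 k1 k6.
have linkv q u1 v : grow q u1 v -> link q v.
  by move=> G p3 p4 Op3 Op4 h3 h4; have [_ h _ _] := G _ Op3 h3; apply: h.
have tsome : [|| t x1, t x2, t x4, t x5 | t x6].
  have /[!inE] : x \in [:: x0; x1; x2; x3; x4; x5; x6] by rewrite ex.
  have tx : t x by [].
  case/or4P => [/eqP e|/eqP<-|/eqP<-|]; rewrite ?tx ?orbT //.
    by move: tx; rewrite e => /ts; rewrite s0.
  case/or4P => [/eqP e|/eqP<-|/eqP<-|/eqP<-]; rewrite ?tx ?orbT //.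
  by move: tx; rewrite e => /ts; rewrite s3.
have three : 3 <= t x1 + (t x2 + (t x4 + t x6)).
  apply: (chord_chain few' (t5 := t x5)); first by rewrite -!orbA.
    rewrite (link_eq _ _ (link_next _ _ _ O1)) (link_eq _ _ (link_next _ _ _ O4)).
    rewrite (link_eq _ _ (link_next _ _ _ O5)) (link_eq _ _ (linkv _ _ _ G4)).
    by rewrite (link_eq _ _ (linkv _ _ _ G1)) (link_eq _ _ (linkv _ _ _ G2)).
  by apply/and5P; split; apply/implyP; apply: ts.
(* [x5] is not next to the chord, so no tightness is known for its partner. *)
pose S := [seq m b (m a q) | q <- [seq q <- [:: x1; x2; x4; x6] | t q]].
have fi : injective (fun q => m b (m a q)) by move=> q r /(can_inj (m1 b))/(can_inj (m1 a)).
have sS : 3 <= size S by rewrite size_map size_filter /= addn0.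
have tt q u1 v : grow q u1 v -> t q -> (forall z1 z2 z3 z4,
   ocy b [:: m b (m a q); z1; z2; z3; z4] -> m g (m b z1) = m b z4) /\ size p2 = 5.
  by move=> G tq; have [_ _ h1 h2] := G _ O2 tq; split; [|apply: h2].
have ttS q : q \in [:: x1; x2; x4; x6] -> t q -> (forall z1 z2 z3 z4,
   ocy b [:: m b (m a q); z1; z2; z3; z4] -> m g (m b z1) = m b z4) /\ size p2 = 5.
  rewrite !inE => /or4P[]/eqP->; [exact: tt G1|exact: tt G2|exact: tt G4|exact: tt G6].
have inS z : z \in S -> exists2 q, z = m b (m a q) & (q \in [:: x1; x2; x4; x6]) && t q.
  by move=> /mapP[q]; rewrite mem_filter andbC => h e; exists q.
have z5 : size p2 = 5.
  case eS: S sS => [//|z S'] _; have /inS[q _ /andP[h1 h2]] : z \in S by rewrite eS mem_head.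
  by have [] := ttS _ h1 h2.
apply: (tight_three O2 z5 _ sS).
- rewrite map_inj_uniq //; apply: filter_uniq; have := ocy_uniq Ox.
  apply: subseq_uniq.
  exact: (mask_subseq [:: false; true; true; false; true; false; true] [:: x0; x1; x2; x3; x4; x5; x6]).
- by move=> z /inS[q -> /andP[]].
move=> z0 z1 z2 z3 z4 /inS[q -> /andP[h1 h2]] Oz.
by have [h _] := ttS _ h1 h2; apply: h Oz.
Qed.
End Seven.

(** * Discharging *)

Section Count.
Implicit Types C : {set V}.
Hypothesis nocut : forall X : {set V},
  #|[set p : V * V | [&& p.1 \in X, p.2 \notin X & adj p.1 p.2]]| != 1.

(** Vertex sets, so that each cycle counts once however it is read. *)
Definition cyc a : {set {set V}} := [set C | `[< exists2 p, ocy a p & C = [set x in p] >]].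

Lemma cycP a C : reflect (exists2 p, ocy a p & C = [set x in p]) (C \in cyc a).
Proof. by rewrite inE; apply: asboolP. Qed.

Definition Ucyc a := finset.cover (cyc a).

Lemma UcycP a x : reflect (exists2 p, ocy a p & x \in p) (x \in Ucyc a).
Proof.
apply: (iffP bigcupP) => [[C /cycP[p O ->]]|[p O xp]]; first by rewrite inE; exists p.
by exists [set x in p]; rewrite ?inE //; apply/asboolP; exists p.
Qed.

Lemma cyc_triv a : trivIset (cyc a).
Proof.
apply/trivIsetP => C C' /cycP[p O ->] /cycP[p' O' ->] ne.
rewrite -setI_eq0; apply: contraR ne => /set0Pn[x]; rewrite !inE => /andP[xp xp'].
by have [_ e] := ocy_type O O' xp xp'; apply/eqP/setP => q; rewrite !inE e.
Qed.

Lemma Ucyc_disj a b : a != b -> [disjoint Ucyc a & Ucyc b].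
Proof.
move=> ab; rewrite -setI_eq0; apply: contraR ab => /set0Pn[x].
by rewrite inE => /andP[/UcycP[p O xp] /UcycP[p' O' xp']]; have [->] := ocy_type O O' xp xp'.
Qed.

Lemma Ucyc_cover a x : x \in Ucyc a -> x \in cover m.
Proof. by move=> /UcycP[p O xp]; apply: ocy_cover O xp. Qed.

(** The two colours other than the type are missed once each, at the two ends of the uncoloured
    edge. *)
Lemma cyc_missing a b C : a != b -> C \in cyc a -> #|[set x in C | m b x == x]| = 1.
Proof.
move=> ab /cycP[p [b1 [c [v [s [C1 r]]]]] ->].
have [c' [v' [s' [C2 e2]]]] : exists c' v' s', ocyc m a b c' v' s' /\ v' :: s' =i p.
  have abc : uniq [:: a; b1; c] by case: C1.
  case/or3P: (ord3_case b abc) => /eqP e; first by rewrite e eqxx in ab.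
    by rewrite e; exists c, v, s; split=> // q; rewrite (reads_mem r).
  rewrite e; exists b1, (last v s), (rev (belast v s)); split.
    exact: (ocyc_rev om C1).
  by rewrite rev_cons_last => q; rewrite mem_rev (reads_mem r).
apply/eqP/cards1P; exists v'; apply/setP => x; rewrite !inE.
have [bc bv] : b != c' /\ m b v' = v' by case: (C2); rewrite uniq3 => /and3P[_ _ ->].
apply/andP/eqP => [[xp /eqP xb]|->]; last by rewrite -e2 mem_head bv.
rewrite -e2 in xp; have [[]//|[_ e]] := ocyc_miss om C2 xp xb.
by rewrite e eqxx in bc.
Qed.

Lemma missing_cyc b x : m b x = x -> exists2 a, a != b & x \in Ucyc a.
Proof.
move=> bx; have [a [c [s C]]] := ocyc_ex om bx.
have [ab _ _] := ocyc_neq C; exists a => //; apply/UcycP; exists (x :: s); last exact: mem_head.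
by exists b, c, x, s; split=> //; apply: reads_refl.
Qed.

Lemma fx_cyc a b c : uniq [:: a; b; c] -> nfix m c = #|cyc a| + #|cyc b|.
Proof.
move=> abc; have [ab ac bc] := uniq3_neq abc.
have one d : d != c -> #|[set x in Ucyc d | m c x == x]| = #|cyc d|.
  move=> dc; rewrite -sum1_card (eq_bigl (fun x => (x \in Ucyc d) && (m c x == x))).
    rewrite big_trivIset_cond ?cyc_triv // -sum1_card; apply: eq_bigr => C hC.
    by rewrite sum1_card -(cyc_missing dc hC); apply: eq_card => x; rewrite !inE.
  by move=> x; rewrite inE.
rewrite -(one a) // -(one b) // /nfix.
have -> : [set x | m c x == x] = [set x in Ucyc a | m c x == x] :|: [set x in Ucyc b | m c x == x].
  apply/setP => x; rewrite !inE -andb_orl; have [e|] := eqVneq (m c x) x; rewrite ?andbF ?andbT //.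
  have [d dc xd] := missing_cyc e; apply/esym.
  by case/or3P: (ord3_case d abc) dc => /eqP ed; rewrite -ed ?eqxx ?xd ?orbT.
rewrite cardsU (_ : _ :&: _ = set0) ?cards0 ?subn0 //.
apply/setP => x; rewrite !inE; apply/negP => /andP[/andP[h1 _] /andP[h2 _]].
by move: (Ucyc_disj ab) => /disjointFr/(_ h1); rewrite h2.
Qed.

Lemma def_cyc a b c : uniq [:: a; b; c] -> deficit m = 2 * (#|cyc a| + #|cyc b| + #|cyc c|).
Proof.
move=> abc; have [ab ac bc] := uniq3_neq abc.
rewrite /deficit (bigD1 a) //= (bigD1 b) 1?eq_sym //= (bigD1 c) /=; last by rewrite eq_sym ac eq_sym.
rewrite big1 => [|d /andP[/andP[h1 h2] h3]]; last first.
  by have := ord3_case d abc; rewrite (negPf h1) (negPf h2) (negPf h3).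
have bca : uniq [:: b; c; a] by rewrite uniq3 bc !(eq_sym _ a) ab.
have acb : uniq [:: a; c; b] by rewrite uniq3 ac ab eq_sym.
rewrite (fx_cyc abc) (fx_cyc bca) (fx_cyc acb).
by move: #|cyc a| #|cyc b| #|cyc c|; clear=> *; lia.
Qed.

Lemma cyc_size a C : C \in cyc a -> 5 <= #|C| /\ odd #|C|.
Proof.
move=> /cycP[p O ->]; rewrite cardsE (card_uniqP (ocy_uniq O)).
by split; [apply: (ocy_size O) | apply: ocy_odd O].
Qed.

Definition nout a C := #|[set x in C | m a x \notin C]|.
Definition nshare a b C := #|[set x in C | shared a b x]|.

Lemma so_outs a p : ocy a p -> nout a [set x in p] = outs a p.
Proof.
move=> O; rewrite /nout /outs -size_filter -(card_uniqP (filter_uniq _ (ocy_uniq O))) -cardsE.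
by apply: eq_card => x; rewrite !inE mem_filter andbC.
Qed.

Lemma sg_count a b p : ocy a p -> nshare a b [set x in p] = count (shared a b) p.
Proof.
move=> O; rewrite /nshare -size_filter -(card_uniqP (filter_uniq _ (ocy_uniq O))) -cardsE.
by apply: eq_card => x; rewrite !inE mem_filter andbC.
Qed.

(** The chords pair off the other vertices of the odd set [C]. *)
Lemma so_odd a C : C \in cyc a -> odd (nout a C).
Proof.
move=> hC; have [_ oC] := cyc_size hC; have [m1 _ _] := om.1.
rewrite -[nout a C](addnK #|[set x in C | m a x \in C]|) addnC.
have -> : #|[set x in C | m a x \in C]| + nout a C = #|C|.
  rewrite -(cardsID [set x | m a x \in C] C); congr addn; apply: eq_card => x; rewrite !inE andbC //.
rewrite oddB; last by apply/subset_leq_card/subsetP => x; rewrite inE => /andP[].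
rewrite oC /=; apply: (odd_invol (m1 a)) => x; rewrite !inE => /andP[h1 h2]; rewrite ?m1 ?h1 ?h2 //.
have [p O e] := cycP _ _ hC; apply: (ocy_sees O).
by move: h1; rewrite e inE.
Qed.

Lemma cyc_unc a p x y : ocy a p -> x \in p -> unc m x y -> y \in p.
Proof.
move=> O xp xy.
have [d /eqP dx] := unc_miss om.1 xy.
have [a' [c [s C']]] := ocyc_ex om dx.
have O' : ocy a' (x :: s) by exists d, c, x, s; split=> //; apply: reads_refl.
have [_ e] := ocy_type O O' xp (mem_head _ _).
have [_ _ _ xl _] := C'.
by rewrite -e (unc_uniq om xy xl) mem_last.
Qed.

(** The other two colours and the uncoloured edges stay inside [C], so a single leaving [a]-edge
    would be a bridge; and the number is odd. *)
Lemma so_three a C : C \in cyc a -> 3 <= nout a C.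
Proof.
move=> hC; have := so_odd hC; have [p O e] := cycP _ _ hC; have [m1 m2 m3] := om.1.
suff : nout a C != 1 by case: (nout a C) => [|[|[]]].
apply: contra (nocut C) => /eqP h; rewrite -h; apply/eqP.
rewrite /nout -(card_imset _ (f := fun x => (x, m a x))); last by move=> x y [].
apply: eq_card => -[x y]; rewrite !inE /=; apply/and3P/imsetP => [[xC yC xy]|[z]].
  have yE : y = m a x.
    apply/eqP; rewrite eq_sym; apply: contraR yC => ne; rewrite e inE.
    have xp : x \in p by move: xC; rewrite e inE.
    have [u|] := boolP (unc m x y); first exact: cyc_unc O xp u.
    rewrite /unc xy /= => /forallPn[d /negPn/eqP hd].
    have da : d != a by apply: contraNneq ne => <-; rewrite hd.
    by rewrite -hd; apply: (ocy_closed O xp da).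
  by exists x; rewrite ?inE ?xC -?yE.
rewrite inE => /andP[zC zn] [-> ->]; split=> //; apply: m2.
by apply: contraNneq zn => ->.
Qed.

Lemma shared_Ucyc a b x : shared a b x = (m b (m a x) \in Ucyc b).
Proof. by apply/asboolP/UcycP. Qed.

Lemma pblock_ocy a p x : ocy a p -> x \in p -> pblock (cyc a) x = [set z in p].
Proof.
move=> O xp; apply: def_pblock; rewrite ?cyc_triv ?inE //.
by apply/asboolP; exists p.
Qed.

Lemma five_chain (s1 s2 s3 s4 t1 t2 t3 t4 : bool) : 3 <= s1 + (s2 + (s3 + s4)) ->
  [&& s1 ==> t1, s4 ==> t4, t1 && s2 ==> t2, t2 && s3 ==> t3, t4 && s3 ==> t3
    & t3 && s2 ==> t2] -> [&& s1 ==> t1, s2 ==> t2, s3 ==> t3 & s4 ==> t4].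
Proof.
by case: s1; case: s2; case: s3; case: s4 => //=;
  case: t1; case: t2; case: t3; case: t4.
Qed.

(** At most one vertex of the 5-cycle is unshared, so the shared ones stay connected along it and
    [share_next] gives them a common partner. *)
Lemma five_four a b p p1 p3 x y : uniq [:: a; b; g] -> ocy a p -> size p = 5 ->
  4 <= count (shared a b) p -> x \in p -> y \in p -> ocy b p1 -> ocy b p3 ->
  m b (m a x) \in p1 -> m b (m a y) \in p3 -> p3 =i p1.
Proof.
move=> abg O sz h4 xp yp O1 O3 hx hy.
pose t q := m b (m a q) \in p1.
suff st : shared a b y ==> t y.
  have ty : t y by move/implyP: st; apply; apply: sharedI O3 hy.
  by have [_ e] := ocy_type O1 O3 ty hy.
have [x1 [x2 [x3 [x4 [Ox e]]]]] := size5_from O sz xp.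
have nx q q' s : ocy a [:: q, q' & s] -> t q && shared a b q' ==> t q'.
  move=> Oq; apply/implyP => /andP[tq /asboolP[p4 O4 h]].
  by rewrite /t -(share_next abg Oq O1 O4 tq h).
have O1' := ocy_rot1 Ox; have O2' := ocy_rot1 O1'; have O3' := ocy_rot1 O2'.
have O4' := ocy_rot1 O3'; rewrite /= in O1' O2' O3' O4'.
have M := ocy_mirror Ox; have M4 := ocy_mirror O4'.
have M3 := ocy_mirror O3'; rewrite /rev /= in M M4 M3.
have tx : t x by [].
have h3 : 3 <= shared a b x1 + (shared a b x2 + (shared a b x3 + shared a b x4)).
  have sx : shared a b x by apply: sharedI O1 hx.
  move: h4; rewrite -!size_filter.
  rewrite (perm_size (_ : perm_eq _ [seq q <- [:: x; x1; x2; x3; x4] | shared a b q])); last first.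
    by apply: uniq_perm; rewrite ?filter_uniq ?(ocy_uniq O) ?(ocy_uniq Ox) // => q; rewrite !mem_filter e.
  by rewrite size_filter /= sx addn0.
have := five_chain h3 (t1 := t x1) (t2 := t x2) (t3 := t x3) (t4 := t x4).
have n1 := nx _ _ _ Ox; have n4 := nx _ _ _ M; rewrite tx /= in n1 n4.
rewrite n1 n4 (nx _ _ _ O1') (nx _ _ _ O2') (nx _ _ _ M4) (nx _ _ _ M3) => /(_ isT) /and4P[k1 k2 k3 k4].
move: yp; rewrite -e !inE => /orP[/eqP->|]; first by rewrite tx implybT.
by case/or4P => /eqP->.
Qed.

Definition poorC a C := (#|C| == 5) || (#|C| == 7) && (nout a C == 3).
(** With at most one shared vertex a poor cycle meets its own demand, as 9 + 1 = 10. *)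
Definition needy a b C := poorC a C && (2 <= nshare a b C).

Lemma poorC_ocy a p : ocy a p -> poorC a [set x in p] = poor a p.
Proof. by move=> O; rewrite /poorC /poor so_outs // cardsE (card_uniqP (ocy_uniq O)). Qed.

Lemma sg_so a b C : uniq [:: a; b; g] -> C \in cyc a -> nshare a b C <= nout a C.
Proof.
move=> abg /cycP[p O ->]; apply/subset_leq_card/subsetP => x; rewrite !inE => /andP[xp sx].
by rewrite xp /= (shared_subout abg O xp sx).
Qed.

Lemma so_size a C : nout a C <= #|C|.
Proof. by apply/subset_leq_card/subsetP => x; rewrite inE => /andP[]. Qed.

Lemma so_five a C : C \in cyc a -> #|C| = 5 -> nout a C = 5.
Proof.
move=> /cycP[p O ->] h; rewrite -[RHS]h; apply: eq_card => x; rewrite !inE.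
case xp: (x \in p) => //=; apply: (chord5 O _ xp).
by rewrite -h cardsE (card_uniqP (ocy_uniq O)).
Qed.

(** * Payments between partners *)

Section Pay.
Variables (a b : 'I_3).
Hypothesis abg : uniq [:: a; b; g].
Let bag : uniq [:: b; a; g]. Proof. exact: uniq3_swap. Qed.

(* A needy cycle with [k] shared vertices asks [1 - 1/k] from the partner at each of them;
   the unit is [1/60], so that [k = 2, 3, 4, 5] give integers *)
Definition tax C := if needy b a C then 60 - 60 %/ nshare b a C else 0.
Definition partner x := pblock (cyc b) (m b (m a x)).
Definition pay C := \sum_(x in C | shared a b x) tax (partner x).
Definition payers C := [set x in C | shared a b x && needy b a (partner x)].

Lemma needy_sg C : C \in cyc b -> needy b a C -> 2 <= nshare b a C <= 5.
Proof.
move=> hC /andP[pr ->] /=; apply: leq_trans (sg_so bag hC) _.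
by case/orP: pr => [/eqP<-|/andP[_ /eqP->]] //; apply: so_size.
Qed.

Lemma partner_cyc x : shared a b x -> partner x \in cyc b.
Proof. by rewrite shared_Ucyc => h; apply: pblock_mem. Qed.

Lemma pay_card C : pay C + \sum_(x in payers C) 60 %/ nshare b a (partner x) = 60 * #|payers C|.
Proof.
rewrite /pay (bigID (fun x => needy b a (partner x))) /= addnC.
rewrite [X in _ + (_ + X)]big1 => [|x /andP[_ /negPf h]]; last by rewrite /tax h.
rewrite addn0 mulnC -sum_nat_const.
rewrite [X in _ + X](eq_bigl (fun x => x \in payers C)) => [|x]; last by rewrite !inE andbA.
rewrite -big_split /=; apply: eq_bigr => x; rewrite inE => /and3P[_ _ h].
by rewrite /tax h subnKC // leq_div.
Qed.

Lemma payers_sg C : #|payers C| <= nshare a b C.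
Proof. by apply/subset_leq_card/subsetP => x; rewrite !inE => /and3P[-> ->]. Qed.

(** A poor cycle and a needy partner would both have length 5, and then by [five_unique] the partner
    has only this one shared vertex. *)
Lemma poor_payers C : C \in cyc a -> poorC a C -> #|payers C| = 0.
Proof.
move=> /cycP[p O ->]; rewrite poorC_ocy // => pr; apply/eqP; rewrite cards_eq0; apply/eqP/setP => x.
rewrite !inE; apply/negP => /and3P[xp /asboolP[p' O' h]]; rewrite /partner (pblock_ocy O' h) /needy poorC_ocy //.
move=> /andP[pr' s2].
have [z z'] := poor_share abg O O' pr pr' xp h.
have /card_gt1P[u [v []]] := s2; rewrite !inE => /andP[up /asboolP[p1 O1 h1]].
move=> /andP[vp /asboolP[p2 O2 h2]]; have [m1 _ _] := om.1.
have hx : m a (m b (m b (m a x))) \in p by rewrite !m1.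
have e w (q : seq V) : w \in p' -> ocy a q -> m a (m b w) \in q -> w = m b (m a x).
  by move=> wp Oq hq; apply: (five_unique bag O' O Oq z' z h hx wp hq).
by rewrite (e _ _ up O1 h1) (e _ _ vp O2 h2) eqxx.
Qed.

(** A partner with [k >= 4] shared vertices is a 5-cycle and by [five_four] shares only with [C];
    the [k] payments to it save [60 %/ k] each, 60 in all. Without such a partner each of at least
    three payments saves 20 or more. *)
Lemma pay_three C : C \in cyc a -> 3 <= #|payers C| -> pay C + 60 <= 60 * #|payers C|.
Proof.
move=> hC h3; rewrite -pay_card leq_add2l.
have [/existsP[x /andP[xT s4]]|] := boolP [exists x, (x \in payers C) && (4 <= nshare b a (partner x))].
  set C' := partner x in s4.
  move: (xT); rewrite inE => /and3P[xC sx nd]; have hC' := partner_cyc sx.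
  have [s2 s5] := andP (needy_sg hC' nd).
  have c5 : #|C'| = 5.
    case/andP: nd => /orP[/eqP //|/andP[_ /eqP o3]] _.
    by have := sg_so bag hC'; rewrite o3 => h; have := leq_trans s4 h.
  have [p O eC] := cycP _ _ hC; have [p' O' eC'] := cycP _ _ hC'; have [m1 _ _] := om.1.
  rewrite -/C' in eC' hC' nd s2 s5 c5.
  have xp : x \in p by move: xC; rewrite eC inE.
  have hx : m b (m a x) \in p'.
    have : m b (m a x) \in C' by rewrite /C' /partner mem_pblock -shared_Ucyc.
    by rewrite eC' inE.
  have back y : y \in C' -> shared b a y -> m a (m b y) \in p.
    rewrite eC' inE => yp /asboolP[q Oq hq].
    have z' : size p' = 5 by rewrite -c5 eC' cardsE (card_uniqP (ocy_uniq O')).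
    have k4 : 4 <= count (shared b a) p' by rewrite -sg_count // -eC'.
    by rewrite -(five_four bag O' z' k4 hx yp O Oq _ hq) ?m1.
  pose S := [set m a (m b y) | y in [set y in C' | shared b a y]].
  have fi : injective (fun y => m a (m b y)) by move=> y z /(can_inj (m1 a))/(can_inj (m1 b)).
  have ST : S \subset [set z in payers C | partner z == C'].
    apply/subsetP => z /imsetP[y]; rewrite inE => /andP[yC sy] ->.
    have yp' : y \in p' by move: yC; rewrite eC' inE.
    have ep : partner (m a (m b y)) = C' by rewrite /partner !m1 (pblock_ocy O' yp').
    rewrite !inE ep nd eqxx !andbT eC inE back //=.
    by apply: (sharedI O'); rewrite !m1.
  apply: (@leq_trans (\sum_(z in S) 60 %/ nshare b a C')).
    rewrite sum_nat_const card_imset // -/(nshare b a C').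
    by move: s4 s5; case: (nshare b a C') => [|[|[|[|[|[|]]]]]].
  rewrite [X in _ <= X](bigID (mem S)) /=; apply: leq_trans (leq_addr _ _).
  rewrite [X in _ <= X](eq_bigl (mem S)) => [|z]; last first.
    rewrite andbC /=; case zS: (z \in S) => //=.
    by have := subsetP ST _ zS; rewrite inE => /andP[->].
  by apply: leq_sum => z zS; have := subsetP ST _ zS; rewrite inE => /andP[_ /eqP->].
move/existsPn => h; apply: (@leq_trans (\sum_(x in payers C) 20)).
  by rewrite sum_nat_const; move: h3; move: #|_|; clear=> *; lia.
apply: leq_sum => x xT; have := h x; rewrite xT /= -ltnNge.
move: xT; rewrite inE => /and3P[_ sx nd]; have := needy_sg (partner_cyc sx) nd.
by case: (nshare _ _ _) => [|[|[|[|]]]].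
Qed.

(** In units of 60: a poor cycle pays nothing, owns 10 and, if needy, is refunded all its shared
    vertices but one. Any other pays at most one unit per shared vertex. From length 11 on it can
    afford this, at length 9 [pay_three] covers the lack of one unit, and at length 7 [seven_slack]
    is needed as well. *)
Lemma cycle_balance C : C \in cyc a -> 60 * (9 + nshare a b C) + pay C <=
  60 * (2 * (#|C| - 5) + 2 * nout a C) + (if needy a b C then 60 * (nshare a b C - 1) else 0).
Proof.
move=> hC; have [c5 oC] := cyc_size hC; have o3 := so_three hC; have oo := so_odd hC.
have so' := sg_so abg hC; have pc := pay_card C; have ps := payers_sg C; have p3 := pay_three hC.
have pp := poor_payers hC; have s5 := @so_five _ C hC.
have pcl : pay C <= 60 * #|payers C| by rewrite -pc leq_addr.
have [pr|pr] := boolP (poorC a C).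
  rewrite (pp pr) muln0 leqn0 in pcl; rewrite (eqP pcl) addn0 /needy pr /=.
  have e : 2 * (#|C| - 5) + 2 * nout a C = 10.
    by case/orP: pr => [/eqP h|/andP[/eqP-> /eqP->]] //; rewrite h (s5 h).
  by rewrite e; case: ifP; move: (nshare a b C); clear=> *; lia.
rewrite /needy (negPf pr) /= addn0.
move: pr; rewrite /poorC negb_or => /andP[n5 n7].
have [c7|n7'] := eqVneq #|C| 7.
  have o5 : 5 <= nout a C.
    by move: n7 o3 oo; rewrite c7 /=; case: (nout a C) => [|[|[|[|[|]]]]].
  have [T0|Tp] := eqVneq #|payers C| 0.
    move: pcl; rewrite T0 c7; move: so' o5; move: (pay C) (nout a C) (nshare a b C); clear=> *; lia.
  have sl : nshare a b C + 2 <= nout a C.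
    have [x] : exists x, x \in payers C by apply/card_gt0P; rewrite lt0n.
    rewrite inE => /and3P[xC sx nd].
    have [p O eC] := cycP _ _ hC; have [p' O' eC'] := cycP _ _ (partner_cyc sx).
    have hx : m b (m a x) \in p'.
      have : m b (m a x) \in partner x by rewrite /partner mem_pblock -shared_Ucyc.
      by rewrite eC' inE.
    have xp : x \in p by move: xC; rewrite eC inE.
    have z : size p = 7 by rewrite -c7 eC cardsE (card_uniqP (ocy_uniq O)).
    have pr' : poor b p' by case/andP: nd; rewrite eC' poorC_ocy.
    move: o5; rewrite addn2 eC so_outs // sg_count // => o5.
    exact: (seven_slack abg O z o5 xp O' hx pr').
  move: c7 sl so' ps pcl p3 o5; move: (pay C) (nout a C) (nshare a b C) #|payers C| #|C|.
  by clear=> P o s T c *; have [] := ltnP T 3; lia.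
have c9 : 9 <= #|C|.
  by move: c5 oC n5 n7'; move: #|C|; clear; do 9?[case=> //].
have [c9e|c9n] := eqVneq #|C| 9.
  move: c9e so' ps pcl p3 o3; move: (pay C) (nout a C) (nshare a b C) #|payers C| #|C|.
  by clear=> P o s T c *; have [] := ltnP T 3; lia.
have c11 : 11 <= #|C|.
  by move: c9 oC c9n; move: #|C|; clear; do 11?[case=> //].
move: so' ps pcl o3 c11; move: (pay C) (nout a C) (nshare a b C) #|payers C| #|C|.
by clear=> *; lia.
Qed.

(** The map from [x] to [m b (m a x)] matches the shared vertices of the two types, and [k] payments
    of [60 - 60 %/ k] make [60 * (k - 1)]. *)
Lemma pay_total : \sum_(C in cyc a) pay C =
  \sum_(C in cyc b) (if needy b a C then 60 * (nshare b a C - 1) else 0).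
Proof.
have [m1 _ _] := om.1.
rewrite /pay -(big_trivIset_cond _ (cyc_triv a)) /=.
transitivity (\sum_(C in cyc b) \sum_(y in C | shared b a y) tax (pblock (cyc b) y)); last first.
  apply: eq_bigr => C hC; rewrite (eq_bigr (fun=> tax C)) => [|y /andP[yC _]]; last first.
    by rewrite (def_pblock (cyc_triv b) hC yC).
  rewrite (eq_bigl (mem [set y in C | shared b a y])) => [|y]; last by rewrite /= inE.
  rewrite sum_nat_const -/(nshare b a C) /tax; case: ifP => [nd|_]; last by rewrite muln0.
  by have := needy_sg hC nd; case: (nshare b a C) => [|[|[|[|[|[|]]]]]].
rewrite -(big_trivIset_cond _ (cyc_triv b)) /=.
rewrite (reindex_onto (fun y => m a (m b y)) (fun x => m b (m a x))) /= => [|x _]; last by rewrite !m1.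
apply: eq_big => [y|y _]; last by rewrite /partner !m1.
by rewrite !shared_Ucyc !m1 eqxx andbT andbC.
Qed.
End Pay.

(** * Summation over all cycles *)

Definition outset a := [set x in Ucyc a | m a x \notin Ucyc a].

Lemma cyc_Ucyc a C x : C \in cyc a -> x \in C -> x \in Ucyc a.
Proof. by move=> hC xC; apply/bigcupP; exists C. Qed.

Lemma cyc_out a C x : a != g -> C \in cyc a -> x \in C -> m a x \notin C ->
  m a x \notin cover m.
Proof.
move=> ag /cycP[p O ->]; rewrite ![_ \in [set z in p]]inE => xp xn.
exact: (ocy_out O ag xp xn).
Qed.

Lemma outset_cover a x : a != g -> x \in outset a -> m a x \notin cover m.
Proof.
move=> ag; rewrite inE => /andP[/bigcupP[C hC xC] h].
by apply: (cyc_out ag hC xC); apply: contra h; apply: cyc_Ucyc.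
Qed.

Lemma card_outset a : a != g -> #|outset a| = \sum_(C in cyc a) nout a C.
Proof.
move=> ag; rewrite -sum1_card (eq_bigl (fun x => (x \in Ucyc a) && (m a x \notin Ucyc a))).
  rewrite big_trivIset_cond ?cyc_triv //; apply: eq_bigr => C hC.
  rewrite sum1_card; apply: eq_card => x; rewrite [LHS]/in_mem /= inE; case xC: (x \in C) => //=.
  apply/idP/idP => h; first by apply: contra h; apply: cyc_Ucyc.
  by apply: contra (cyc_out ag hC xC h); apply: Ucyc_cover.
by move=> x; rewrite inE.
Qed.

Lemma card_Ucyc a : #|Ucyc a| = \sum_(C in cyc a) #|C|.
Proof. by apply/esym/eqP; apply: cyc_triv. Qed.

Lemma card_shared a b : #|[set x in Ucyc a | shared a b x]| = \sum_(C in cyc a) nshare a b C.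
Proof.
rewrite -sum1_card (eq_bigl (fun x => (x \in Ucyc a) && shared a b x)).
  rewrite big_trivIset_cond ?cyc_triv //; apply: eq_bigr => C hC.
  by rewrite sum1_card; apply: eq_card => x; rewrite !inE.
by move=> x; rewrite inE.
Qed.

Lemma card_link a b : #|[set m a x | x in outset a] :&: [set m b x | x in outset b]| <=
  \sum_(C in cyc a) nshare a b C.
Proof.
rewrite -card_shared; have [m1 _ _] := om.1.
apply: leq_trans (leq_imset_card (m a) _); apply/subset_leq_card/subsetP => z.
rewrite inE => /andP[/imsetP[x xO ->] /imsetP[y yO e]]; apply: imset_f.
by move: xO yO; rewrite !inE shared_Ucyc e m1 => /andP[-> _] /andP[].
Qed.

(** The left side is 19 for each cycle of type [a] or [b] and 10 for each of type [g]; the latter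
    have at least 5 vertices of their own. Over the other two types the payments cancel, and an
    outer end common to both is charged once from either side, which suffices since vertices count
    twice. *)
Lemma order_bound a b : uniq [:: a; b; g] -> 5 * deficit m + 9 * nfix m g <= 2 * #|V|.
Proof.
move=> abg; have bag := uniq3_swap abg.
have [ab ag bg] := uniq3_neq abg.
rewrite (def_cyc abg) (fx_cyc abg).
have [m1 _ _] := om.1; have mi d : injective (m d) := can_inj (m1 d).
pose Z d := [set m d x | x in outset d].
have cZ d : d != g -> #|Z d| = \sum_(C in cyc d) nout d C.
  by move=> dg; rewrite card_imset ?card_outset.
(* The 600 is [60 * 2 * 5], moved over from the subtraction in [#|C| - 5]. *)
have bal d e : uniq [:: d; e; g] -> 60 * (9 * #|cyc d| + \sum_(C in cyc d) nshare d e C) +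
    \sum_(C in cyc d) pay d e C + 600 * #|cyc d| <= 60 * (2 * #|Ucyc d| + 2 * \sum_(C in cyc d) nout d C) +
    \sum_(C in cyc d) (if needy d e C then 60 * (nshare d e C - 1) else 0).
  move=> deg; rewrite card_Ucyc -[in 9 * _]sum1_card -[in 600 * _]sum1_card.
  rewrite !big_distrr /= -!big_split /= !big_distrr /= -!big_split /=.
  apply: leq_sum => C hC; have := cycle_balance deg hC; have [] := cyc_size hC.
  by move: (pay _ _ _) (nout _ _) (nshare _ _ _) #|C| (if _ then _ else _); clear=> *; lia.
have := bal _ _ abg; have := bal _ _ bag; rewrite (pay_total abg) (pay_total bag).
have LG : 5 * #|cyc g| <= #|Ucyc g|.
  rewrite card_Ucyc -sum1_card big_distrr /=; apply: leq_sum => C hC.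
  by have [] := cyc_size hC.
have [l1 l2] := (card_link a b, card_link b a); rewrite setIC in l2.
have dZ d e : d != g -> [disjoint Ucyc e & Z d].
  move=> dg; rewrite disjoint_sym; apply/pred0P => z /=; apply/negP => /andP[/imsetP[x xO ->] h].
  by have := outset_cover dg xO; rewrite (Ucyc_cover h).
have un : #|Ucyc a| + #|Ucyc b| + #|Ucyc g| + #|Z a :|: Z b| <= #|V|.
  have cU (A B : {set V}) : [disjoint A & B] -> #|A :|: B| = #|A| + #|B|.
    by move=> /disjoint_setI0 h; rewrite -cardsUI h cards0 addn0.
  have dU (A B D : {set V}) : [disjoint A & D] -> [disjoint B & D] -> [disjoint A :|: B & D].
    by move=> h1 h2; rewrite -setI_eq0 setIUl !disjoint_setI0 // setU0.
  have dUr (A B D : {set V}) : [disjoint A & B] -> [disjoint A & D] -> [disjoint A & B :|: D].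
    by move=> h1 h2; rewrite disjoint_sym dU // disjoint_sym.
  rewrite -cU; last exact: Ucyc_disj.
  rewrite -cU; last by apply: dU; apply: Ucyc_disj.
  rewrite -cU; first exact: max_card.
  by apply: dUr; apply: (dU _ _ _ (dU _ _ _ (dZ _ _ _) (dZ _ _ _)) (dZ _ _ _)).
have := cardsUI (Z a) (Z b); rewrite (cZ _ ag) (cZ _ bg).
move: l1 l2 LG un; rewrite -/(Z a) -/(Z b).
move: (\sum_(_ in _) nout a _) (\sum_(_ in _) nout b _) (\sum_(_ in _) nshare a b _) (\sum_(_ in _) nshare b a _).
move: (\sum_(_ in _) _) (\sum_(_ in _) _) #|cyc a| #|cyc b| #|cyc g| #|Ucyc a| #|Ucyc b| #|Ucyc g|.
move: #|_ :|: _| #|_ :&: _| #|V|; clear=> *; lia.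
Qed.
End Count.
End Cases.
End Coloring.

Lemma ex_min (A : Type) (P : A -> Prop) (f : A -> nat) : (exists x, P x) ->
  exists2 x, P x & forall y, P y -> f x <= f y.
Proof.
move=> [x Px]; move: {2}(f x) (leqnn (f x)) => n; elim: n x Px => [|n IH] x Px h.
  by exists x => // y _; move: h; rewrite leqn0 => /eqP->.
have [[y [Py hy]]|no] := pselect (exists y, P y /\ f y <= n); first exact: IH hy.
exists x => // y Py; apply: leq_trans h _; rewrite ltnNge; apply/negP => hy.
by apply: no; exists y.
Qed.

(** * Multigraphs *)

Section Mult.
Variables (V : finType) (mu : V -> V -> nat).

(** Only the number of colours on a pair is bounded; which parallel edge carries which colour is
    settled by [edges_of_mcol]. *)
Definition mcol k (m : 'I_k -> V -> V) : Prop := (forall c, involutive (m c)) /\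
  forall x y, x != y -> #|[set c | m c x == y]| <= mu x y.

Definition mdef k (m : 'I_k -> V -> V) := \sum_c #|[set x | m c x == x]|.

Definition cubic_mult := [/\ forall x y, mu x y = mu y x, forall x, mu x x = 0,
  forall x, \sum_y mu x y = 3
  & forall X : {set V}, \sum_(x in X) \sum_(y in ~: X) mu x y != 1].

(** Quantified over all 3-colourings, so that a reduction has to carry over just one colouring
    without raising its deficit. *)
Definition good := forall m3 : 'I_3 -> V -> V, mcol m3 -> exists2 m2 : 'I_2 -> V -> V,
  mcol m2 & 45 * mdef m2 <= 2 * #|V| + 22 * mdef m3.
End Mult.

(** * The simple triangle-free case *)

Section Core.
Variables (V : finType) (adj : rel V).
Hypothesis adjC : symmetric adj.
Hypothesis adj_irr : irreflexive adj.
Hypothesis adj3 : forall x, #|[set y | adj x y]| = 3.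
Hypothesis tri : forall x y z, adj x y -> adj y z -> ~~ adj x z.
Hypothesis nocut : forall X : {set V},
  #|[set p : V * V | [&& p.1 \in X, p.2 \notin X & adj p.1 p.2]]| != 1.
Implicit Types (m : 'I_3 -> V -> V) (a b c d g : 'I_3).

Lemma ext3_ex m0 g : coloring adj m0 -> exists2 m, extremal2 adj m g & deficit m <= deficit m0.
Proof.
move=> c0; have [m1 c1 h1] := ex_min (P := coloring adj) (@deficit V) (ex_intro _ m0 c0).
have o1 : optimal adj m1 by [].
have [m2 o2 h2] := ex_min (P := optimal adj) (fun m => nfix m g) (ex_intro _ m1 o1).
have e2 : extremal adj m2 g by [].
have [m3 e3 h3] := ex_min (P := fun m => extremal adj m g) (fun m => #|V| - #|cover adj m|) (ex_intro _ m2 e2).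
exists m3; last by apply: e3.1.2.
split=> // m' /h3; rewrite leq_sub2lE //.
exact: max_card.
Qed.

Lemma opt_perm m (s : 'I_3 -> 'I_3) : involutive s -> optimal adj m -> optimal adj (fun c => m (s c)).
Proof.
move=> si [[m1 m2 m3] mn]; split; last first.
  move=> m' /mn h; suff -> : deficit (fun c => m (s c)) = deficit m by [].
  by rewrite /deficit [RHS](reindex_inj (inv_inj si)).
split=> [c|c x|c d x cd]; [exact: m1|exact: m2|apply: m3]; apply: contra cd => /eqP h.
by rewrite -(si c) h si.
Qed.

Lemma ext_least m g d : extremal adj m g -> nfix m g <= nfix m d.
Proof.
move=> [om h]; pose s c := if c == g then d else if c == d then g else c.
have si : involutive s.
  move=> c; rewrite /s; case: (c =P g) => [->|/eqP cg].
    by rewrite eqxx; case: eqP.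
  case: (c =P d) => [->|/eqP cd]; first by rewrite eqxx.
  by rewrite (negPf cg) (negPf cd).
by have := h _ (opt_perm si om); rewrite /nfix /s eqxx.
Qed.

Lemma core_two m0 : coloring adj m0 -> exists m e1 e2, [/\ coloring adj m, e1 != e2 &
  45 * (nfix m e1 + nfix m e2) <= 2 * #|V| + 22 * deficit m0].
Proof.
pose a : 'I_3 := inord 0; pose b : 'I_3 := inord 1; pose g : 'I_3 := inord 2.
have abg : uniq [:: a; b; g] by rewrite uniq3 -!(inj_eq val_inj) /= !inordK.
have [ab ag bg] := uniq3_neq abg.
move=> /(ext3_ex g)[m em3 hm]; have ob := order_bound adjC adj_irr adj3 tri em3 nocut abg.
(* Leastness of [g] enters as [3 * nfix m g <= deficit m]. *)
have cm := em3.1.1.1; have [la lb] := (ext_least a em3.1, ext_least b em3.1).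
have de : deficit m = nfix m a + nfix m b + nfix m g.
  rewrite /deficit (bigD1 a) //= (bigD1 b) 1?eq_sym //= (bigD1 g) /=; last by rewrite eq_sym ag eq_sym.
  rewrite big1 => [|d /andP[/andP[h1 h2] h3]]; first by rewrite addn0 addnA.
  by have := ord3_case d abg; rewrite (negPf h1) (negPf h2) (negPf h3).
have [le|lt] := leqP (nfix m a) (nfix m b).
  exists m, a, g; split=> //; move: ob hm de la lb le.
  by move: (nfix m a) (nfix m b) (nfix m g) (deficit m) (deficit m0); clear=> *; lia.
exists m, b, g; split=> //; move: ob hm de la lb lt.
by move: (nfix m a) (nfix m b) (nfix m g) (deficit m) (deficit m0); clear=> *; lia.
Qed.
End Core.

Lemma core_good (V : finType) (mu : V -> V -> nat) : cubic_mult mu ->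
  (forall x y, mu x y <= 1) ->
  (forall x y z, 0 < mu x y -> 0 < mu y z -> mu x z = 0) -> good mu.
Proof.
move=> [muC mu0 mu3 cut] simple tri m0 [i0 c0]; pose adj x y := 0 < mu x y.
have adjE x y : adj x y = mu x y :> nat by rewrite /adj; case: (mu x y) (simple x y) => [|[]].
have adjC : symmetric adj by move=> x y; rewrite /adj muC.
have adj_irr : irreflexive adj by move=> x; rewrite /adj mu0.
have adj3 x : #|[set y | adj x y]| = 3.
  rewrite -(mu3 x) -sum1dep_card big_mkcond /=; apply: eq_bigr => y _.
  by rewrite -adjE; case: (adj x y).
have adjT x y z : adj x y -> adj y z -> ~~ adj x z.
  by move=> xy yz; rewrite /adj (tri _ _ _ xy yz).
have nocut (X : {set V}) :
    #|[set p : V * V | [&& p.1 \in X, p.2 \notin X & adj p.1 p.2]]| != 1.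
  apply: contra (cut X) => /eqP <-; rewrite -sum1dep_card pair_big_dep /=.
  rewrite [X in _ == X]big_mkcond [X in X == _]big_mkcond /=; apply/eqP; apply: eq_bigr => p _.
  by rewrite !inE -adjE; case: (_ \in X); case: (_ \in X) => //=; case: (adj _ _).
have col : coloring adj m0.
  split=> // [c x cx|c d x cd cx].
    have := c0 x (m0 c x); rewrite eq_sym cx => /(_ isT); apply: leq_trans.
    by apply/card_gt0P; exists c; rewrite inE.
  apply: contra cd => /eqP e; have := leq_trans (c0 x (m0 c x) _) (simple _ _).
  by rewrite eq_sym => /(_ cx)/card_le1_eqP h; apply/eqP; apply: h; rewrite inE ?e.
have [m [e1 [e2 [[m1 m2 m3] e12 h]]]] := core_two adjC adj_irr adj3 adjT nocut col.
exists (fun c : 'I_2 => if c == ord0 then m e1 else m e2); last first.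
  by rewrite /mdef big_ord_recl big_ord1 /=.
split=> [c|x y xy]; first by case: ifP.
have mE c : (if c == ord0 :> 'I_2 then m e1 else m e2) = m (if c == ord0 then e1 else e2) by case: ifP.
under eq_finset => c do rewrite mE.
rewrite -adjE; have [c1|] := leqP #|[set c : 'I_2 | m (if c == ord0 then e1 else e2) x == y]| 0.
  exact: leq_trans c1 _.
move=> /card_gt0P[c]; rewrite inE => /eqP cy.
have nx d : m d x = y -> m d x != x by move=> ->; rewrite eq_sym.
have -> : adj x y by rewrite -cy; apply: m2; apply: nx.
apply/card_le1_eqP => d d'; rewrite !inE => /eqP k /eqP k'.
have c3 f f' : m f x = y -> m f' x = y -> f = f'.
  move=> hf hf'; apply/eqP; apply: contraT => ne; have := m3 _ _ _ ne (nx _ hf).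
  by rewrite hf hf' eqxx.
have := c3 _ _ k k'; case: (d =P ord0) => [->|/eqP n]; case: (d' =P ord0) => [->|/eqP n'] // e.
- by rewrite e eqxx in e12.
- by rewrite e eqxx in e12.
apply: val_inj; move: (ltn_ord d) (ltn_ord d') n n'; rewrite -!(inj_eq val_inj) /=.
by move: (val d) (val d'); clear=> *; lia.
Qed.

(** * Kempe changes in multigraphs *)

Section MultKempe.
Variables (V : finType) (mu : V -> V -> nat).
Hypothesis muC : forall x y, mu x y = mu y x.
Implicit Types (m : 'I_3 -> V -> V) (a b c : 'I_3).

Lemma mcol_sym k (m : 'I_k -> V -> V) x y : mcol mu m ->
  #|[set c | m c x == y]| = #|[set c | m c y == x]|.
Proof. by move=> [m1 _]; apply: eq_card => c; rewrite !inE (inv_eq (m1 c)) eq_sym. Qed.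

Lemma mcol_add m b x v : mcol mu m -> m b x = x -> m b v = v -> x != v ->
  #|[set c | m c x == v]| < mu x v ->
  exists2 n : 'I_3 -> V -> V, mcol mu n & mdef n + 2 = mdef m.
Proof.
move=> cm bx bv xv lt; have [m1 m2] := cm; exists (recolor m b (flip x v (m b))).
  split=> [c|]; first by rewrite /recolor; case: eqP => _ //; apply: flip_inv.
  move=> y z yz; have sub : [set c | recolor m b (flip x v (m b)) c y == z] \subset
      [set c | m c y == z] :|: (if (y == x) && (z == v) || (y == v) && (z == x) then [set b] else set0).
    apply/subsetP => c; rewrite !inE /recolor; case: (c =P b) => [->|_ ->//].
    rewrite /flip; case: (y =P x) => [->|_].
      by move=> /eqP<-; rewrite !eqxx /= inE eqxx orbT.
    case: (y =P v) => [->|_ ->//]; move=> /eqP<-.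
    by rewrite !eqxx orbT inE eqxx orbT.
  apply: leq_trans (subset_leq_card sub) _; case: ifP => h; last by rewrite setU0 m2.
  rewrite setUC; apply: leq_trans (leq_card_setU _ _) _; rewrite cards1 add1n.
  case/orP: h => /andP[/eqP-> /eqP->] //.
  by rewrite (mcol_sym _ _ cm) muC.
rewrite /mdef (bigD1 b) //= [RHS](bigD1 b) //= addnAC; congr addn; last first.
  by apply: eq_bigr => c /negPf cb; rewrite /recolor cb.
rewrite /recolor eqxx (cardsD1 x [set y | m b y == y]) (cardsD1 v (_ :\ x)) !inE bx bv !eqxx eq_sym xv /=.
rewrite addnC addnA; congr addn; apply: eq_card => y; rewrite !inE /flip.
have [->|yx] := eqVneq y x; first by rewrite andbF eq_sym (negPf xv).
by have [->|yv] := eqVneq y v; rewrite // (negPf xv).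
Qed.

Lemma kmp_count m a b (K : {set V}) x y : a != b ->
  #|[set c | kempe m a b K c x == y]| = #|[set c | m c x == y]|.
Proof.
move=> ab; rewrite /kempe; case: (x \in K) => //.
have ba : b == a = false by rewrite eq_sym (negPf ab).
pose s c := if c == a then b else if c == b then a else c.
have si : involutive s.
  move=> c; rewrite /s; case: (c =P a) => [->|/eqP ca].
    by rewrite eqxx; case: eqP => // e; rewrite e.
  by case: (c =P b) => [->|/eqP cb]; rewrite ?eqxx // (negPf ca) (negPf cb).
rewrite -(card_imset _ (inv_inj si)); apply: eq_card => c; rewrite !inE.
apply/imsetP/idP => [[d dy ->]|h].
  by move: dy; rewrite inE /s; case: (d =P a) => [_ //|_]; case: (d =P b).
exists (s c); rewrite ?si // inE /s; case: (c =P a) => [ca|/eqP ca].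
  by rewrite ba eqxx -ca.
by case: (c =P b) => [cb|/eqP cb]; rewrite ?eqxx -?cb // (negPf ca) (negPf cb).
Qed.

Lemma mdef_vertex k (m : 'I_k -> V -> V) : mdef m = \sum_x #|[set c | m c x == x]|.
Proof.
rewrite /mdef; under eq_bigr do rewrite -sum1dep_card big_mkcond /=.
by rewrite exchange_big /=; apply: eq_bigr => x _; rewrite -sum1dep_card [RHS]big_mkcond.
Qed.

Lemma kmp_mcol m a b (K : {set V}) : mcol mu m -> a != b ->
  (forall x, x \in K -> m a x \in K) -> (forall x, x \in K -> m b x \in K) ->
  mcol mu (kempe m a b K) /\ mdef (kempe m a b K) = mdef m.
Proof.
move=> [m1 m2] ab Ka Kb; split; last first.
  by rewrite !mdef_vertex; apply: eq_bigr => x _; apply: kmp_count.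
split=> [c x|x y xy]; last by rewrite kmp_count // m2.
have Kd d : (forall x, x \in K -> m d x \in K) -> (m d x \in K) = (x \in K).
  by move=> h; apply/idP/idP => [/h|/h//]; rewrite m1.
rewrite /kempe; case: (c =P a) => [->|/eqP ca].
  by case xK: (x \in K); rewrite ?(Kd a) ?(Kd b) ?xK ?m1.
case: (c =P b) => [->|/eqP cb]; first by case xK: (x \in K); rewrite ?(Kd a) ?(Kd b) ?xK ?m1.
by rewrite !if_same m1.
Qed.

(** An [a]-[b] chain through [x] ends there, so it starts from at most one of [v2] and [v3].
    Exchanging the colours on the chain from the other one frees [b] there, and a free edge to [x]
    can take it. *)
Lemma kempe_add m a b x v2 v3 : mcol mu m -> a != b -> m b x = x -> m a v2 = v2 -> m a v3 = v3 ->
  v2 != v3 -> x != v2 -> x != v3 -> #|[set c | m c x == v2]| < mu x v2 ->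
  #|[set c | m c x == v3]| < mu x v3 -> exists2 n : 'I_3 -> V -> V, mcol mu n & mdef n + 2 = mdef m.
Proof.
move=> cm ab bx a2 a3 v23 x2 x3 l2 l3; have [m1 _] := cm.
have swap v (K : {set V}) : m a v = v -> x != v -> #|[set c | m c x == v]| < mu x v ->
    v \in K -> x \notin K -> (forall x, x \in K -> m b x \in K /\ m a x \in K) ->
    exists2 n : 'I_3 -> V -> V, mcol mu n & mdef n + 2 = mdef m.
  move=> av xv lt vK xK cl; have Ka z (h : z \in K) := (cl z h).2; have Kb z (h : z \in K) := (cl z h).1.
  have [cn <-] := kmp_mcol cm ab Ka Kb.
  apply: (mcol_add cn (b := b) (x := x) (v := v)) => //.
  - by rewrite /kempe (negPf xK).
  - by rewrite /kempe vK eqxx eq_sym (negPf ab).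
  - by rewrite kmp_count.
have [s2 h2 u2] := alt_ext (m1 b) (m1 a) a2; have [s3 h3 u3] := alt_ext (m1 b) (m1 a) a3.
have cl v s : m a v = v -> alt (m b) (m a) v s -> forall x, x \in [set y in v :: s] ->
    m b x \in [set y in v :: s] /\ m a x \in [set y in v :: s].
  by move=> av h y; rewrite !(inE, in_set) -!in_cons => ys; apply: (alt_closed (m1 b) (m1 a) av h ys).
have [xK2|xK2] := boolP (x \in v2 :: s2); last first.
  by apply: (swap v2 [set y in v2 :: s2]) => //; rewrite ?in_set ?mem_head //; apply: cl.
have [xv|xl] := alt_ends (m1 b) (m1 a) h2 xK2 (or_introl bx); first by rewrite xv eqxx in x2.
have v3K : v3 \notin v2 :: s2.
  apply/negP => v3K; have [e|e] := alt_ends (m1 b) (m1 a) h2 v3K (or_intror a3).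
    by rewrite e eqxx in v23.
  by rewrite xl e eqxx in x3.
apply: (swap v3 [set y in v3 :: s3]) => //; rewrite ?in_set ?mem_head //; last exact: cl.
apply: contra v3K => xK3.
have P c z : c \in [:: a; b] -> (m c z \in v2 :: s2) = (z \in v2 :: s2).
  move=> ci; have cc y : y \in v2 :: s2 -> m c y \in v2 :: s2.
    move=> ys; have [k1 k2] := alt_closed (m1 b) (m1 a) a2 h2 ys.
    by move: ci; rewrite !inE => /orP[]/eqP->.
  by apply/idP/idP => [/cc|/cc//]; rewrite m1.
have := alt_const (P := fun z => z \in v2 :: s2) _ _ h3 xK3; rewrite xK2 => <- // z; apply: P; rewrite !inE eqxx ?orbT //.
Qed.
End MultKempe.

(** * Contraction of three vertices *)

(* [h] contracts the three vertices of [X], joined to each other by three edges, to [x'];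
   [r] is a section of [h] *)
Section Contract.
Variables (V V' : finType) (mu : V -> V -> nat) (X : {set V}).
Variables (h : V -> V') (r : V' -> V) (x' : V').
Hypothesis cm : cubic_mult mu.
Hypothesis hr : cancel r h.
Hypothesis hX : forall p, (h p == x') = (p \in X).
Hypothesis rh : forall p, p \notin X -> r (h p) = p.
Hypothesis X3 : #|X| = 3.
Hypothesis inner : \sum_(p in X) \sum_(q in X) mu p q = 6.

Let muC x y : mu x y = mu y x. Proof. by case: cm. Qed.
Let mu0 x : mu x x = 0. Proof. by case: cm. Qed.
Let mu3 x : \sum_y mu x y = 3. Proof. by case: cm. Qed.

Definition contract u v :=
  if u == v then 0 else \sum_(p | h p == u) \sum_(q | h q == v) mu p q.
Local Notation mu' := contract.

(** Cuts of the contraction are cuts of preimages, so no bridge arises. *)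
Lemma contract_fiber (A B : {set V'}) : [disjoint A & B] ->
  \sum_(u in A) \sum_(v in B) mu' u v = \sum_(p | h p \in A) \sum_(q | h q \in B) mu p q.
Proof.
move=> dAB; rewrite [RHS](partition_big h (mem A)) //=; apply: eq_bigr => u uA.
transitivity (\sum_(v in B) \sum_(p | h p == u) \sum_(q | h q == v) mu p q).
  apply: eq_bigr => v vB; rewrite /contract; case: eqP => // e.
  by move: dAB => /disjointFr/(_ uA); rewrite e vB.
rewrite exchange_big /=; apply: eq_big => [p|p _].
  by have [->|] := eqVneq (h p) u; rewrite ?andbF ?andbT.
rewrite [RHS](partition_big h (mem B)) //=; apply: eq_bigr => v vB.
by apply: eq_bigl => q; have [->|] := eqVneq (h q) v; rewrite ?andbF ?andbT.
Qed.

Lemma contract_fib u p : u != x' -> (h p == u) = (p == r u).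
Proof.
move=> ux; apply/eqP/eqP => [e|->]; last exact: hr.
by rewrite -e rh // -hX e.
Qed.

Lemma contract_rout u : u != x' -> r u \notin X.
Proof. by move=> ux; rewrite -hX hr. Qed.

Lemma contractC u v : mu' u v = mu' v u.
Proof.
rewrite /contract (eq_sym v u); case: eqP => // _; rewrite exchange_big /=.
by apply: eq_bigr => q _; apply: eq_bigr => p _.
Qed.

Lemma contract_out u v : u != x' -> v != x' -> u != v -> mu' u v = mu (r u) (r v).
Proof.
move=> ux vx uv; rewrite /contract (negPf uv).
under eq_bigl do rewrite contract_fib //; rewrite big_pred1_eq.
by under eq_bigl do rewrite contract_fib //; rewrite big_pred1_eq.
Qed.

Lemma contract_in v : v != x' -> mu' x' v = \sum_(p in X) mu p (r v).
Proof.
move=> vx; rewrite /contract eq_sym (negPf vx).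
under eq_bigl do rewrite hX; apply: eq_bigr => p _.
by under eq_bigl do rewrite contract_fib //; rewrite big_pred1_eq.
Qed.

Definition outm p := \sum_(q in ~: X) mu p q.

Lemma inner_out p : \sum_(q in X) mu p q + outm p = 3.
Proof.
rewrite -(mu3 p) [RHS](bigID (mem X)) /=; congr addn.
by apply: eq_bigl => q; rewrite inE.
Qed.

Lemma outm_total : \sum_(p in X) outm p = 3.
Proof.
have : \sum_(p in X) (\sum_(q in X) mu p q + outm p) = 9.
  by under eq_bigr do rewrite inner_out; rewrite sum_nat_const X3.
by rewrite big_split /= inner; move: (\sum_(p in X) outm p); clear=> *; lia.
Qed.

(** Both are 3 minus the number of edges from [w] to [p] and [q]: one by the three inner edges, the
    other by the degree of [w]. *)
Lemma outm_opp p q w : p \in X -> q \in X -> w \in X -> uniq [:: p; q; w] -> mu p q = outm w.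
Proof.
move=> pX qX wX u; have XE : X = [set z in [:: p; q; w]].
  apply/esym/eqP; rewrite eqEcard X3 cardsE (card_uniqP u) leqnn andbT.
  by apply/subsetP => z; rewrite !inE => /or3P[]/eqP->.
have sE (F : V -> nat) : \sum_(z in X) F z = F p + (F q + F w).
  rewrite (eq_bigl (mem [:: p; q; w])) => [|z]; last by rewrite XE inE.
  by rewrite -big_uniq //= !big_cons big_nil addn0.
have := inner; have := inner_out w; rewrite !sE !mu0 (muC q p) (muC w p) (muC w q).
by move: (mu p q) (mu p w) (mu q w) (outm w); clear=> *; lia.
Qed.

Lemma contract_cubic : cubic_mult mu'.
Proof.
split; [exact: contractC| by move=> u; rewrite /contract eqxx | |]; last first.
  move=> A; rewrite contract_fiber ?disjoints_subset ?setCK //.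
  have [_ _ _ /(_ (h @^-1: A))] := cm; apply: contra => /eqP<-; apply/eqP.
  by apply: eq_big => [p|p _]; rewrite ?inE //; apply: eq_bigl => q; rewrite !inE.
move=> u; transitivity (\sum_(u' in [set u]) \sum_(v in ~: [set u]) mu' u' v).
  rewrite big_set1 [LHS](bigID (pred1 u)) /= big_pred1_eq /contract eqxx add0n.
  by apply: eq_bigl => v; rewrite !inE.
rewrite contract_fiber ?disjoints_subset ?setCK //; have [->|ux] := eqVneq u x'.
  rewrite -outm_total; apply: eq_big => [p|p _]; rewrite ?inE ?hX //.
  by apply: eq_bigl => q; rewrite !inE hX.
under eq_bigl do rewrite inE contract_fib //; rewrite big_pred1_eq.
rewrite -(mu3 (r u)) [RHS](bigD1 (r u)) //= mu0 add0n.
by apply: eq_bigl => q; rewrite !inE contract_fib.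
Qed.

(** * 3-colourings of the contraction *)

Section Push.
Variable m : 'I_3 -> V -> V.
Hypothesis mc : mcol mu m.
Let m1 : forall c, involutive (m c). Proof. exact: mc.1. Qed.

Definition outX c := [set p in X | m c p \notin X].
Definition exitX c := [pick p in outX c].
(* Each colour keeps at most one of its edges leaving [X] *)
Definition push c u := if u == x' then (if exitX c is Some p then h (m c p) else x') else
  let v := m c (r u) in if v \in X then (if exitX c == Some v then x' else u) else h v.

Lemma exitX_out c p : exitX c = Some p -> p \in X /\ m c p \notin X.
Proof. by rewrite /exitX; case: pickP => // q; rewrite inE => /andP[h1 h2] [<-]. Qed.

Lemma push_inv c : involutive (push c).
Proof.
move=> u; rewrite [push c u]/push; have [->|ux] := eqVneq u x'.
  case e: (exitX c) => [p|]; last by rewrite /push eqxx e.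
  have [pX nX] := exitX_out e.
  by rewrite /push hX (negPf nX) rh // m1 pX e eqxx.
case vX: (m c (r u) \in X); last first.
  rewrite /push hX vX rh ?vX // m1 (negPf (contract_rout ux)); exact: hr.
case: eqP => [e|/eqP/negPf e]; first by rewrite /push eqxx e m1 hr.
by rewrite /push (negPf ux) vX e.
Qed.

Lemma push_exit c v : v != x' -> push c x' = v -> exists2 p, p \in X & m c p = r v.
Proof.
move=> vx; rewrite /push eqxx; case e: (exitX c) => [p|] ev; last by rewrite ev eqxx in vx.
by have [pX nX] := exitX_out e; exists p; rewrite // -ev rh.
Qed.

Lemma push_mcol : mcol mu' push.
Proof.
have [_ m2] := mc.
have half v : v != x' -> #|[set c | push c x' == v]| <= mu' x' v.
  move=> vx; rewrite contract_in //.
  apply: (@leq_trans (\sum_(p in X) #|[set c | m c p == r v]|)); last first.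
    apply: leq_sum => p pX; apply: m2; apply: contraTneq pX => ->.
    exact: contract_rout.
  under [X in _ <= X]eq_bigr do rewrite -sum1dep_card big_mkcond /=.
  rewrite exchange_big /= -sum1dep_card big_mkcond /=; apply: leq_sum => c _.
  case: eqP => // e; have [p pX ep] := push_exit vx e.
  by rewrite (bigD1 p) //= ep eqxx.
split; first exact: push_inv.
move=> u v uv; have [ux|ux] := eqVneq u x'; first by rewrite ux half // -ux eq_sym.
have [vx|vx] := eqVneq v x'.
  rewrite vx contractC; apply: leq_trans (half _ ux); apply/subset_leq_card/subsetP => c.
  by rewrite !inE => /eqP<-; rewrite push_inv.
rewrite contract_out //; apply: leq_trans (m2 (r u) (r v) _); last first.
  by rewrite (inj_eq (can_inj hr)).
apply/subset_leq_card/subsetP => c; rewrite !inE /push (negPf ux).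
case: ifP => vX; first by case: ifP => _; rewrite ?(negPf uv) // eq_sym (negPf vx).
by move=> /eqP<-; rewrite rh ?vX.
Qed.

(** The vertices of [X] that [c] matches inside [X] come in pairs, so those it leads out of [X] and
    those missing it are together odd in number. With no or two edges leaving, a missing vertex of
    [X] thus makes up for [x'] or for the dropped edge; only three leaving edges cost, namely 2. *)
Lemma push_fix c : #|[set u | push c u == u]| <=
  #|[set v | m c v == v]| + (if #|outX c| == 3 then 2 else 0).
Proof.
pose F := [set v | m c v == v]; pose O := outX c.
pose E := if exitX c is Some p then O :\ p else set0.
have sub : r @: ([set u | push c u == u] :\ x') \subset (F :\: X) :|: m c @: E.
  apply/subsetP => v /imsetP[u]; rewrite !inE => /andP[ux] /[swap] ->.
  rewrite /push (negPf ux) (negPf (contract_rout ux)) /=; case: ifP => vX.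
    have [e|e] := eqVneq (exitX c) (Some (m c (r u))); first by rewrite (eq_sym x') (negPf ux).
    move=> _; apply/orP; right; rewrite -[r u](m1 c); apply: imset_f.
    have vO : m c (r u) \in O by rewrite inE vX m1 contract_rout.
    rewrite /E; case e': (exitX c) e => [p|] e.
      by rewrite in_setD1 vO andbT; apply: contraNneq e => ->.
    by move: e'; rewrite /exitX; case: pickP => // /(_ (m c (r u))); rewrite vO.
  by move=> /eqP e; apply/orP; left; rewrite -{2}e rh ?vX ?eqxx.
have cE : #|E| = #|O|.-1.
  rewrite /E /exitX; case: pickP => [p pO|h0]; first by rewrite (cardsD1 p O) pO.
  by rewrite cards0 (eq_card0 (A := O)).
have c1 : #|[set u | push c u == u] :\ x'| <= #|F :\: X| + #|O|.-1.
  rewrite -(card_imset _ (can_inj hr)); apply: leq_trans (subset_leq_card sub) _.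
  apply: leq_trans (leq_card_setU _ _) _; rewrite leq_add2l -cE; exact: leq_imset_card.
have c2 : (x' \in [set u | push c u == u]) <= (#|O| == 0).
  rewrite inE /push eqxx; case e: (exitX c) => [p|].
    by have [pX nX] := exitX_out e; rewrite hX (negPf nX).
  rewrite eqxx lt0b cards_eq0; apply/eqP/setP => p.
  by move: e; rewrite /exitX; case: pickP => // h0 _; rewrite h0 inE.
have c3 : odd (#|O| + #|F :&: X|).
  have : ~~ odd #|X :\: O :\: F|.
    apply: (odd_invol (m1 c)) => p; rewrite !inE => /andP[h1 /andP[h2 pX]] //.
    by move: h2; rewrite (inj_eq (can_inj (m1 c))) h1 m1 pX negbK => ->.
  have := cardsID O X; have := cardsID F (X :\: O).
  have -> : X :&: O = O by apply/setP => p; rewrite !inE; case: (p \in X).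
  have -> : (X :\: O) :&: F = F :&: X.
    apply/setP => p; rewrite !inE; case pX: (p \in X); rewrite ?andbF //= ?andbT negbK.
    by case: eqP => [->|]; rewrite ?pX ?andbF.
  rewrite X3; move: #|X :\: O :\: F| #|O| #|F :&: X| #|X :\: O|; clear=> *; lia.
have oX : #|O| <= 3 by rewrite -X3; apply/subset_leq_card/subsetP => p; rewrite inE => /andP[].
rewrite -/O -/F -(cardsID X F) (cardsD1 x' [set u | push c u == u]).
move: c1 c2 c3 oX; move: (x' \in _) #|O| #|F :&: X| #|F :\: X| #|_ :\ x'|; clear=> b o f g k.
by case: o => [|[|[|[|o]]]] //=; case: b => //=; lia.
Qed.

Lemma outX_total : \sum_c #|outX c| <= 3.
Proof.
have [_ m2] := mc; apply: (@leq_trans (\sum_(p in X) outm p)); last by rewrite outm_total.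
apply: (@leq_trans (\sum_(p in X) \sum_(q in ~: X) #|[set c | m c p == q]|)); last first.
  apply: leq_sum => p pX; apply: leq_sum => q qX; apply: m2; apply: contraTneq pX => ->.
  by move: qX; rewrite inE.
under [X in _ <= X]eq_bigr => p _ do under eq_bigr do rewrite -sum1dep_card big_mkcond /=.
under [X in _ <= X]eq_bigr do rewrite exchange_big /=.
rewrite exchange_big /=; apply: leq_sum => c _.
rewrite -sum1_card big_mkcond [X in _ <= X]big_mkcond /=; apply: leq_sum => p _.
rewrite inE; case: (p \in X) => //=; case: ifP => // nX.
by rewrite (bigD1 (m c p)) ?inE //= eqxx.
Qed.

(* If a colour uses all three edges leaving [X], keeping one of them costs 2, which is
   regained by a Kempe change freeing another colour at one of the two other ends *)
Lemma push_def : exists2 n : 'I_3 -> V' -> V', mcol mu' n & mdef n <= mdef m.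
Proof.
have cp := push_mcol; have [/existsP[a /eqP oa]|] := boolP [exists a, #|outX a| == 3]; last first.
  move=> /existsPn no; exists push => //; apply: leq_sum => c _.
  by have := push_fix c; rewrite (negPf (no c)) addn0.
have oE : outX a = X.
  by apply/eqP; rewrite eqEcard oa X3 leqnn andbT; apply/subsetP => p; rewrite inE => /andP[].
have ob b : b != a -> outX b = set0.
  move=> ba; apply/eqP; rewrite -cards_eq0; have := outX_total.
  rewrite (bigD1 a) //= (bigD1 b) //= oa; move: #|outX b|; clear=> *; lia.
have le : mdef push <= mdef m + 2.
  rewrite /mdef (bigD1 a) //= [X in _ <= X + _](bigD1 a) //= addnAC; apply: leq_add.
    by have := push_fix a; rewrite oa.
  by apply: leq_sum => c /ob oc; have := push_fix c; rewrite oc cards0 addn0.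
have [b ba] : exists b : 'I_3, b != a.
  by exists (if a == ord0 then ord_max else ord0); case: (a =P ord0) => [->//|/eqP]; rewrite eq_sym.
have ex c : c != a -> exitX c = None.
  by move=> ca; rewrite /exitX ob //; case: pickP => // p; rewrite inE.
case e: (exitX a) => [p0|]; last first.
  move: e; rewrite /exitX oE; case: pickP => // h0 _.
  by move: X3; rewrite eq_card0.
have [p0X _] := exitX_out e.
have : 1 < #|X :\ p0| by have := cardsD1 p0 X; rewrite p0X X3 add1n => -[<-].
move=> /card_gt1P[p2 [p3 []]]; rewrite !inE => /andP[p20 p2X] /andP[p30 p3X] p23.
have out p : p \in X -> m a p \notin X by rewrite -{1}oE inE => /andP[].
have fixp p : p \in X -> p != p0 -> push a (h (m a p)) = h (m a p).
  move=> pX pp; rewrite /push hX (negPf (out _ pX)) rh ?out // m1 pX e.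
  by case: eqP => // -[e']; rewrite e' eqxx in pp.
have hinj p q : p \in X -> q \in X -> p != q -> h (m a p) != h (m a q).
  move=> pX qX; apply: contra => /eqP e'; have := congr1 r e'.
  by rewrite !rh ?out // => /(can_inj (m1 a))->.
have room p : p \in X -> p != p0 -> #|[set c | push c x' == h (m a p)]| < mu' x' (h (m a p)).
  move=> pX pp; have hx : h (m a p) != x' by rewrite hX out.
  rewrite (_ : [set c | _] = set0) ?cards0.
    rewrite contract_in // (bigD1 p) //= rh ?out // addn_gt0.
    suff -> : 0 < mu p (m a p) by [].
    have [_ m2] := mc; apply: leq_trans (m2 p (m a p) _).
      by apply/card_gt0P; exists a; rewrite inE.
    by apply: contraNneq (out p pX) => <-.
  apply/setP => c; rewrite !inE; have [->|ca] := eqVneq c a.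
    by rewrite /push eqxx e (negPf (hinj _ _ p0X pX _)) // eq_sym.
  by rewrite /push eqxx ex // eq_sym (negPf hx).
have bx : push b x' = x' by rewrite /push eqxx ex.
have xh p : p \in X -> x' != h (m a p) by move=> pX; rewrite eq_sym hX out.
have ab : a != b by rewrite eq_sym.
have [n cn dn] := kempe_add contractC cp ab bx (fixp _ p2X p20) (fixp _ p3X p30)
  (hinj _ _ p2X p3X p23) (xh _ p2X) (xh _ p3X) (room _ p2X p20) (room _ p3X p30).
exists n => //; move: le; rewrite -dn; move: (mdef n) (mdef m); clear=> *; lia.
Qed.
End Push.

(** * Lifting 2-colourings *)

Definition third_pt p q := odflt p [pick z in X | (z != p) && (z != q)].

Lemma othP p q : p \in X -> q \in X -> p != q ->
  [/\ third_pt p q \in X, third_pt p q != p & third_pt p q != q].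
Proof.
move=> pX qX pq; rewrite /third_pt; case: pickP => [z /and3P[]//|no].
have := cardsD1 q (X :\ p); have := cardsD1 p X.
rewrite (_ : X :\ p :\ q = set0); last first.
  by apply/setP => z; have := no z; rewrite !inE; case: (z \in X); case: (z == p); case: (z == q).
rewrite !inE pX qX eq_sym pq cards0 X3 /=; move: #|X :\ p|; clear=> *; lia.
Qed.

Lemma oth_eq p q z : p \in X -> q \in X -> p != q -> z \in X -> z != p -> z != q -> third_pt p q = z.
Proof.
move=> pX qX pq zX zp zq; have [oX op oq] := othP pX qX pq.
apply/eqP; apply: contraT => oz; have : 4 <= #|X|; last by rewrite X3.
have u : uniq [:: third_pt p q; z; p; q] by rewrite /= !inE !negb_or oz op oq zp zq pq.
rewrite -[4]/(size [:: third_pt p q; z; p; q]) -(card_uniqP u); apply/subset_leq_card/subsetP => w.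
by rewrite !inE => /or4P[]/eqP->.
Qed.

Lemma outm_out p y : y \notin X -> mu p y <= outm p.
Proof. by move=> yX; rewrite /outm (bigD1 y) ?inE //= leq_addr. Qed.

Lemma outm_out2 p y z : y \notin X -> z \notin X -> y != z -> mu p y + mu p z <= outm p.
Proof.
move=> yX zX yz; rewrite /outm (bigD1 y) ?inE //= (bigD1 z) /= ?inE ?zX 1?eq_sym //.
by rewrite addnA leq_addr.
Qed.

Lemma sum_pos (F : V -> nat) : 0 < \sum_(p in X) F p -> exists2 p, p \in X & 0 < F p.
Proof.
move=> s0; have [/existsP[p /andP[h1 h2]]|/existsPn no] := boolP [exists p, (p \in X) && (0 < F p)].
  by exists p.
move: s0; rewrite big1 // => p pX; have := no p; rewrite pX -eqn0Ngt; exact/eqP.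
Qed.

Lemma outm_two : 2 <= \sum_(p in X) outm p. Proof. by rewrite outm_total. Qed.

(** [1 + (p0 == p1)] asks for two units where one vertex serves both colours. *)
Lemma two_slots (F : V -> nat) p0 : p0 \in X -> 0 < F p0 -> 2 <= \sum_(p in X) F p ->
  exists2 p1, p1 \in X & 1 + (p0 == p1) <= F p1.
Proof.
move=> p0X f0; rewrite (bigD1 p0) //=; have [f2|f1] := ltnP 1 (F p0).
  by exists p0; rewrite // eqxx.
have [/existsP[p /and3P[h1 h2 h3]] _|/existsPn no] :=
    boolP [exists p, [&& p \in X, p != p0 & 0 < F p]].
  by exists p; rewrite // eq_sym (negPf h2).
rewrite big1 => [|p /andP[h1 h2]]; last first.
  by have := no p; rewrite h1 h2 /= -eqn0Ngt => /eqP.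
by move: f1; move: (F p0); clear=> *; lia.
Qed.

Section Lift.
Variable n : 'I_2 -> V' -> V'.
Hypothesis nc : mcol mu' n.
Let n1 : forall c, involutive (n c). Proof. exact: nc.1. Qed.

Definition isout c := n c x' != x'.
Definition target c := r (n c x').

Lemma target_out c : isout c -> target c \notin X.
Proof. exact: contract_rout. Qed.

(* [p] and [q] are the vertices of [X] that the colours [c] and [d] do not use inside [X] *)
Definition slots (c d : 'I_2) p q := [/\ p \in X /\ q \in X,
  1 + (p == q) <= outm p /\ 1 + (p == q) <= outm q,
  isout c -> 1 + [&& isout d, p == q & target c == target d] <= mu p (target c)
  & isout d -> 1 + [&& isout c, p == q & target c == target d] <= mu q (target d)].

Lemma slots_sym c d p q : slots c d p q -> slots d c q p.
Proof.
move=> [[h1 h2] [h3 h4] h5 h6]; split=> //; rewrite 1?(eq_sym q p) // => o.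
  by rewrite (eq_sym (target d)); apply: h6.
by rewrite (eq_sym (target d)); apply: h5.
Qed.

Lemma card2 (P : pred 'I_2) : #|[set c | P c]| = P ord0 + P ord_max.
Proof.
rewrite -sum1dep_card big_mkcond /= big_ord_recl big_ord1.
have -> : lift ord0 ord0 = ord_max :> 'I_2 by apply: val_inj.
by case: (P _); case: (P _).
Qed.

Lemma slot_one c : isout c -> exists2 p, p \in X & 0 < mu p (target c).
Proof.
move=> oc; apply: sum_pos; rewrite -contract_in //; have [_ n2] := nc.
apply: leq_trans (n2 x' (n c x') _); last by rewrite eq_sym.
by apply/card_gt0P; exists c; rewrite inE.
Qed.

Lemma slots_half c d : isout c -> ~~ isout d -> exists p q, slots c d p q.
Proof.
move=> oc od; have [p pX mp] := slot_one oc; have op := leq_trans mp (outm_out p (target_out oc)).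
have [q qX hq] := @two_slots outm p pX op outm_two.
exists p, q; split=> //; rewrite ?(negPf od) //; split=> //.
by case: eqP hq => // ->.
Qed.

(** If both colours lead to one vertex, its multiplicity from [X] is at least 2 and serves both; two
    different targets seen from the same vertex of [X] add up in its [outm]. *)
Lemma slots_ex : exists p q, slots ord0 ord_max p q.
Proof.
have [o0|o0] := boolP (isout ord0); have [o1|o1] := boolP (isout ord_max).
- have [p pX mp] := slot_one o0; have op := leq_trans mp (outm_out p (target_out o0)).
  have [e|ne] := eqVneq (target ord0) (target ord_max).
    have [q qX hq] : exists2 q, q \in X & 1 + (p == q) <= mu q (target ord0).
      apply: (@two_slots (fun q => mu q (target ord0)) p pX mp).
      rewrite -contract_in //; have [_ n2] := nc; apply: leq_trans (n2 x' (n ord0 x') _); last by rewrite eq_sym.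
      by rewrite card2 eqxx (can_inj hr e) eqxx.
    have oq := leq_trans hq (outm_out q (target_out o0)).
    exists p, q; rewrite /slots o0 o1 -e eqxx andbT /=; split=> //.
      by split=> //; case: eqP hq oq => // ->.
    by move=> _; case: eqP hq => // ->.
  have [q qX mq] := slot_one o1; have oq := leq_trans mq (outm_out q (target_out o1)).
  exists p, q; rewrite /slots o0 o1 (negPf ne) andbF /=; split=> //.
  have [epq|] := eqVneq p q; last by [].
  have := outm_out2 p (target_out o0) (target_out o1) ne.
  rewrite -epq in mq *; move=> k; split; apply: leq_trans k; move: mp mq; clear=> *; lia.
- exact: slots_half.
- by have [p [q s]] := slots_half o1 o0; exists q, p; apply: slots_sym.
have [p pX op] : exists2 p, p \in X & 0 < outm p by apply: sum_pos; rewrite outm_total.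
have [q qX hq] := @two_slots outm p pX op outm_two.
exists p, q; rewrite /slots (negPf o0) (negPf o1); split=> //; split=> //.
by case: eqP hq => // ->.
Qed.

Section LiftSlots.
Variable s : 'I_2 -> V.
Hypothesis sX : forall c, s c \in X.
Hypothesis s_out : forall w, #|[set c | s c == w]| <= outm w.
Hypothesis s_mu : forall q y, #|[set c | [&& isout c, s c == q & target c == y]]| <= mu q y.

(** Colour [c] joins the two vertices of [X] other than [s c]; [s c] takes over the edge of the
    contracted vertex, or misses [c] if there is none. *)
Definition lift c q := if q \in X then
    (if q == s c then (if isout c then target c else s c) else third_pt q (s c))
  else if isout c && (q == target c) then s c else r (n c (h q)).

Lemma lift_inv c : involutive (lift c).
Proof.
move=> q; rewrite {2}/lift; case qX: (q \in X).
  have [->|ne] := eqVneq q (s c).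
    case: ifP => oc; last by rewrite /lift sX eqxx oc.
    by rewrite /lift (negPf (target_out oc)) oc eqxx.
  have [oX oq os] := othP qX (sX c) ne.
  by rewrite /lift oX (negPf os); apply: oth_eq; rewrite // eq_sym.
case: ifP => [/andP[oc /eqP->]|no]; first by rewrite /lift sX eqxx oc.
have qX' : q \notin X by rewrite qX.
have zx : n c (h q) != x'.
  apply: contraFneq no => e; have e' : n c x' = h q by rewrite -e n1.
  have oc : isout c by rewrite /isout e' hX qX.
  by rewrite oc /target e' rh ?eqxx.
rewrite /lift (negPf (contract_rout zx)) hr n1 rh //.
case: ifP => // /andP[oc /eqP e]; move: (can_inj hr e) => /(can_inj (n1 c)) e2.
by rewrite -hX e2 eqxx in qX'.
Qed.

Lemma lift_mcol : mcol mu lift.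
Proof.
have [_ n2] := nc; split; first exact: lift_inv.
have half x y : x \in X -> y \notin X -> #|[set c | lift c x == y]| <= mu x y.
  move=> xX yX; apply: leq_trans (s_mu x y); apply/subset_leq_card/subsetP => c.
  rewrite !inE /lift xX; have [_|ne] := eqVneq x (s c).
    case: ifP => oc /eqP e; first by rewrite e eqxx.
    by rewrite -e sX in yX.
  move=> /eqP e; have [oX _ _] := othP xX (sX c) ne.
  by rewrite -e oX in yX.
move=> x y xy; have [xX|xX] := boolP (x \in X); have [yX|yX] := boolP (y \in X).
- have [oX ox oy] := othP xX yX xy; have u : uniq [:: x; y; third_pt x y].
    by rewrite uniq3 xy eq_sym ox eq_sym oy.
  (* The colours on a pair inside [X] are those whose [s c] is the third vertex; [outm_opp] turns
     the bound [s_out] there into the multiplicity of the pair. *)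
  rewrite (outm_opp xX yX oX u); apply: leq_trans (s_out _); apply/subset_leq_card/subsetP => c.
  rewrite !inE /lift xX; have [ex|ne] := eqVneq x (s c).
    case: ifP => oc /eqP e; first by have := target_out oc; rewrite e yX.
    by rewrite ex e eqxx in xy.
  move=> /eqP e; have [_ _ os] := othP xX (sX c) ne.
  by rewrite (oth_eq xX yX xy (sX c)) ?eqxx // eq_sym // -e.
- exact: (half _ _ xX yX).
- rewrite muC; apply: leq_trans (half _ _ yX xX); apply/subset_leq_card/subsetP => c.
  by rewrite !inE => /eqP<-; rewrite lift_inv.
have hxy : h x != h y by apply: contra xy => /eqP e; rewrite -(rh xX) e rh.
have -> : mu x y = mu' (h x) (h y) by rewrite contract_out ?hX // !rh.
apply: leq_trans (n2 _ _ hxy).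
apply/subset_leq_card/subsetP => c; rewrite !inE /lift (negPf xX).
case: ifP => [_ /eqP e|_ /eqP<-]; first by rewrite -e sX in yX.
by rewrite hr.
Qed.

(** [h] is injective on the vertices missing [c], since inside [X] only [s c] can be one. *)
Lemma lift_def : mdef lift <= mdef n.
Proof.
apply: leq_sum => c _; rewrite -(@card_in_imset _ _ h).
  apply/subset_leq_card/subsetP => u /imsetP[q]; rewrite !inE => /eqP e ->.
  move: e; rewrite /lift; case: ifP => qX.
    case: ifP => [/eqP es|ne e]; last first.
      by have [_ k _] := othP qX (sX c) (negbT ne); rewrite e eqxx in k.
    case: ifP => oc e; first by have := target_out oc; rewrite e qX.
    by move: qX; rewrite -hX => /eqP->; move: oc => /negbFE.
  case: ifP => [_ e|_ e]; first by rewrite -e sX in qX.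
  by rewrite -{2}e hr.
have inX q : q \in X -> lift c q = q -> q = s c.
  move=> qX; rewrite /lift qX; case: eqP => // /eqP ne e.
  by have [_ k _] := othP qX (sX c) ne; rewrite e eqxx in k.
move=> p q; rewrite !inE => /eqP ep /eqP eq e.
have [pX|pX] := boolP (p \in X).
  have qX : q \in X by rewrite -hX -e hX.
  by rewrite (inX _ pX ep) (inX _ qX eq).
have qX : q \notin X by rewrite -hX -e hX.
by rewrite -(rh pX) e rh.
Qed.
End LiftSlots.

Lemma lift_ex : exists2 m : 'I_2 -> V -> V, mcol mu m & mdef m <= mdef n.
Proof.
have [p [q [[pX qX] [op oq] mp mq]]] := slots_ex.
pose s (c : 'I_2) := if c == ord0 then p else q.
have s0 : s ord0 = p by [].
have s1 : s ord_max = q by [].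
have sX c : s c \in X by rewrite /s; case: ifP.
exists (lift s); last exact: lift_def; apply: lift_mcol => //.
- move=> w; rewrite card2 s0 s1.
  have [ew|pw] := eqVneq p w; last by case: eqP => // <-; apply: leq_trans oq.
  rewrite -ew (eq_sym q); exact: op.
- move=> w y; rewrite card2 s0 s1.
  have [/and3P[o0 /eqP ew /eqP ey]|_] := boolP [&& isout ord0, p == w & target ord0 == y]; last first.
    by case: and3P => // -[o1 /eqP<- /eqP<-]; apply: leq_trans (mq o1).
  by rewrite -ew -ey (eq_sym q) (eq_sym (target ord_max)); apply: mp.
Qed.
End Lift.

Lemma contract_good : #|V'| <= #|V| -> good mu' -> good mu.
Proof.
move=> le gd m3 c3; have [n3 k3 d3] := push_def c3; have [n2 k2 d2] := gd _ k3.
have [m2 c2 e2] := lift_ex k2; exists m2 => //; move: le d3 d2 e2.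
by move: (mdef _) (mdef _) (mdef _) (mdef _) #|V| #|V'|; clear=> *; lia.
Qed.
End Contract.

(** * Induction on the number of vertices *)

Lemma reduce_good (V : finType) (mu : V -> V -> nat) x y z : cubic_mult mu ->
  (forall (V' : finType) (mu' : V' -> V' -> nat), #|V'| < #|V| -> cubic_mult mu' -> good mu') ->
  uniq [:: x; y; z] -> mu x y + mu y z + mu x z = 3 -> good mu.
Proof.
move=> cm IH u e; have [muC mu0 mu3 _] := cm.
have [xy xz yz] : [/\ x != y, x != z & y != z].
  by move: u; rewrite /= !inE negb_or andbT -andbA => /and3P.
pose V' : finType := {v : V | v \notin [:: y; z]}.
have xP : x \notin [:: y; z] by rewrite !inE negb_or xy.
pose x' : V' := Sub x xP; pose X := [set v in [:: x; y; z]].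
(* [y] and [z] are outside the subtype, so [insubd] sends them to the default [x']. *)
pose h (p : V) : V' := insubd x' p; pose r (v : V') : V := val v.
have hr : cancel r h by move=> v; apply: valKd.
have hX p : (h p == x') = (p \in X).
  rewrite -(inj_eq val_inj) /h val_insubd !inE /=.
  by case: (p == y); case: (p == z); rewrite /= ?eqxx ?orbT ?orbF.
have rh p : p \notin X -> r (h p) = p.
  by rewrite inE in_cons negb_or => /andP[_ pX]; rewrite /r /h val_insubd pX.
have X3 : #|X| = 3 by rewrite cardsE (card_uniqP u).
have inner : \sum_(p in X) \sum_(q in X) mu p q = 6.
  have sE (F : V -> nat) : \sum_(p in X) F p = F x + (F y + F z).
    rewrite (eq_bigl (mem [:: x; y; z])) => [|p]; last by rewrite inE.
    by rewrite -big_uniq //= !big_cons big_nil addn0.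
  rewrite !sE !mu0 (muC y x) (muC z x) (muC z y).
  by move: e; move: (mu x y) (mu x z) (mu y z); clear=> *; lia.
have lt : #|V'| < #|V|.
  rewrite card_sig; apply/proper_card/properP; split; first exact/subsetP.
  by exists y; rewrite ?inE ?eqxx.
apply: (contract_good cm hr hX rh X3 inner (ltnW lt)); apply: IH => //.
exact: (contract_cubic cm hr hX rh X3 inner).
Qed.

Lemma dipole_good (V : finType) (mu : V -> V -> nat) x y : cubic_mult mu -> x != y ->
  (forall z, z \in [:: x; y]) -> 2 <= mu x y -> good mu.
Proof.
move=> [muC _ _ _] xy all2 mu2 m3 _; pose f z := if z == x then y else x.
have yx : (y == x) = false by rewrite eq_sym (negPf xy).
have f1 z : f z != z.
  by move: (all2 z); rewrite /f !inE => /orP[]/eqP->; rewrite ?eqxx ?yx ?xy // eq_sym yx.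
have fi : involutive f.
  by move=> z; move: (all2 z); rewrite /f !inE => /orP[]/eqP->; rewrite ?eqxx ?yx ?eqxx.
exists (fun _ : 'I_2 => f); last first.
  rewrite /mdef big1 => [|c _]; first by rewrite muln0.
  by apply/eqP; rewrite cards_eq0; apply/eqP/setP => z; rewrite !inE (negPf (f1 z)).
split=> // u v uv; apply: leq_trans (max_card _) _; rewrite card_ord.
by move: (all2 u) (all2 v) uv; rewrite !inE => /orP[]/eqP-> /orP[]/eqP->; rewrite ?eqxx // muC.
Qed.

(** A triangle of simple edges or a multiple edge lies in a triple with exactly three inner edges,
    except when the graph is a triple edge alone. *)
Lemma all_good (V : finType) (mu : V -> V -> nat) : cubic_mult mu -> good mu.
Proof.
move: {2}#|V| (leqnn #|V|) => n; elim: n V mu => [|n IH] V mu le cm.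
  move=> m3 _; exists (fun _ : 'I_2 => id).
    by split=> // x; move: le; rewrite leqn0 => /eqP/card0_eq/(_ x).
  by rewrite /mdef big1 ?muln0 // => c _; apply/eqP; rewrite -leqn0 (leq_trans (max_card _)).
have IH' (V' : finType) (mu' : V' -> V' -> nat) : #|V'| < #|V| -> cubic_mult mu' -> good mu'.
  by move=> lt; apply: IH; rewrite -ltnS; apply: leq_trans le.
have [muC mu0 mu3 cut] := cm; have red := reduce_good cm IH'.
have split1 x y : x != y -> mu x y + \sum_(z | (z != x) && (z != y)) mu x z = 3.
  by move=> xy; rewrite -(mu3 x) [RHS](bigD1 x) //= mu0 add0n [RHS](bigD1 y) 1?eq_sym.
have [/existsP[x /existsP[y mu2]]|] := boolP [exists x, exists y, 2 <= mu x y]; last first.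
  move=> no2; have mu1 x y : mu x y <= 1.
    rewrite leqNgt; apply: contra no2 => h; apply/existsP; exists x; apply/existsP; exists y.
    exact: h.
  have [[x [y [z [xy yz xz]]]]|notri] :=
      pselect (exists x y z, [/\ 0 < mu x y, 0 < mu y z & 0 < mu x z]).
    have ne p q : 0 < mu p q -> p != q by move=> k; apply: contraTneq k => ->; rewrite mu0.
    apply: (red x y z); first by rewrite /= !inE negb_or andbT -andbA !ne.
    by move: (mu1 x y) (mu1 y z) (mu1 x z) xy yz xz; move: (mu x y) (mu y z) (mu x z); clear=> *; lia.
  apply: core_good => // x y z xy yz; apply/eqP; rewrite eqn0Ngt; apply/negP => xz.
  by apply: notri; exists x, y, z.
have xy : x != y by apply: contraTneq mu2 => ->; rewrite mu0.
have yx : y != x by rewrite eq_sym.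
(* A triple edge is a component, so any third vertex completes a contractible triple. *)
have [mu3x|mu3x] := eqVneq (mu x y) 3.
  have [/existsP[z /andP[zx zy]]|/existsPn no] := boolP [exists z, (z != x) && (z != y)]; last first.
    apply: (dipole_good cm xy) => // z; have := no z; rewrite !inE negb_and !negbK //.
  have z0 p q : mu p q = 3 -> z != p -> z != q -> p != q -> mu p z = 0.
    move=> h zp zq pq; have := split1 _ _ pq; rewrite h (bigD1 z) /=; last by rewrite zp.
    by move: (mu p z); clear=> *; lia.
  apply: (red x y z); first by rewrite /= !inE negb_or xy !(eq_sym _ z) zx zy.
  by rewrite mu3x (z0 x y) // (z0 y x) // muC.
have sx := split1 _ _ xy; have sy := split1 _ _ yx; rewrite (muC y x) in sy.
have e2 : mu x y = 2.
  move: sx mu2 mu3x; move: (mu x y) (\sum_(_ | _) _); clear=> *; lia.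
have [z zyx zP] : exists2 z, (z != y) && (z != x) & 0 < mu y z.
  have [/existsP[z /andP[h1 h2]]|/existsPn no] :=
    boolP [exists z, ((z != y) && (z != x)) && (0 < mu y z)]; first by exists z.
  move: sy; rewrite e2 big1 // => z h; have := no z; rewrite h /= -eqn0Ngt; exact/eqP.
have [zy zx] := andP zyx.
have eyz : mu y z = 1.
  by move: sy; rewrite e2 (bigD1 z) //=; move: zP; move: (mu y z) (\sum_(_ | _) _); clear=> *; lia.
have u : uniq [:: x; y; z] by rewrite /= !inE negb_or xy !(eq_sym _ z) zx zy.
have [exz|nxz] := eqVneq (mu x z) 0; first by apply: (red x y z); rewrite // e2 eyz exz.
have exz : mu x z = 1.
  by move: sx nxz; rewrite e2 (bigD1 z) /= ?zx //; move: (mu x z) (\sum_(_ | _) _); clear=> *; lia.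
(* Four inner edges would leave a single edge out of the triple. *)
have := cut [set v in [:: x; y; z]].
have sE (F : V -> nat) : \sum_(p in [set v in [:: x; y; z]]) F p = F x + (F y + F z).
  rewrite (eq_bigl (mem [:: x; y; z])) => [|p]; last by rewrite inE.
  by rewrite -big_uniq //= !big_cons big_nil addn0.
have oE p : mu p x + (mu p y + mu p z) + \sum_(q in ~: [set v in [:: x; y; z]]) mu p q = 3.
  rewrite -sE -(mu3 p) [RHS](bigID (mem [set v in [:: x; y; z]])) /=; congr addn.
  by apply: eq_bigl => q; rewrite in_setC.
have := oE x; have := oE y; have := oE z; rewrite sE !mu0 (muC y x) (muC z x) (muC z y) e2 eyz exz.
move: (\sum_(_ in _) mu x _) (\sum_(_ in _) mu y _) (\sum_(_ in _) mu z _).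
by clear=> a b c h1 h2 h3; rewrite (_ : a + (b + c) = 1) //; lia.
Qed.

(** Sending each root of [R'] to its root under [R] reaches every component of [R] and identifies
    those of [u] and [v]. *)
Lemma n_comp_split (T : finType) (R R' : rel T) u v : connect_sym R -> connect_sym R' ->
  subrel R' R -> connect R u v -> ~~ connect R' u v -> n_comp R predT < n_comp R' predT.
Proof.
move=> sR sR' sub uv nuv; have subc x y : connect R' x y -> connect R x y.
  by move=> /connectP[p pth ->]; apply/connectP; exists p; rewrite ?(sub_path sub).
pose A := [set x | roots R' x]; pose f := root R.
have nE (Q : rel T) : n_comp Q predT = #|[set x | roots Q x]|.
  by apply: eq_card => x; rewrite !inE andbT.
have rootR x : root R (root R' x) = root R x.
  apply/rootP => //; rewrite sR; apply: subc; exact: connect_root.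
rewrite !nE -/A; apply: (@leq_ltn_trans #|f @: A|).
  apply/subset_leq_card/subsetP => x; rewrite inE => /eqP rx; apply/imsetP; exists (root R' x).
    by rewrite inE roots_root.
  by rewrite /f rootR rx.
rewrite ltn_neqAle leq_imset_card andbT; apply: contra nuv => /imset_injP inj.
rewrite -root_connect //; apply/eqP; apply: inj; rewrite ?inE ?roots_root //.
by rewrite /f !rootR; apply/rootP.
Qed.

(** * From edges to multiplicities *)

Section EdgeLevel.
Variables (V E : finType) (src tgt : E -> V).
Hypothesis ll : loopless src tgt.
Local Notation inc := (incident src tgt).
Implicit Types (e f : E) (x y : V).

Definition joins e x y := ((src e == x) && (tgt e == y)) || ((src e == y) && (tgt e == x)).
Definition mult x y := #|[set e | joins e x y]|.
Definition other e x := if src e == x then tgt e else src e.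

Lemma joinsC e x y : joins e x y = joins e y x.
Proof. by rewrite /joins orbC. Qed.

Lemma joins_other e x y : joins e x y = inc e x && (y == other e x).
Proof.
rewrite /joins /incident /other; have := ll e; have [<-|sx] := eqVneq (src e) x.
  by move=> /negPf n; rewrite (eq_sym (tgt e) (src e)) n andbF orbF eq_sym.
by move=> _ /=; rewrite eq_sym andbC.
Qed.

Lemma joins_neq e x y : joins e x y -> x != y.
Proof.
by apply: contraTneq => ->; rewrite /joins orbb; apply: contra (ll e) => /andP[/eqP-> /eqP->].
Qed.

Lemma inc_two e : \sum_x inc e x = 2.
Proof.
rewrite -[LHS]big_mkcond /= sum1_card -(_ : #|[set src e; tgt e]| = 2); last by rewrite cards2 ll.
by apply: eq_card => x; rewrite !inE !(eq_sym x).
Qed.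

Lemma adjS_sym (S : {set E}) : connect_sym (adjS src tgt S).
Proof.
by apply: sym_connect_sym => x y; apply: eq_existsb => e; rewrite orbC.
Qed.

Lemma mult_cubic : cubic src tgt -> bridgeless src tgt -> cubic_mult mult.
Proof.
move=> cub bl; split.
- by move=> x y; apply: eq_card => e; rewrite !inE joinsC.
- move=> x; apply/eqP; rewrite cards_eq0; apply/eqP/setP => e; rewrite !inE.
  by apply/negbTE/negP => /joins_neq; rewrite eqxx.
- move=> x; rewrite -(cub x) /degree -sum1dep_card [RHS]big_mkcond /=.
  under eq_bigr do rewrite /mult -sum1dep_card big_mkcond /=.
  rewrite exchange_big /=; apply: eq_bigr => e _.
  under eq_bigr do rewrite joins_other; case: (inc e x) => /=; last by rewrite big1.
  by rewrite -big_mkcond big_pred1_eq.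
move=> X; apply/negP => /eqP c1.
(* If the cut has size one, its only edge is a bridge: without it [X] is closed under adjacency. *)
pose D := [set e | (src e \in X) != (tgt e \in X)].
have DE : #|D| = 1.
  rewrite -c1 -sum1dep_card [LHS]big_mkcond /=.
  under [RHS]eq_bigr => x _ do under eq_bigr => y _ do rewrite /mult -sum1dep_card big_mkcond /=.
  under [RHS]eq_bigr => x _ do rewrite exchange_big /=.
  rewrite exchange_big /=; apply: eq_bigr => e _.
  have oE x : \sum_(y in ~: X) (if joins e x y then 1 else 0) = inc e x && (other e x \notin X).
    under eq_bigr do rewrite joins_other; case: (inc e x) => /=; last by rewrite big1.
    rewrite -big_mkcondr; have [oX|oX] := boolP (other e x \in X).
      by rewrite big1 // => y /andP[yX /eqP ey]; rewrite ey inE oX in yX.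
    rewrite (eq_bigl (pred1 (other e x))) ?big_pred1_eq // => y /=.
    by case: eqP => [->|_]; rewrite ?andbF // inE oX.
  under [RHS]eq_bigr do rewrite oE.
  rewrite [RHS]big_mkcond /= (bigD1 (src e)) //= (bigD1 (tgt e)) /= 1?eq_sym ?ll // big1 => [|x /andP[xs xt]].
    have n := negPf (ll e); rewrite /incident /other !eqxx (eq_sym (tgt e)) n orbT /=.
    by case: (src e \in X); case: (tgt e \in X).
  by rewrite /incident !(eq_sym _ x) (negPf xs) (negPf xt) if_same.
have /cards1P[e De] : #|D| == 1 by rewrite DE.
have eD : e \in D by rewrite De inE.
move/negP: (bl e); apply; rewrite /bridge /ncomp.
apply: (@n_comp_split _ _ _ (src e) (tgt e)); try exact: adjS_sym.
- move=> x y /existsP[f /andP[fS h]]; apply/existsP; exists f; rewrite h andbT.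
  by rewrite inE.
- by apply: connect1; apply/existsP; exists e; rewrite inE !eqxx.
have cl : closed (adjS src tgt ([set: E] :\ e)) (mem X).
  move=> x y /existsP[f /andP[]]; rewrite !inE andbT => fe h.
  have : f \notin D by rewrite De inE.
  by rewrite inE negbK => /eqP; case/orP: h => /andP[/eqP-> /eqP->].
by apply/negP => /(closed_connect cl) h; move: eD; rewrite inE h eqxx.
Qed.

Lemma other_inc e x : inc e x -> inc e (other e x).
Proof. by rewrite /incident /other; case: ifP => _; rewrite eqxx ?orbT. Qed.

Lemma other_joins e x : inc e x -> joins e x (other e x).
Proof. by rewrite joins_other eqxx andbT. Qed.

Lemma other_inv e x : inc e x -> other e (other e x) = x.
Proof.
move=> ex; have := other_joins ex; rewrite joinsC joins_other => /andP[_ /eqP h]; exact/esym.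
Qed.

Lemma mcol_of_edges k (S : {set E}) : colorable src tgt k S ->
  exists2 m : 'I_k -> V -> V, mcol mult m & mdef m + 2 * #|S| <= k * #|V|.
Proof.
move=> /existsP[c /forallP cS]; have proper e f x : e \in S -> f \in S -> inc e x -> inc f x ->
    c e = c f -> e = f.
  move=> eS fS ex nfix cef; apply/eqP; apply: contraT => ef.
  have := cS e; rewrite eS /= => /forallP/(_ f); rewrite fS cef eqxx /= implybF /edges_adj ef /=.
  by move=> /existsPn/(_ x); rewrite ex nfix.
pose at_ i x f := [&& f \in S, c f == i & inc f x].
pose m i x := if [pick f | at_ i x f] is Some f then other f x else x.
have mE i x f : at_ i x f -> m i x = other f x.
  rewrite /m => hf; case: pickP => [f' hf'|/(_ f)]; last by rewrite hf.
  case/and3P: hf hf' => fS /eqP cf nfix /and3P[fS' /eqP cf' fx'].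
  by rewrite (proper f' f x) // cf cf'.
have mN i x : (forall f, ~~ at_ i x f) -> m i x = x.
  by move=> no; rewrite /m; case: pickP => // f hf; have := no f; rewrite hf.
have atV i x : (exists f, at_ i x f) \/ (forall f, ~~ at_ i x f).
  have [/existsP h|/existsPn h] := boolP [exists f, at_ i x f]; [by left|by right].
exists m.
  split=> [i x|x y xy].
    have [[f hf]|no] := atV i x; last by rewrite !(mN _ _ no).
    have [fS cf nfix] := and3P hf; rewrite (mE _ _ _ hf) (mE _ _ f) ?other_inv //.
    by rewrite /at_ fS cf other_inc.
  have sel i : i \in [set i | m i x == y] -> exists2 f, at_ i x f & joins f x y.
    rewrite inE => /eqP e; have [[f hf]|no] := atV i x; last by rewrite -e mN ?eqxx in xy.
    by exists f => //; rewrite -e (mE _ _ _ hf); apply: other_joins; case/and3P: hf.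
  apply: (@leq_trans #|c @: [set e | joins e x y]|); last exact: leq_imset_card.
  apply/subset_leq_card/subsetP => i /sel[f /and3P[_ /eqP <- _] fj].
  by apply: imset_f; rewrite inE.
(* Each edge of [S] contributes its colour at both of its ends. *)
suff le : 2 * #|S| <= \sum_i #|[set x | m i x != x]|.
  rewrite -[k in _ <= k * _]card_ord -sum_nat_const.
  apply: leq_trans (leq_add (leqnn _) le) _; rewrite /mdef -big_split /=; apply: leq_sum => i _.
  rewrite -(cardsC [set x | m i x == x]) leq_add2l; apply: eq_leq; apply: eq_card => x.
  by rewrite !inE.
have -> : 2 * #|S| = \sum_(f in S) \sum_x inc f x.
  by under eq_bigr do rewrite inc_two; rewrite sum_nat_const mulnC.
rewrite (partition_big c predT) //=; apply: leq_sum => i _; rewrite exchange_big /=.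
rewrite -sum1dep_card [X in _ <= X]big_mkcond /=; apply: leq_sum => x _.
have [[f hf]|no] := atV i x; last first.
  rewrite big1 // => f /andP[fS cf]; have := no f; rewrite /at_ fS cf /=.
  by case: (inc f x).
have [fS cf nfix] := and3P hf.
rewrite (mE _ _ _ hf) (eq_sym _ x) (joins_neq (other_joins nfix)).
rewrite (bigD1 f) ?fS ?cf //= big1 ?addn0 ?leq_b1 // => f' /andP[/andP[fS' /eqP cf'] ff].
apply/eqP; rewrite eqb0; apply: contra ff => fx'; apply/eqP; apply: (proper _ _ x) => //.
by rewrite cf' (eqP cf).
Qed.

Lemma edges_of_mcol k (m : 'I_k.+1 -> V -> V) : mcol mult m ->
  exists2 S : {set E}, colorable src tgt k.+1 S & k.+1 * #|V| <= mdef m + 2 * #|S|.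
Proof.
move=> [m1 m2]; pose J x y := [set e | joins e x y].
have JC x y : J x y = J y x by apply/setP => e; rewrite !inE joinsC.
(* Colours joining the same two vertices take distinct parallel edges, in the order of the colours *)
pose rk (c : 'I_k.+1) x := #|[set d : 'I_k.+1 | (d < c) && (m d x == m c x)]|.
pose sel c x e := [&& m c x != x, joins e x (m c x) & index e (enum (J x (m c x))) == rk c x].
have sel_other c x e : sel c x e -> sel c (m c x) e.
  move=> /and3P[h1 h2 h3]; rewrite /sel m1 eq_sym h1 joinsC h2 JC (eqP h3) /=; apply/eqP.
  by apply: eq_card => d; rewrite !inE m1 (inv_eq (m1 d)) (eq_sym x).
have sel_inc c x y e : sel c x e -> inc e y -> sel c y e.
  move=> s ey; case/and3P: (s) => _ h _; have nout := sel_other _ _ _ s.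
  move: ey h; rewrite /incident /joins => /orP[]/eqP<- /orP[]/andP[/eqP h1 /eqP h2]; rewrite ?h1 ?h2 //.
have sel_edge c x e f : sel c x e -> sel c x f -> e = f.
  move=> /and3P[_ h2 /eqP h3] /and3P[_ k2 /eqP k3].
  have eJ : e \in enum (J x (m c x)) by rewrite mem_enum inE.
  have fJ : f \in enum (J x (m c x)) by rewrite mem_enum inE.
  by rewrite -(nth_index e eJ) -(nth_index e fJ) h3 k3.
have sel_col c d x e : sel c x e -> sel d x e -> c = d.
  wlog cd : c d / c <= d.
    by move=> w sc sd; have [h|/ltnW h] := leqP c d; [apply: w|apply/esym; apply: w].
  move=> sc sd; apply/val_inj/eqP; rewrite eqn_leq cd leqNgt; apply/negP => lt.
  case/and3P: sc sd => nc jc /eqP ic /and3P[nd jd /eqP id].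
  have e1 : m c x = m d x.
    by move: jc jd; rewrite !joins_other => /andP[_ /eqP->] /andP[_ /eqP->].
  have : rk c x < rk d x; last by rewrite -ic -id e1 ltnn.
  apply/proper_card/properP; split.
    by apply/subsetP => b; rewrite !inE e1 => /andP[h ->]; rewrite (leq_trans h cd).
  by exists c; rewrite !inE ?ltnn // lt e1 eqxx.
have sel_ex c x : m c x != x -> exists e, sel c x e.
  move=> ne; have lt : rk c x < size (enum (J x (m c x))).
    rewrite -cardE; apply: leq_trans (m2 x (m c x) _); last by rewrite eq_sym.
    apply/proper_card/properP; split; first by apply/subsetP => d; rewrite !inE => /andP[].
    by exists c; rewrite !inE ?ltnn.
  have [e0 _] : exists e0, e0 \in enum (J x (m c x)).
    by case: (enum _) lt => // e0 l _; exists e0; rewrite mem_head.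
  exists (nth e0 (enum (J x (m c x))) (rk c x)); rewrite /sel ne index_uniq ?enum_uniq // eqxx andbT.
  by have := mem_nth e0 lt; rewrite mem_enum inE.
pose S := [set e | [exists c, exists x, sel c x e]].
(* The default [ord0] is taken only outside [S]. *)
pose col e := odflt ord0 [pick c | [exists x, sel c x e]].
have colE c x e : sel c x e -> col e = c.
  move=> s; rewrite /col; case: pickP => [d /existsP[y sy]|/(_ c)/existsP[]]; last by exists x.
  have ex : inc e x by case/and3P: s => _; rewrite joins_other => /andP[].
  exact: sel_col (sel_inc _ _ _ _ sy ex) s.
exists S.
  apply/existsP; exists [ffun e => col e]; apply/forallP => e; apply/implyP => eS.
  apply/forallP => f; apply/implyP => fS; apply/implyP => /andP[ef /existsP[v /andP[ev fv]]].
  rewrite !ffunE; apply: contra ef => /eqP ce.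
  move: eS fS ce; rewrite !inE => /existsP[c /existsP[x sx]] /existsP[d /existsP[y sy]].
  rewrite (colE _ _ _ sx) (colE _ _ _ sy) => cd; rewrite -cd in sy.
  by apply/eqP; apply: sel_edge (sel_inc _ _ _ _ sx ev) (sel_inc _ _ _ _ sy fv).
suff le : \sum_c #|[set x | m c x != x]| <= 2 * #|S|.
  have -> : k.+1 * #|V| = \sum_(c < k.+1) #|V| by rewrite sum_nat_const card_ord.
  apply: leq_trans (leq_add (leqnn _) le); rewrite /mdef -big_split /=; apply: leq_sum => i _.
  rewrite -(cardsC [set x | m i x == x]) leq_add2l; apply: eq_leq; apply: eq_card => x.
  by rewrite !inE.
have -> : 2 * #|S| = \sum_(f in S) \sum_x inc f x.
  by under eq_bigr do rewrite inc_two; rewrite sum_nat_const mulnC.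
rewrite (partition_big col predT) //=; apply: leq_sum => c _; rewrite exchange_big /=.
rewrite -sum1dep_card big_mkcond /=; apply: leq_sum => x _; case: ifP => // ne.
have [e s] := sel_ex _ _ ne; have eS : e \in S by rewrite inE; apply/existsP; exists c; apply/existsP; exists x.
rewrite (bigD1 e) /=; last by rewrite eS (colE _ _ _ s) eqxx.
by case/and3P: s => _; rewrite joins_other => /andP[-> _].
Qed.
End EdgeLevel.

(** * From colourings to [nu] *)

Lemma nu_colorable (V E : finType) (src tgt : E -> V) k (S : {set E}) :
  colorable src tgt k S -> #|S| <= nu src tgt k.
Proof. by move=> cS; rewrite /nu (bigD1 S) //= leq_maxl. Qed.

Lemma nu_attained (V E : finType) (src tgt : E -> V) k :
  exists2 S : {set E}, colorable src tgt k.+1 S & #|S| = nu src tgt k.+1.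
Proof.
have c0 : colorable src tgt k.+1 set0.
  apply/existsP; exists [ffun=> ord0]; apply/forallP => e; apply/implyP; by rewrite inE.
have [|S cS] := @eq_bigmax_cond _ (colorable src tgt k.+1) (fun S => #|S|); last by move=> e; exists S.
by apply/card_gt0P; exists set0.
Qed.

(** The claim multiplied by 90, in natural numbers. *)
Lemma nu_bound (V E : finType) (src tgt : E -> V) :
  loopless src tgt -> cubic src tgt -> bridgeless src tgt ->
  22 * #|V| + 44 * nu src tgt 3 <= 90 * nu src tgt 2.
Proof.
move=> ll cub bl; have [S cS <-] := nu_attained src tgt 2.
have [m3 c3 d3] := mcol_of_edges ll cS.
have [m2 c2 d2] := all_good (mult_cubic ll cub bl) c3.
have [S2 cS2 d4] := edges_of_mcol ll c2; have := nu_colorable cS2.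
move: d3 d2 d4; move: (nu _ _ _) (mdef m2) (mdef m3) #|S| #|S2| #|V|; clear=> *; lia.
Qed.

From mathcomp Require Import all_order all_algebra.
From mathcomp Require Import lra.
Import GRing.Theory Num.Theory.
Local Open Scope ring_scope.

Theorem theorem6 (V E : finType) (src tgt : E -> V) :
  loopless src tgt -> cubic src tgt -> bridgeless src tgt ->
  (44%:R / 45%:R) * ((#|V|%:R + 2%:R * (nu src tgt 3)%:R) / 4%:R)
    <= (nu src tgt 2)%:R :> rat.
Proof.
move=> ll cub bl; have := nu_bound ll cub bl; rewrite -(ler_nat rat) natrD !natrM.
move: (nu src tgt 3)%:R (nu src tgt 2)%:R #|V|%:R => x y n; lra.
Qed.
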